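(* Let $0<m<n$, $s:=n-m$, let $Z\subseteq\mathbb{P}^n$ be an $m$-dimensional irreducible complex projective variety and $L\in\mathbb{G}(s,\mathbb{P}^n)$. Let $z\in Z\cap L$ be a smooth point of $Z$ and let $\alpha$ be the minimum angle between $T_zZ$ and $T_zL$ (as subspaces of $T_z\mathbb{P}^n$). Then $$\kappa_Z(L,z)=\frac{1}{\sin\alpha}$$ (where $1/0=\infty$).
   Context: Metrics. $\mathbb{C}^{n+1}$ carries its standard hermitian inner product $\langle\cdot,\cdot\rangle$. The tangent space of $\mathbb{P}^n=\mathbb{P}^n(\mathbb{C})$ at the point represented by $z\in\mathbb{C}^{n+1}\setminus\{0\}$ is modelled as $T_z\mathbb{P}^n=\{\dot z\in\mathbb{C}^{n+1}\mid\langle\dot z,z\rangle=0\}$ with hermitian inner product $\langle\dot u,\dot v\rangle_z=\|z\|^{-2}\langle\dot u,\dot v\rangle$ (Fubini-Study metric). $\mathbb{G}(s,\mathbb{P}^n)$ is the complex Grassmann manifold of $s$-dimensional projective linear subspaces $L\subseteq\mathbb{P}^n$, identified with the Grassmann manifold $\mathbb{G}(s+1,\mathbb{C}^{n+1})$ of $(s+1)$-dimensional linear subspaces $\widehat L\subseteq\mathbb{C}^{n+1}$ (with $L=\mathbb{P}(\widehat L)$). Its hermitian metric is the unitarily invariant one: identifying $T_L\mathbb{G}$ with $\mathrm{Hom}(\widehat L,\widehat L^\perp)$ and writing linear maps as matrices $R,S$ in orthonormal bases, $\langle R,S\rangle=\mathrm{tr}(RS^* )$. Intersection condition number. For a smooth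 point $z$ of $Z$ and $L\in\mathbb{G}(s,\mathbb{P}^n)$ with $z\in L$, the intersection is transversal at $z$ if $T_zZ+T_zL=T_z\mathbb{P}^n$. In this case there are open neighborhoods $U$ of $L$ in $\mathbb{G}(s,\mathbb{P}^n)$ and $V$ of $z$ in $Z$ and a holomorphic map $\gamma\colon U\to V$ (the solution map) with $\tilde L\cap V=\{\gamma(\tilde L)\}$ for all $\tilde L\in U$. One sets $\kappa_Z(L,z):=\|D_L\gamma\|$, the operator norm of $D_L\gamma\colon T_L\mathbb{G}\to T_z\mathbb{P}^n$ with respect to the hermitian norm on $T_L\mathbb{G}$ and the Fubini-Study norm on $T_z\mathbb{P}^n$. If $z\in Z\cap L$ is not a smooth point of $Z$ or the intersection at $z$ is not transversal, $\kappa_Z(L,z):=\infty$. Minimum angle. For nonzero linear subspaces $V_1,V_2$ of a finite dimensional hermitian vector space, $\sphericalangle_{\min}(V_1,V_2):=\min\{\sphericalangle(v_1,v_2)\mid v_1\in V_1\setminus\{0\},\,v_2\in V_2\setminus\{0\}\}$, where $\sphericalangle(v_1,v_2):=\arccos\frac{|\langle v_1,v_2\rangle|}{\|v_1\|\cdot\|v_2\|}$. *)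

(* Defs.v *)
(* Complex geometry of P^n over C = R[i], R an arbitrary realType.

   C^(n+1) is 'rV[C]_n.+1 and linear subspaces are {vspace 'rV[C]_n.+1}.
   A point of P^n is a line (a subspace of dimension 1), and an s-dimensional
   projective subspace L is the linear subspace of dimension s.+1 over it;
   subsets of P^n are sets of lines.  The notations of mpoly clash with those of
   MathComp-Analysis and are left out. *)
From HB Require Import structures.
From mathcomp Require Import all_boot all_order all_algebra.
From mathcomp Require Import all_classical all_reals all_analysis.
From mathcomp Require Import complex.
From mathcomp Require Import -(notations) mpoly.
Set Implicit Arguments.
Unset Strict Implicit.
Unset Printing Implicit Defensive.
Import Order.TTheory GRing.Theory Num.Theory.
Import numFieldNormedType.Exports.
Local Open Scope classical_set_scope.
Local Open Scope ring_scope.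

(* Packaged as a numClosedFieldType because the topology and the norm on a
   numClosedFieldType are not inferred from the bare carrier R[i]. *)
Definition Cplx (R : realType) : numClosedFieldType := R[i].

Section ProjectiveGeometry.
Variables (R : realType) (n : nat).
Local Notation C := (Cplx R).
Local Notation V := 'rV[C]_n.+1.
Local Notation poly := (mpoly n.+1 C).

Definition hnorm (u : V) : R := Num.sqrt (complex.Re (dotmx u u)).

Definition angle (u v : V) : R :=
  acos (ComplexField.Normc.normc (dotmx u v) / (hnorm u * hnorm v)).

(* The angles lie in [0, pi/2]; by compactness the infimum is attained as soon
   as V1 and V2 are nonzero subspaces. *)
Definition min_angle (V1 V2 : set V) : R :=
  inf [set a | exists v1 v2,
    [/\ V1 v1, v1 != 0, V2 v2, v2 != 0 & a = angle v1 v2]].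

Definition has_dim (S : set V) (d : nat) : Prop :=
  exists W : {vspace V}, S = [set` W] /\ \dim W = d.

Definition grass (s : nat) : set {vspace V} := [set L | \dim L = s.+1].

Definition proj_space : set {vspace V} := grass 0.

Definition peval (p : poly) (w : V) : C := meval (fun i => w 0 i) p.

Definition homogeneous (p : poly) : Prop :=
  exists d, p \is ishomog1 d mdeg.

Definition vanishes_on (p : poly) (Z : set {vspace V}) : Prop :=
  forall l w, Z l -> w \in l -> peval p w = 0.

Definition zero_locus (S : set poly) : set {vspace V} :=
  [set l | proj_space l /\ forall p, S p -> vanishes_on p [set l]].

Definition alg_closed (Z : set {vspace V}) : Prop :=
  exists2 S : set poly, S `<=` homogeneous & Z = zero_locus S.

Definition irreducible_variety (Z : set {vspace V}) : Prop :=
  [/\ alg_closed Z, Z !=set0 &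
    forall Z1 Z2, alg_closed Z1 -> alg_closed Z2 ->
      Z `<=` Z1 `|` Z2 -> Z `<=` Z1 \/ Z `<=` Z2].

Definition has_chain (Z : set {vspace V}) (k : nat) : Prop :=
  exists Y : nat -> set {vspace V},
    [/\ forall i, (i <= k)%N -> irreducible_variety (Y i),
        forall i, (i < k)%N -> Y i `<` Y i.+1 & Y k `<=` Z].

(* Krull dimension of the Zariski topology. *)
Definition dim_variety (Z : set {vspace V}) (m : nat) : Prop :=
  has_chain Z m /\ forall k, has_chain Z k -> (k <= m)%N.

(* T_z P^n is modelled by the orthogonal complement of z in C^(n+1). *)
Definition tangent_proj (z : V) : set V := [set v | dotmx v z = 0].

(* Zariski tangent space: polynomials vanishing on Z are those vanishing on the
   affine cone over Z, so that the equations below cut out the tangent space of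
   the cone at z, which contains z by Euler's identity. *)
Definition tangent_variety (Z : set {vspace V}) (z : V) : set V :=
  [set v | tangent_proj z v /\
    forall p : poly, vanishes_on p Z ->
      \sum_(i < n.+1) peval (mderiv i p) z * v 0 i = 0].

Definition tangent_linear (L : {vspace V}) (z : V) : set V :=
  [set v | tangent_proj z v /\ v \in L].

Definition smooth_point (Z : set {vspace V}) (z : V) : Prop :=
  exists m, dim_variety Z m /\ has_dim (tangent_variety Z z) m.

Definition transversal (Z : set {vspace V}) (L : {vspace V}) (z : V) : Prop :=
  [set v1 + v2 | v1 in tangent_variety Z z & v2 in tangent_linear L z]
    = tangent_proj z.

(* The manifold structure of the Grassmannian near L is that of the quotient by
   GL_(n+1): A |-> L (1 + A) is a holomorphic submersion near A = 0.  On the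
   subspace hom_perp L of matrices it is the standard chart sending a linear map
   L -> L^perp to its graph. *)
Definition perturb (L : {vspace V}) (A : 'M[C]_n.+1) : {vspace V} :=
  (linfun (mulmxr (1%:M + A) : V -> V) @: L)%VS.

(* T_L G = Hom(L, L^perp), a linear map being extended by 0 on L^perp; the
   hermitian norm below is then tr(R R^* ) in orthonormal bases of L and
   L^perp. *)
Definition hom_perp (L : {vspace V}) : set 'M[C]_n.+1 :=
  [set A | (forall x y, x \in L -> y \in L -> dotmx (x *m A) y = 0) /\
           (forall y, (forall x, x \in L -> dotmx y x = 0) -> y *m A = 0)].

Definition frobenius (A : 'M[C]_n.+1) : R :=
  Num.sqrt (complex.Re (\tr (A *m (map_mx Num.conj A)^T))).

Definition grass_open (s : nat) (U : set {vspace V}) : Prop :=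
  U `<=` grass s /\
  forall L, U L -> \forall A \near (0 : 'M[C]_n.+1), U (perturb L A).

(* Inverse of the chart of P^n at z that sends t in T_z P^n to the line spanned
   by z + t. *)
Definition proj_coord (z : V) (l : {vspace V}) : V :=
  let w := vpick l in (dotmx z z / dotmx w z) *: w - z.

Definition local_expr (g : {vspace V} -> {vspace V}) (L : {vspace V}) (z : V)
  : 'M[C]_n.+1 -> V := fun A => proj_coord z (g (perturb L A)).

Definition holomorphic_at (g : {vspace V} -> {vspace V}) (L : {vspace V})
  : Prop := differentiable (local_expr g L (vpick (g L))) (0 : 'M[C]_n.+1).

Definition solution_map (s : nat) (Z : set {vspace V}) (L : {vspace V}) (z : V)
    (g : {vspace V} -> {vspace V}) : Prop :=
  exists U W : set {vspace V},
    [/\ grass_open s U /\ U L,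
        grass_open 0 W /\ W <[z]>%VS,
        forall L', U L' -> holomorphic_at g L' &
        forall L', U L' ->
          [set l | (Z `&` W) l /\ (l <= L')%VS] = [set g L']].

(* Operator norm of D_L g : T_L G -> T_z P^n for the hermitian norm on T_L G and
   the Fubini-Study norm on T_z P^n. *)
Definition deriv_norm (g : {vspace V} -> {vspace V}) (L : {vspace V}) (z : V)
  : \bar R :=
  ereal_sup [set x | exists A : 'M[C]_n.+1,
    [/\ hom_perp L A, frobenius A <= 1 &
        x = (hnorm ('d (local_expr g L z) (0 : 'M[C]_n.+1) A) / hnorm z)%:E]].

(* Solution maps at (L, z) agree near L, hence have the same derivative, and
   xget selects its norm. *)
Definition kappa (s : nat) (Z : set {vspace V}) (L : {vspace V}) (z : V)
  : \bar R :=
  if `[< smooth_point Z z /\ transversal Z L z >]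
  then xget 0%E [set x | exists2 g, solution_map s Z L z g & x = deriv_norm g L z]
  else +oo%E.

End ProjectiveGeometry.

(* Main.v *)
Require Import Defs.
From HB Require Import structures.
From mathcomp Require Import all_boot all_order all_algebra.
From mathcomp Require Import all_classical all_reals all_analysis.
From mathcomp Require Import complex.
From mathcomp Require Import -(notations) mpoly.
From mathcomp Require Import ring lra.
Set Implicit Arguments.
Unset Strict Implicit.
Unset Printing Implicit Defensive.
Import Order.TTheory GRing.Theory Num.Theory.
Import numFieldNormedType.Exports.
Local Open Scope classical_set_scope.
Local Open Scope ring_scope.


(** The solution map is differentiated explicitly, and its derivative turns out to be a
    projection whose norm is governed by the minimum angle.

    Write T for T_z Z and LW for T_z L, of dimensions m and n - m.  If T and LW meet
    outside 0, the intersection is not transversal and the minimum angle is 0, so that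
    both sides are infinite.  Otherwise they span T_z P^n.  The differentials at z of the
    equations of Z then separate the points of LW, and there are n - m equations p_j of Z
    whose differentials are dual to a basis b of LW (dual_equations).

    Near z the p_j define Z (locally_complete_intersection).  This is where the dimension
    of Z enters.  A chain of m + 1 irreducible subsets yields m + 1 functions on the affine
    cone over Z that are algebraically independent modulo its ideal (chain_frame).  The
    corresponding partial derivatives extend to m + 1 independent vector fields tangent to
    the cone (frame_tangent), so that the differential of every equation of Z is along Z a
    combination of the differentials of the p_j (gradient_combination).  On the manifold
    p = 0 the finitely many generators of the ideal of Z therefore satisfy a linear
    differential inequality with value 0 at z, and by a discrete Gronwall estimate they
    vanish on that manifold near z (vanishing_propagates).

    A nearby linear space L (1 + A) meets Z near z in the line of a vector
    u A = (z + c *m b) *m (1 + A), where c solves the system p (u A) = 0.  The implicit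
    function theorem, proved by Picard iteration, provides c and the derivative of u
    (local_solution).  In this way a solution map is constructed (solve_solution_map), and
    any other one agrees with it near L (solution_map_eq).  The derivative at L sends A in
    Hom(L, L^perp) to v = y - y J b, where y = z *m A is orthogonal to L and J is the matrix
    of the differentials of the p_j.  The vector v lies in T and v - y in LW
    (derivative_tangent), so that y is the component of v orthogonal to LW.  The ratio of
    the norms of v and y is the inverse of the sine of the angle between v and LW, and its
    supremum is 1 / sin alpha (operator_norm_angle).

    The estimates are carried out over a field with a complete absolute value, for an
    entrywise matrix norm with values in R, and all derivatives are obtained from
    quadratic bounds on remainders. *)


(** * Polynomials vanishing on cones *)

(** Induction along the ring operations, to which evaluations, restrictions to
    lines and derivatives are compatible. *)
Lemma mpoly_ring_ind (k : nat) (A : comNzRingType) (Q : mpoly k A -> Prop) :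
  (forall c, Q (mpolyC k c)) -> (forall i : 'I_k, Q (mpolyX A (mnm1 i))) ->
  (forall p q, Q p -> Q q -> Q (p + q)) ->
  (forall p q, Q p -> Q q -> Q (p * q)) -> forall p, Q p.
Proof.
move=> QC QX QD QM.
have QX' (m : multinom k) : Q (mpolyX A m).
  rewrite mpolyXE_id; elim/big_rec: _ => [|i x _ Qx].
    by have := QC 1; rewrite mpolyC1.
  apply: (QM) => //; elim: (m i) => [|j IH].
    by rewrite expr0 -mpolyC1; apply: QC.
  by rewrite exprS; apply: QM.
elim/mpolyind => [|c m p _ _ Qp]; first by have := QC 0; rewrite mpolyC0.
by apply: QD => //; rewrite -mul_mpolyC; apply: QM.
Qed.

Section PolynomialsOnCones.
Variables (R : realType) (n : nat).
Local Notation C := (Cplx R).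
Local Notation V := 'rV[C]_n.+1.
Local Notation poly := (mpoly n.+1 C).
Implicit Types (p q : poly) (w : V) (Z : set {vspace V}).

Lemma pevalD p q w : peval (p + q) w = peval p w + peval q w.
Proof. exact: mevalD. Qed.

Lemma pevalM p q w : peval (p * q) w = peval p w * peval q w.
Proof. exact: mevalM. Qed.

Lemma pevalC c w : peval (mpolyC n.+1 c) w = c.
Proof. exact: mevalC. Qed.

Lemma pevalX i w : peval (mpolyX C (mnm1 i)) w = w 0 i.
Proof. exact: mevalXU. Qed.

Lemma peval_sum (I : finType) (F : I -> poly) w :
  peval (\sum_i F i) w = \sum_i peval (F i) w.
Proof. exact: raddf_sum. Qed.

(** The restriction of p to the line spanned by w, as a polynomial in the
    scalar. *)
Definition line_restr p w : {poly C} :=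
  mmap (polyC : {rmorphism C -> {poly C}}) (fun i => w 0 i *: 'X) p.

Lemma horner_line_restr p w a : (line_restr p w).[a] = peval p (a *: w).
Proof.
rewrite /line_restr; elim/mpoly_ring_ind: p => [c|i|p q IHp IHq|p q IHp IHq].
- by rewrite mmapC hornerC pevalC.
- by rewrite mmapX mmap1U !hornerE pevalX !mxE mulrC.
- by rewrite mmapD hornerD IHp IHq pevalD.
- by rewrite rmorphM /= hornerM IHp IHq pevalM.
Qed.

Lemma peval_homog d p a w : p \is ishomog1 d mdeg ->
  peval p (a *: w) = a ^+ d * peval p w.
Proof.
move=> /dhomogP hp; rewrite /peval !mevalE mulr_sumr !big_seq.
apply: eq_bigr => m /hp /= <-; rewrite mulrCA; congr (_ * _).
rewrite mdegE -prodrXr -big_split /=; apply: eq_bigr => i _.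
by rewrite !mxE exprMn.
Qed.

Lemma poly_eq0_of_horner (r : {poly C}) : (forall a, r.[a] = 0) -> r = 0.
Proof.
move=> hr; apply/eqP/negPn/negP => r0.
have := @max_poly_roots _ r [seq (i%:R : C) | i <- iota 0 (size r)] r0.
rewrite size_map size_iota ltnn => H; apply/notF/H.
  by apply/allP => x /mapP [i _ ->]; apply/rootP.
by rewrite map_inj_uniq ?iota_uniq// => i j /eqP; rewrite eqr_nat => /eqP.
Qed.

(** The homogeneous components of p along a line are the coefficients of the
    restriction, so that they vanish together with p. *)
Lemma vanish_line_homog p w :
  (forall a, peval p (a *: w) = 0) <->
  (forall d, peval (pihomog mdeg d p) w = 0).
Proof.
have E a : peval p (a *: w) =
    \sum_(d < mmeasure mdeg p) a ^+ d * peval (pihomog mdeg d p) w.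
  rewrite {1}(pihomog_partitionE (leqnn (mmeasure mdeg p))) peval_sum.
  by apply: eq_bigr => d _; apply: peval_homog; apply: pihomogP.
split=> [h d|h a]; last by rewrite E big1// => d _; rewrite h mulr0.
case: (ltnP d (mmeasure mdeg p)) => [ltd|led]; last first.
  suff -> : pihomog mdeg d p = 0 by exact: meval0.
  rewrite pihomogE big_seq_cond big1// => m /andP[mp /eqP hm].
  by move: (mmeasure_mnm_ge (mf := mdeg) (p := p) (m := m)); rewrite hm => /(_ led); rewrite mp.
have h0 : \poly_(i < mmeasure mdeg p) peval (pihomog mdeg i p) w = 0.
  apply: poly_eq0_of_horner => a; rewrite horner_poly -[RHS](h a) E.
  by apply: eq_bigr => i _; rewrite mulrC.
by have := congr1 (fun r : {poly C} => r`_d) h0; rewrite coef_poly ltd coef0.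
Qed.

Lemma line_mem (l : {vspace V}) w w' : \dim l = 1%N -> w \in l -> w != 0 ->
  w' \in l -> exists a, w' = a *: w.
Proof.
move=> dl wl w0 w'l.
have /eqP e : (<[w]> == l)%VS by rewrite eqEdim -memvE wl dl dim_vline w0.
by move: w'l; rewrite -e => /vlineP.
Qed.

Lemma alg_closedP Z : alg_closed Z ->
  forall l, \dim l = 1%N ->
    (forall p, homogeneous p -> vanishes_on p Z -> vanishes_on p [set l]) -> Z l.
Proof.
move=> [S hS ->] l dl h; split=> // p Sp; apply: h; first exact: hS.
move=> l' w [_ /(_ _ Sp)] h' wl'; exact: (h' l').
Qed.

Lemma alg_closed_line Z l : alg_closed Z -> Z l -> \dim l = 1%N.
Proof. by move=> [S _ ->] []. Qed.

(** The lines of Z on which p vanishes are cut out by the homogeneous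
    components of p. *)
Lemma alg_closed_cut Z p : alg_closed Z ->
  alg_closed [set l | Z l /\ vanishes_on p [set l]].
Proof.
move=> [S hS eZ].
exists (S `|` [set pihomog mdeg d p | d in setT]).
  move=> q [/hS //|[d _ <-]]; exists d; exact: pihomogP.
rewrite eZ eqEsubset; split=> l.
  move=> [[pl Sl] vl]; split=> // q [/Sl //|[d _ <-]] l' w -> wl.
  by apply: (vanish_line_homog p w).1 => a; apply: (vl l) => //; apply: memvZ.
move=> [pl Sl]; split; first by split=> // q Sq; apply: Sl; left.
move=> l' w -> wl; rewrite -[w]scale1r; apply: (vanish_line_homog p w).2 => d.
by apply: (Sl _ _ l w) => //; right; exists d.
Qed.

Lemma vanish_nonvanish p l : \dim l = 1%N -> ~ vanishes_on p [set l] ->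
  forall w, w \in l -> w != 0 -> line_restr p w != 0.
Proof.
move=> dl nv w wl w0; apply/eqP => r0; apply: nv => l' w' -> w'l.
have [a ->] := line_mem dl wl w0 w'l.
by rewrite -horner_line_restr r0 horner0.
Qed.

(** Primality of the ideal of an irreducible set, also for polynomials that are
    not homogeneous: on a line where neither factor vanishes identically, both
    restrict to nonzero polynomials in one variable. *)
Lemma irreducible_prime Z p q : irreducible_variety Z ->
  vanishes_on (p * q) Z -> vanishes_on p Z \/ vanishes_on q Z.
Proof.
move=> [cZ _ irr] vpq.
pose Zc r := [set l | Z l /\ vanishes_on r [set l]].
have sub r : Z `<=` Zc r -> vanishes_on r Z.
  by move=> h l w /h[_ /(_ l w)] h' wl; apply: h'.
case: (irr (Zc p) (Zc q)); try exact: alg_closed_cut.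
- move=> l Zl; apply: contrapT => /not_orP[np nq].
  have dl := alg_closed_line cZ Zl.
  have np' : ~ vanishes_on p [set l] by move=> h; apply: np.
  have nq' : ~ vanishes_on q [set l] by move=> h; apply: nq.
  have l0 : l != 0%VS by rewrite -dimv_eq0 dl.
  have w0 : vpick l != 0 by rewrite vpick0.
  have := mulf_neq0 (vanish_nonvanish dl np' (memv_pick l) w0)
    (vanish_nonvanish dl nq' (memv_pick l) w0).
  move/eqP; apply; apply: poly_eq0_of_horner => a.
  rewrite hornerM !horner_line_restr -pevalM; apply: (vpq l) => //.
  exact/memvZ/memv_pick.
- by move=> /sub; left.
- by move=> /sub; right.
Qed.

End PolynomialsOnCones.

(** * Hilbert's basis theorem *)

Section HilbertBasis.

Definition is_ideal (B : comNzRingType) (I : B -> Prop) : Prop :=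
  [/\ I 0, forall a b, I a -> I b -> I (a + b) & forall a b, I b -> I (a * b)].

(** Recursive on the generators, which makes the lifting of generators from
    coefficients to polynomials an induction on the sequence. *)
Fixpoint generated (B : comNzRingType) (s : seq B) (b : B) : Prop :=
  if s is x :: s' then exists c, generated s' (b - c * x) else b = 0.

Definition noetherian (B : comNzRingType) : Prop :=
  forall I : B -> Prop, is_ideal I ->
    exists2 s, {in s, forall x, I x} & forall b, I b -> generated s b.

Lemma generated_ideal (B : comNzRingType) (s : seq B) : is_ideal (generated s).
Proof.
elim: s => [|x s [I0 ID IM]]; split=> //=.
- by move=> a b -> ->; rewrite addr0.
- by move=> a b ->; rewrite mulr0.
- by exists 0; rewrite mul0r subr0.
- move=> a b [c hc] [d hd]; exists (c + d); rewrite mulrDl opprD addrACA.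
  exact: ID.
- by move=> a b [c hc]; exists (a * c); rewrite -mulrA -mulrBr; apply: IM.
Qed.

Lemma generated_mem (B : comNzRingType) (s : seq B) x :
  x \in s -> generated s x.
Proof.
elim: s => [//|y s IH]; rewrite inE => /orP[/eqP ->|/IH h].
  by exists 1; rewrite mul1r subrr; have [] := generated_ideal s.
by exists 0; rewrite mul0r subr0.
Qed.

Lemma generated_sub (B : comNzRingType) (s : seq B) (I : B -> Prop) :
  is_ideal I -> {in s, forall x, I x} -> forall b, generated s b -> I b.
Proof.
move=> [I0 ID IM]; elim: s => [_ b -> //|x s IH hs b [c /IH hc]].
rewrite -[b](subrK (c * x)); apply: ID.
  by apply: hc => y ys; apply: hs; rewrite inE ys orbT.
by apply: IM; apply: hs; rewrite inE eqxx.
Qed.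

Lemma generated_lift (B : comNzRingType) (N : nat) (s : seq {poly B}) (a : B) :
  {in s, forall q : {poly B}, (size q <= N.+1)%N} ->
  generated [seq (q : {poly B})`_N | q <- s] a ->
  exists q, [/\ generated s q, (size q <= N.+1)%N & q`_N = a].
Proof.
elim: s a => [|x s IH] a hs /=; first by move=> ->; exists 0; rewrite size_poly0 coef0.
move=> [c /IH []] => [q qs|q [gq sq qa]]; first by apply: hs; rewrite inE qs orbT.
exists (q + c%:P * x); split.
- by exists c%:P; rewrite addrK.
- rewrite (leq_trans (size_polyD _ _))// geq_max sq mul_polyC.
  by rewrite (leq_trans (size_scale_leq _ _))// hs// inE eqxx.
- by rewrite coefD coefCM qa subrK.
Qed.

Lemma lift_seq (B : comNzRingType) (T : eqType) (f : T -> B) (Q : T -> Prop)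
    (t : seq B) : {in t, forall a, exists2 q, Q q & f q = a} ->
  exists2 s : seq T, {in s, forall q, Q q} & map f s = t.
Proof.
elim: t => [|a t IH] h; first by exists [::].
have [|s hs est] := IH; first by move=> b bt; apply: h; rewrite inE bt orbT.
have [|q Qq fq] := h a; first by rewrite inE eqxx.
exists (q :: s) => [y|]; last by rewrite /= fq est.
by rewrite inE => /orP[/eqP -> //|/hs].
Qed.

(** The ideals L N of the coefficients of degree N of the elements of I of degree at
    most N increase with N, so that they stabilize at some D.  Lifts of generators
    of L 0, ..., L D generate I, by descent on the degree. *)
Lemma noetherian_poly (B : comNzRingType) :
  noetherian B -> noetherian {poly B}.
Proof.
move=> nB I [I0 ID IM].
pose L N a := exists2 q : {poly B}, I q /\ (size q <= N.+1)%N & q`_N = a.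
have Lid N : is_ideal (L N).
  split.
  - by exists 0; rewrite ?coef0// size_poly0.
  - move=> a b [p [Ip sp] <-] [q [Iq sq] <-].
    exists (p + q); last by rewrite coefD.
    by split; [exact: ID|rewrite (leq_trans (size_polyD _ _))// geq_max sp].
  - move=> a b [p [Ip sp] <-]; exists (a%:P * p); last by rewrite coefCM.
    split; first exact: IM.
    by rewrite mul_polyC (leq_trans (size_scale_leq _ _)).
have Lmono N k a : L N a -> L (N + k)%N a.
  move=> [q [Iq sq] <-]; exists ('X^k * q).
    split; first exact: IM.
    have [->|q0] := eqVneq q 0; first by rewrite mulr0 size_poly0.
    by rewrite mulrC size_mulXn// -addSn addnC leq_add2r.
  by rewrite coefXnM ltnNge leq_addl /= addnK.
have Lgen N : exists2 s : seq {poly B},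
    {in s, forall q, I q /\ (size q <= N.+1)%N} &
    forall a, L N a -> generated [seq (q : {poly B})`_N | q <- s] a.
  have [t ht gt] := nB _ (Lid N).
  have [s hs est] := lift_seq (f := fun q : {poly B} => q`_N) ht.
  by exists s => // a /gt; rewrite est.
have [s hs] := choice (fun N => let: ex_intro2 s a b := Lgen N in
  ex_intro (fun s : seq {poly B} =>
    {in s, forall q, I q /\ (size q <= N.+1)%N} /\
    forall a, L N a -> generated [seq (q : {poly B})`_N | q <- s] a) s (conj a b)).
have Lall : is_ideal (fun a => exists N, L N a).
  split; first by exists 0%N; have [] := Lid 0%N.
    move=> a b [N La] [M Lb]; exists (N + M)%N; have [_ + _] := Lid (N + M)%N.
    by apply; [exact: Lmono|rewrite addnC; exact: Lmono].
  by move=> a b [N Lb]; exists N; have [_ _] := Lid N; apply.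
have [t ht gt] := nB _ Lall.
have [D hD] : exists D, {in t, forall a, L D a}.
  elim: t ht {gt} => [_|a t IH ht]; first by exists 0%N.
  have [|D hD] := IH; first by move=> b bt; apply: ht; rewrite inE bt orbT.
  have [|N hN] := ht a; first by rewrite inE eqxx.
  exists (D + N)%N => b; rewrite inE => /orP[/eqP ->|/hD]; last exact: Lmono.
  by rewrite addnC; apply: Lmono.
have LD N a : L N a -> L D a.
  by move=> La; apply: (generated_sub (Lid D) hD); apply: gt; exists N.
pose G := flatten [seq s N | N <- iota 0 D.+1].
have sG N q : (N <= D)%N -> generated (s N) q -> generated G q.
  move=> ND; apply: generated_sub; first exact: generated_ideal.
  move=> x xs; apply: generated_mem; apply/flatten_mapP; exists N => //.
  by rewrite mem_iota add0n ltnS.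
exists G.
  by move=> x /flatten_mapP[N _ /(hs N).1 []].
have IG : forall q, generated G q -> I q.
  apply: generated_sub => // x /flatten_mapP[N _ /(hs N).1 []] //.
have [_ GD GM] := generated_ideal G.
have step N a : (N <= D)%N -> L N a ->
    exists q, [/\ generated G q, (size q <= N.+1)%N & q`_N = a].
  move=> ND /(hs N).2 /generated_lift [|q [gq sq qa]].
    by move=> q /(hs N).1 [].
  by exists q; split=> //; apply: sG gq.
have main N (p : {poly B}) : (size p <= N)%N -> I p -> generated G p.
  elim: N p => [|N IH] p.
    rewrite leqn0 size_poly_eq0 => /eqP -> _.
    by have [] := generated_ideal G.
  move=> sp Ip.
  have [q [gq sq qa]] : exists q, [/\ generated G q, (size q <= N.+1)%N & q`_N = p`_N].
    have LN : L N p`_N by exists p.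
    case: (leqP N D) => ND; first exact: step.
    have [q [gq sq qa]] := step D _ (leqnn D) (LD _ _ LN).
    exists ('X^(N - D) * q); split; first exact: GM.
      have [->|q0] := eqVneq q 0; first by rewrite mulr0 size_poly0.
      by rewrite mulrC size_mulXn// (leq_trans (leq_add (leqnn _) sq))// addnS subnK// ltnW.
    by rewrite coefXnM ltnNge leq_subr /= subKn ?(ltnW ND).
  rewrite -[p](subrK q); apply: GD => //; apply: IH; last first.
    by apply: ID => //; rewrite -mulN1r; apply: IM; apply: IG.
  apply/leq_sizeP => j; rewrite leq_eqVlt => /orP[/eqP <-|Nj].
    by rewrite coefB qa subrr.
  by rewrite coefB !nth_default ?subrr// (leq_trans _ Nj).
by move=> p Ip; apply: (main (size p)).
Qed.

Lemma noetherian_surj (B A : comNzRingType) (f : {rmorphism B -> A}) :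
  (forall a, exists b, f b = a) -> noetherian B -> noetherian A.
Proof.
move=> fsurj nB I [I0 ID IM].
have [|t ht gt] := nB (fun b => I (f b)).
  by split=> [|a b Ia Ib|a b Ib]; rewrite ?rmorph0 ?rmorphD ?rmorphM; [|apply: ID|apply: IM].
exists (map f t) => [x /mapP[y yt ->]|a]; first exact: ht.
have [b <- /gt] := fsurj a.
elim: t b {ht gt} => [|x t IH] b /=; first by move=> ->; rewrite rmorph0.
by move=> [c /IH hc]; exists (f c); rewrite -rmorphM -rmorphB.
Qed.

Lemma noetherian_field (F : fieldType) : noetherian F.
Proof.
move=> I [I0 ID IM].
have [[x Ix x0]|nx] := pselect (exists2 x, I x & x != 0).
  exists [:: x] => [y|b _]; first by rewrite inE => /eqP ->.
  by exists (b / x); rewrite mulfVK// subrr.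
exists [::] => //= b Ib; apply/eqP/negPn/negP => b0; apply: nx; by exists b.
Qed.

(** The ring of polynomials in k variables is a quotient of a ring of polynomials
    iterated k times, to which the theorem in one variable applies. *)
Lemma noetherian_mpoly (k : nat) (F : fieldType) : noetherian (mpoly k F).
Proof.
have /(_ k (leqnn k)) [B [f [c [nB fc fX]]]] : forall j, (j <= k)%N ->
    exists (B : comNzRingType) (f : {rmorphism B -> mpoly k F}) (c : F -> B),
    [/\ noetherian B, forall a, f (c a) = mpolyC k a
      & forall i : 'I_k, (i < j)%N -> exists b, f b = mpolyX F (mnm1 i)].
  elim=> [_|j IH jk].
    exists F, (@mpolyC k F), id; split=> //; exact: noetherian_field.
  have [B [f [c [nB fc fX]]]] := IH (ltnW jk).
  pose x := mpolyX F (mnm1 (Ordinal jk)).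
  have cx : commr_rmorph f x by move=> b; apply: mulrC.
  exists {poly B}, (horner_morph cx), (fun a => (c a)%:P); split.
  - exact: noetherian_poly.
  - by move=> a; rewrite -fc; apply: horner_morphC.
  - move=> i; rewrite ltnS leq_eqVlt => /orP[/eqP ij|/fX[b <-]]; last first.
      by exists b%:P; apply: horner_morphC.
    exists 'X; rewrite (_ : i = Ordinal jk); last exact: val_inj.
    exact: horner_morphX.
apply: (noetherian_surj (f := f)) => //.
apply: mpoly_ring_ind => [a|i|p q [a <-] [b <-]|p q [a <-] [b <-]].
- by exists (c a).
- exact: fX.
- by exists (a + b); rewrite rmorphD.
- by exists (a * b); rewrite rmorphM.
Qed.

End HilbertBasis.

(** * Derivations modulo a prime ideal *)

Section Derivations.

Definition derivation (B A : comNzRingType) (f : B -> A) (d : B -> A) : Prop :=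
  (forall a b, d (a + b) = d a + d b) /\
  (forall a b, d (a * b) = f a * d b + f b * d a).

Section Extension.
Variables (B A : comNzRingType) (f : {rmorphism B -> A}) (x : A).

Let comm_x : commr_rmorph f x. Proof. by move=> b; apply: mulrC. Qed.

Definition ev : {rmorphism {poly B} -> A} := horner_morph comm_x.

Lemma evE p : ev p = (map_poly f p).[x]. Proof. by []. Qed.

Lemma evC b : ev b%:P = f b. Proof. exact: horner_morphC. Qed.

Lemma evX : ev 'X = x. Proof. exact: horner_morphX. Qed.

(** The extension of d to polynomials that kills 'X, followed by evaluation at x. *)
Definition coefwise (d : B -> A) (p : {poly B}) : A := (map_poly d p).[x].

Lemma derivation0 (d : B -> A) : derivation f d -> d 0 = 0.
Proof. by move=> [dD _]; apply: (addrI (d 0)); rewrite -dD !addr0. Qed.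

Lemma derivationB (d : B -> A) a b : derivation f d -> d (a - b) = d a - d b.
Proof.
move=> hd; have [dD _] := hd; apply: (addIr (d b)).
by rewrite -dD !subrK.
Qed.

Lemma coefwiseC d b : derivation f d -> coefwise d b%:P = d b.
Proof.
move=> /derivation0 d0; rewrite /coefwise; suff -> : map_poly d b%:P = (d b)%:P.
  by rewrite hornerC.
by apply/polyP => i; rewrite coef_map_id0// !coefC; case: ifP.
Qed.

Lemma coefwise_derivation d : derivation f d -> derivation ev (coefwise d).
Proof.
move=> hd; have d0 := derivation0 hd; have [dD dM] := hd.
have dS (k : nat) (F : 'I_k -> B) : d (\sum_i F i) = \sum_i d (F i).
  by elim/big_ind2: _ => // [x1 x2 y1 y2 <- <-]; rewrite dD.
split=> p q; rewrite /coefwise ?evE -?hornerM -hornerD; congr (_.[x]).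
  by apply/polyP => i; rewrite coefD !coef_map_id0// coefD dD.
apply/polyP => i; rewrite coefD !coef_map_id0//.
rewrite coefM dS [map_poly f q * _]mulrC !coefM -big_split /=.
by apply: eq_bigr => j _; rewrite dM !coef_map_id0 ?rmorph0// [f q`__ * _]mulrC.
Qed.

Lemma deriv_derivation : derivation ev (fun p => ev p^`()).
Proof.
split=> p q; first by rewrite derivD rmorphD.
by rewrite derivM rmorphD !rmorphM /= addrC [ev p^`() * _]mulrC.
Qed.

End Extension.

Lemma derivation_comb (B A : comNzRingType) (f : {rmorphism B -> A}) d1 d2 e1 e2 :
  derivation f d1 -> derivation f d2 ->
  derivation f (fun b => e1 * d1 b - e2 * d2 b).
Proof.
move=> [d1D d1M] [d2D d2M]; split=> a b; first by rewrite d1D d2D; ring.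
by rewrite d1M d2M; ring.
Qed.

Definition is_prime_ideal (A : comNzRingType) (I : A -> Prop) : Prop :=
  [/\ is_ideal I, ~ I 1 & forall a b, I (a * b) -> I a \/ I b].

Lemma ideal_sum (A : comNzRingType) (I : A -> Prop) (T : Type) (r : seq T)
    (F : T -> A) : is_ideal I -> (forall t, I (F t)) -> I (\sum_(t <- r) F t).
Proof. by move=> [I0 ID _] h; elim/big_ind: _. Qed.

Lemma idealB (A : comNzRingType) (I : A -> Prop) a b :
  is_ideal I -> I a -> I b -> I (a - b).
Proof. by move=> [_ ID IM] Ia Ib; apply: ID => //; rewrite -mulN1r; apply: IM. Qed.

Lemma idealMr (A : comNzRingType) (I : A -> Prop) a b :
  is_ideal I -> I a -> I (a * b).
Proof. by move=> [_ _ IM] Ia; rewrite mulrC; apply: IM. Qed.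

(** Extension of derivations modulo a prime ideal, in characteristic zero.  If x
    is algebraic over the image of f modulo I, the value at 'X is forced by a
    relation G of least degree, whose derivative does not lie in I; the factor e
    clears the denominator ev G^`(). *)
Lemma extend_derivation (B A : comNzRingType) (f : {rmorphism B -> A}) (x : A)
    (I : A -> Prop) (d : B -> A) :
  is_prime_ideal I -> (forall k a, I (a *+ k.+1) -> I a) ->
  derivation f d -> (forall b, I (f b) -> I (d b)) ->
  exists (d' : {poly B} -> A) (e : A), [/\ ~ I e, derivation (ev f x) d',
    forall b, d' b%:P = e * d b & forall p, I (ev f x p) -> I (d' p)].
Proof.
move=> [Iid I1 Ipr] Ichar hd dI; have [I0 ID IM] := Iid.
pose triv (p : {poly B}) := forall i, I (f p`_i).
have d0 := derivation0 hd.
have Icoef (g : B -> A) (p : {poly B}) : g 0 = 0 -> (forall i, I (g p`_i)) ->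
    I (map_poly g p).[x].
  move=> g0 hp; rewrite horner_coef; apply: ideal_sum => // i.
  by apply: idealMr => //; rewrite coef_map_id0.
have cw_triv p : triv p -> I (coefwise x d p).
  by move=> tp; apply: Icoef => // i; apply: dI.
have ev_triv p : triv p -> I (ev f x p).
  by move=> tp; rewrite evE; apply: Icoef => //; rewrite rmorph0.
have triv_deriv p : triv p -> triv p^`().
  by move=> tp i; rewrite coef_deriv rmorphMn /= -mulr_natr; apply: idealMr.
pose cwD := coefwise_derivation x hd.
have [[p0 [Ip0 np0]]|alltriv] := pselect (exists p, I (ev f x p) /\ ~ triv p);
    last first.
  exists (coefwise x d), 1; split=> // [b|p Ip].
    by rewrite mul1r (coefwiseC x b hd).
  by apply: cw_triv; apply: contrapT => np; apply: alltriv; exists p.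
(* A nontrivial relation G of x over B of least degree. *)
have [N [[G [sG IG nG]] Nmin]] : exists N,
    (exists G : {poly B}, [/\ size G = N, I (ev f x G) & ~ triv G]) /\
    forall p : {poly B}, (size p < N)%N -> I (ev f x p) -> triv p.
  have exN : exists N, `[< exists G : {poly B},
      [/\ size G = N, I (ev f x G) & ~ triv G] >].
    by exists (size p0); apply/asboolP; exists p0.
  exists (ex_minn exN); case: ex_minnP => N /asboolP hN minN; split=> // p sp Ip.
  apply: contrapT => np; move: sp; rewrite ltnNge minN//; apply/asboolP.
  by exists p.
pose e := ev f x G^`().
have ntriv0 : exists i, ~ I (f G`_i) by apply/existsNP.
have sG0 : (0 < size G)%N.
  rewrite lt0n size_poly_eq0; apply/eqP => G0; apply: nG => i.
  by rewrite G0 coef0 rmorph0.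
(* By minimality, and since the characteristic is zero. *)
have nIe : ~ I e.
  move=> Ie; have tG' : triv G^`().
    by apply: Nmin => //; rewrite -sG lt_size_deriv// -size_poly_gt0.
  have tS i : I (f G`_i.+1).
    by apply: (Ichar i); rewrite -rmorphMn -coef_deriv.
  apply: nG => -[|i]; last exact: tS.
  have [G1 [c eG]] : exists G1 c, G = G1 * 'X + c%:P.
    by elim/poly_ind: (G) => [|G1 c _]; [exists 0, 0|exists G1, c]; rewrite ?mul0r ?addr0.
  have -> : G`_0 = c by rewrite eG coefD coefMX coefC add0r.
  have -> : f c = ev f x G - ev f x G1 * x.
    by rewrite eG rmorphD rmorphM /= evX evC addrC addKr.
  apply: idealB => //; apply: idealMr => //; apply: ev_triv => i.
  by have := tS i; rewrite eG coefD coefMX coefC addr0.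
have nIl : ~ I (f (lead_coef G)).
  move=> Il; apply: nG.
  have : triv (G - lead_coef G *: 'X^((size G).-1)).
    apply: Nmin; last first.
      rewrite -mul_polyC rmorphB rmorphM /= evC; apply: idealB => //.
      exact: idealMr.
    rewrite -sG -[X in (_ < X)%N](prednK sG0) ltnS; apply/leq_sizeP => j.
    rewrite leq_eqVlt => /orP[/eqP <-|ltj].
      by rewrite coefB coefZ coefXn eqxx mulr1 subrr.
    rewrite coefB coefZ coefXn gtn_eqF// mulr0 subr0 nth_default//.
    by rewrite -(prednK sG0).
  move=> t i; have := t i; rewrite coefB coefZ coefXn => h.
  rewrite -[f _](subrK (f (lead_coef G * (i == (size G).-1)%:R))) -rmorphB.
  by apply: ID => //; rewrite rmorphM; apply: idealMr.
(* The condition d' G = 0 forces e * d' 'X = - coefwise x d G when d' extends d;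
   here both sides are multiplied by e. *)
pose d' p := e * coefwise x d p - coefwise x d G * ev f x p^`().
have hd' : derivation (ev f x) d'.
  exact: (derivation_comb e (coefwise x d G) cwD (deriv_derivation f x)).
have d'C b : d' b%:P = e * d b.
  by rewrite /d' derivC rmorph0 mulr0 subr0 (coefwiseC x b hd).
have d'G : d' G = 0 by rewrite /d' mulrC subrr.
exists d', e; split=> //.
have triv_d' p : triv p -> I (d' p).
  move=> tp; apply: idealB => //; apply: IM; first exact: cw_triv.
  exact/ev_triv/triv_deriv.
(* Pseudo-division by G lowers the degree of a relation p; lead_coef G is not in I
   and can be cancelled. *)
suff main k (p : {poly B}) : (size p <= k)%N -> I (ev f x p) -> I (d' p).
  by move=> p; apply: (main (size p)).
elim: k p => [|k IH] p sp Ip.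
  by apply: triv_d' => i; move: sp; rewrite leqn0 size_poly_eq0 => /eqP ->;
    rewrite coef0 rmorph0.
have [tp|ntp] := pselect (triv p); first exact: triv_d'.
have Gp : (size G <= size p)%N.
  by rewrite leqNgt; apply/negP => h; apply: ntp; apply: Nmin => //; rewrite -sG.
pose m := lead_coef p *: 'X^(size p - size G).
pose r := lead_coef G *: p - m * G.
have Ir : I (ev f x r).
  rewrite rmorphB -mul_polyC !rmorphM /=; apply: idealB => //; exact: IM.
have sr : (size r <= k)%N.
  have sp0 : (0 < size p)%N := leq_trans sG0 Gp.
  apply: (@leq_trans (size p).-1); last by rewrite -ltnS prednK.
  apply/leq_sizeP => j jp; rewrite coefB coefZ /m -scalerAl coefZ mulrC coefXnM.
  have jge : (size p - size G <= j)%N.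
    by rewrite (leq_trans _ jp)// -subn1 leq_sub2l.
  rewrite ltnNge jge /=; have [/eqP jE|jne] := boolP (j == (size p).-1).
    have -> : (j - (size p - size G) = (size G).-1)%N.
      by rewrite jE -{2}(subKn Gp) -!subn1 subnAC.
    by rewrite jE /lead_coef; ring.
  have jp' : (size p <= j)%N.
    by rewrite -(prednK sp0) ltn_neqAle eq_sym jne.
  rewrite !nth_default ?mulr0 ?mul0r ?subrr//.
  by rewrite -{1}(subKn Gp) leq_sub2r.
have := IH _ sr Ir.
have -> : d' r = f (lead_coef G) * d' p + ev f x p * (e * d (lead_coef G))
              - (ev f x m * d' G + ev f x G * d' m).
  rewrite /r (derivationB _ _ hd') -mul_polyC.
  by rewrite (proj2 hd') (proj2 hd') d'C evC.
move=> h; have [] // : I (f (lead_coef G)) \/ I (d' p).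
apply: Ipr.
rewrite (_ : _ * _ = f (lead_coef G) * d' p + ev f x p * (e * d (lead_coef G)) -
  (ev f x m * d' G + ev f x G * d' m) - (ev f x p * (e * d (lead_coef G)) -
  (ev f x m * d' G + ev f x G * d' m))); last by ring.
apply: idealB => //; apply: idealB => //; first exact: idealMr.
by rewrite d'G mulr0 add0r; apply: idealMr.
Qed.

End Derivations.

Section TangentVectors.
Variables (F : numFieldType) (N : nat).
Local Notation P := (mpoly N F).
Implicit Types (I : P -> Prop).

(** The ring B plays the role of a polynomial subring in k variables w_i of the
    coordinate ring P / I, on which the partial derivatives d_i live. *)
Definition independent_frame I (k : nat) : Prop :=
  exists (B : comNzRingType) (f : {rmorphism B -> P}) (c : F -> B)
    (w : nat -> B) (d : nat -> B -> P),
  [/\ forall a, f (c a) = mpolyC N a, forall b, I (f b) -> b = 0,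
      forall i, derivation f (d i), forall i a, d i (c a) = 0 &
      forall i j, (i < k)%N -> (j < k)%N -> d i (w j) = (i == j)%:R].

Lemma independent_frame0 : independent_frame (fun p => mcoeff mnm0 p = 0) 0.
Proof.
exists F, (@mpolyC N F), id, (fun=> 0), (fun _ _ => 0); split=> //.
  by move=> b; rewrite mcoeffC eqxx mulr1.
by move=> i; split=> a b; rewrite ?mulr0 addr0.
Qed.

Lemma independent_frame_sub I I' k : (forall p, I p -> I' p) ->
  independent_frame I' k -> independent_frame I k.
Proof.
by move=> sI [B [f [c [w [d [h1 h2 h3 h4 h5]]]]]]; exists B, f, c, w, d;
  split=> // b /sI /h2.
Qed.

(** The element h is a further independent variable modulo the smaller ideal: in a
    relation for h over B the constant coefficient lies in I', hence vanishes, and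
    the relation can be divided by h. *)
Lemma independent_frameS I I' k h : is_ideal I -> is_ideal I' ->
  (forall p, I p -> I' p) -> (forall p, I (p * h) -> I p) -> I' h ->
  independent_frame I' k -> independent_frame I k.+1.
Proof.
move=> Iid I'id sub hreg I'h [B [f [c [w [d [fc finj hd dc dw]]]]]].
pose d' i := if (i < k)%N then coefwise h (d i) else fun p => ev f h p^`().
exists {poly B}, (ev f h), (fun a => (c a)%:P),
  (fun j => if (j < k)%N then (w j)%:P else 'X), d'; split.
- by move=> a; rewrite evC.
- elim/poly_ind => [//|p b IH] Ipb.
  have e : ev f h (p * 'X + b%:P) = ev f h p * h + f b.
    by rewrite rmorphD rmorphM /= evX evC.
  have b0 : b = 0.
    apply: finj; rewrite -(addKr (ev f h p * h) (f b)) -e addrC.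
    by apply: idealB => //; [apply: sub|case: I'id => _ _; apply].
  move: Ipb; rewrite e b0 rmorph0 addr0 => /hreg/IH ->.
  by rewrite mul0r addr0.
- move=> i; rewrite /d'; case: ifP => _; last exact: deriv_derivation.
  exact: coefwise_derivation.
- move=> i a; rewrite /d'; case: ifP => _; last by rewrite derivC rmorph0.
  by rewrite (coefwiseC h (c a) (hd i)).
- move=> i j; rewrite !ltnS /d' => ik jk.
  case: (ltnP i k) => hi; case: (ltnP j k) => hj.
  + by rewrite (coefwiseC h (w j) (hd i)) dw.
  + rewrite /coefwise (_ : map_poly (d i) 'X = 0) ?horner0 ?(ltn_eqF (leq_trans hi hj))//.
    apply/polyP => l; rewrite coef_map_id0 ?(derivation0 (hd i))// coefX coef0.
    case: eqP => _; last exact: derivation0 (hd i).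
    have := proj2 (hd i) 1 1; rewrite mulr1 rmorph1 mul1r => /eqP.
    by rewrite -subr_eq0 opprD addrA subrr add0r oppr_eq0 => /eqP.
  + by rewrite derivC rmorph0 (gtn_eqF (leq_trans hj hi)).
  + by rewrite derivX rmorph1 (_ : i = j) ?eqxx//; apply/eqP; rewrite eqn_leq (leq_trans ik hj) (leq_trans jk hi).
Qed.

Lemma ideal_charP I : is_ideal I -> forall k a, I (a *+ k.+1) -> I a.
Proof.
move=> [_ _ IM] k a /(IM (mpolyC N (k.+1%:R^-1))).
rewrite mul_mpolyC -[a *+ _](@scaler_nat F) scalerA mulVf ?scale1r// pnatr_eq0.
Qed.

(** The coordinate functions are adjoined to the ring B one after the other, and the
    i-th partial derivative is extended along the way by extend_derivation; its
    values at the coordinate functions are the components of a vector field v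
    tangent to the zero set of I. *)
Lemma frame_tangent I k : is_prime_ideal I -> independent_frame I k ->
  exists g : nat -> P, forall i, (i < k)%N ->
  exists (e : P) (v : 'I_N -> P), [/\ ~ I e,
    forall q, I q -> I (\sum_l mderiv l q * v l) &
    forall j, (j < k)%N ->
      I (\sum_l mderiv l (g j) * v l - e * (i == j)%:R)].
Proof.
move=> Ipr [B0 [f0 [c0 [w0 [d0 [fc0 finj hd0 dc0 dw0]]]]]].
have [Iid I1 Imul] := Ipr; have [I0 ID IM] := Iid.
exists (fun j => f0 (w0 j)) => i ik.
suff /(_ N (leqnn N)) : forall s, (s <= N)%N -> exists (B : comNzRingType)
    (f : {rmorphism B -> P}) (c : F -> B) (w : nat -> B) (d : B -> P) (e : P),
    [/\ ~ I e /\ derivation f d, forall b, I (f b) -> I (d b),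
      (forall a, f (c a) = mpolyC N a) /\ (forall a, d (c a) = 0),
      (forall j, f (w j) = f0 (w0 j)) /\
      (forall j, (j < k)%N -> d (w j) = e * (i == j)%:R) &
      forall l : 'I_N, (l < s)%N -> exists b, f b = mpolyX F (mnm1 l)].
  move=> [B [f [c [w [d [e [[nIe hd] dI [fc dc] [fw dw] fX]]]]]]].
  have /choice [b hb] : forall l : 'I_N, exists b, f b = mpolyX F (mnm1 l).
    by move=> l; apply: fX.
  exists e, (fun l => d (b l)).
  have lift q : exists2 a, f a = q & d a = \sum_l mderiv l q * d (b l).
    have [dD dM] := hd.
    elim/mpoly_ring_ind: q => [a|l|p q [x <- dx] [y <- dy]|p q [x <- dx] [y <- dy]].
    - exists (c a) => //; rewrite dc big1// => l _.
      by rewrite mderivC mul0r.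
    - exists (b l) => //; rewrite (bigD1 l)//= big1 ?addr0 => [|l' l'l].
        rewrite mderivX mnm1E eqxx scale1r.
        by rewrite -[X in mnm_sub X _]add0m addmK mpolyX0 mul1r.
      by rewrite mderivX mnm1E eq_sym (negbTE l'l) scale0r mul0r.
    - exists (x + y); rewrite ?rmorphD// dD dx dy -big_split /=.
      by apply: eq_bigr => l _; rewrite mderivD mulrDl.
    - exists (x * y); rewrite ?rmorphM// dM dx dy !mulr_sumr -big_split /=.
      by apply: eq_bigr => l _; rewrite mderivM; ring.
  split=> // [q Iq|j jk].
    by have [a fa <-] := lift q; apply: dI; rewrite fa.
  have [a fa <-] := lift (f0 (w0 j)).
  rewrite -(dw j jk) -(derivationB _ _ hd); apply: dI.
  by rewrite rmorphB fa fw subrr.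
elim=> [_|s IH sN].
  exists B0, f0, c0, w0, (d0 i), 1; split=> //.
    by move=> b /finj ->; rewrite (derivation0 (hd0 i)).
  by split=> // j jk; rewrite mul1r dw0.
have [B [f [c [w [d [e [[nIe hd] dI [fc dc] [fw dw] fX]]]]]]] := IH (ltnW sN).
have [d' [e' [nIe' hd' d'C d'I]]] :=
  extend_derivation (mpolyX F (mnm1 (Ordinal sN))) Ipr (ideal_charP Iid) hd dI.
exists {poly B}, (ev f (mpolyX F (mnm1 (Ordinal sN)))), (fun a => (c a)%:P),
  (fun j => (w j)%:P), d', (e' * e); split=> //.
- by split=> // /Imul[].
- by split=> a; rewrite ?evC// d'C dc mulr0.
- by split=> j; rewrite ?evC// => jk; rewrite d'C dw// mulrA.
- move=> l; rewrite ltnS leq_eqVlt => /orP[/eqP ls|/fX[b <-]]; last first.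
    by exists b%:P; rewrite evC.
  by exists 'X; rewrite evX; congr (mpolyX _ (mnm1 _)); apply: val_inj.
Qed.

End TangentVectors.

(** * Differentials of the equations of a variety *)

Section CoordinateRing.
Variables (R : realType) (n : nat).
Local Notation C := (Cplx R).
Local Notation V := 'rV[C]_n.+1.
Local Notation poly := (mpoly n.+1 C).
Implicit Types (p q : poly) (w : V) (Z : set {vspace V}).

Lemma vanishing_ideal Z : is_ideal (fun p => vanishes_on p Z).
Proof.
split=> [l w _ _|a b ha hb l w Zl wl|a b hb l w Zl wl].
- by rewrite -mpolyC0 pevalC.
- by rewrite pevalD (ha l) ?(hb l) ?addr0.
- by rewrite pevalM (hb l) ?mulr0.
Qed.

Lemma vanishing_prime Z : irreducible_variety Z ->
  is_prime_ideal (fun p => vanishes_on p Z).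
Proof.
move=> hZ; split; first exact: vanishing_ideal.
  have [_ [l Zl] _] := hZ => /(_ l 0 Zl (mem0v l)).
  by rewrite -mpolyC1 pevalC => /eqP; rewrite oner_eq0.
by move=> a b; apply: irreducible_prime.
Qed.

Lemma peval0 p : peval p 0 = mcoeff mnm0 p.
Proof.
elim/mpoly_ring_ind: p => [c|i|p q IHp IHq|p q IHp IHq].
- by rewrite pevalC mcoeffC eqxx mulr1.
- rewrite pevalX mxE mcoeffX; case: eqP => // h.
  by have := congr1 (fun m : multinom n.+1 => m i) h; rewrite mnm1E eqxx mnm0E.
- by rewrite pevalD mcoeffD IHp IHq.
- by rewrite pevalM IHp IHq rmorphM.
Qed.

(** The transcendence degree of the coordinate ring of the cone over Z exceeds
    by one the length of any chain in Z: each strict inclusion of the chain yields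
    a new independent function by independent_frameS, and so does the inclusion
    of the apex of the cone in the cone over the base of the chain. *)
Lemma chain_frame Z m : has_chain Z m ->
  independent_frame (fun p => vanishes_on p Z) m.+1.
Proof.
move=> [Y [irr prop subZ]].
apply: (@independent_frame_sub _ _ _ (fun p => vanishes_on p (Y m))).
  by move=> p hp l w Yl wl; apply: (hp l) => //; apply: subZ.
elim: m {subZ} irr prop => [|m IH] irr prop.
  have pr := vanishing_prime (irr 0%N (leqnn 0)).
  have [cY [l Yl] _] := irr 0%N (leqnn 0).
  have dl := alg_closed_line cY Yl.
  have w0 : vpick l != 0 by rewrite vpick0 -dimv_eq0 dl.
  have [i wi0] : exists i, vpick l 0 i != 0.
    apply: contrapT => /forallNP h; move/negP: w0; apply.
    by apply/eqP/rowP => i; rewrite mxE; apply/eqP/negPn/negP/h.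
  apply: (@independent_frameS _ _ _ (fun p => mcoeff mnm0 p = 0) _ (mpolyX C (mnm1 i))) => //.
  - exact: vanishing_ideal.
  - split=> [|a b ha hb|a b hb]; first exact: mcoeff0.
      by rewrite mcoeffD ha hb addr0.
    by rewrite -peval0 pevalM !peval0 hb mulr0.
  - by move=> p hp; rewrite -peval0; apply: (hp l) => //; apply: mem0v.
  - move=> p /(irreducible_prime (irr 0%N (leqnn 0)))[//|/(_ l _ Yl (memv_pick l))].
    by rewrite pevalX => e; rewrite e eqxx in wi0.
  - by rewrite -peval0 pevalX mxE.
  - exact: independent_frame0.
have [[cY _ _] irS] := (irr m (leqnSn m), irr m.+1 (leqnn _)).
have [sY nsY] := prop m (leqnn _).
have [h [hv hnv]] : exists h, vanishes_on h (Y m) /\ ~ vanishes_on h (Y m.+1).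
  apply: contrapT => /forallNP hall; apply: nsY => l Yl.
  apply: (alg_closedP cY); first by apply: alg_closed_line Yl; case: irS.
  move=> p _ hp l' w -> wl; have /not_andP[//|/contrapT hp'] := hall p.
  exact: (hp' l).
apply: (@independent_frameS _ _ _ (fun p => vanishes_on p (Y m)) _ h) => //.
- exact: vanishing_ideal.
- exact: vanishing_ideal.
- by move=> p hp l w Yl wl; apply: (hp l) => //; apply: sY.
- by move=> p /(irreducible_prime irS)[].
- by apply: IH => i im; [apply: irr|apply: prop]; rewrite (leq_trans im) ?leqnSn.
Qed.

Definition grad q : 'cV[poly]_n.+1 := \col_l mderiv l q.

Definition jacobian k (p : 'I_k -> poly) : 'M[poly]_(n.+1, k) :=
  \matrix_(l, j) mderiv l (p j).

(** Along Z the differential of any equation q of Z is a combination of those of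
    p_1, ..., p_k, as soon as these are independent and k is the codimension: all
    of them annihilate the n.+1 - k independent tangent fields of frame_tangent.
    The coefficients come from Cramer's rule, the matrix b selecting the minor. *)
Lemma gradient_combination Z d k (p : 'I_k -> poly) (b : 'M[C]_(k, n.+1)) :
  irreducible_variety Z ->
  independent_frame (fun q => vanishes_on q Z) d -> (d + k)%N = n.+1 ->
  (forall j, vanishes_on (p j) Z) ->
  let M := map_mx (@mpolyC n.+1 C) b *m jacobian p in
  ~ vanishes_on (\det M) Z ->
  forall q, vanishes_on q Z -> exists a : 'cV[poly]_k, forall l,
    vanishes_on (\det M * mderiv l q - (jacobian p *m a) l 0) Z.
Proof.
move=> hZ hfr dk pZ M nM q qZ.
have hpr := vanishing_prime hZ.
have [Iid _ Ipr] := hpr.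
have [g hg] := frame_tangent hpr hfr.
have /choice [ev hev] : forall i : 'I_d, exists ev : poly * ('I_n.+1 -> poly),
    [/\ ~ vanishes_on ev.1 Z,
    forall q, vanishes_on q Z -> vanishes_on (\sum_l mderiv l q * ev.2 l) Z &
    forall j, (j < d)%N ->
      vanishes_on (\sum_l mderiv l (g j) * ev.2 l - ev.1 * (val i == j)%:R) Z].
  move=> i; have [e [v h]] := hg i (ltn_ord i); by exists (e, v).
set a := \adj M *m (map_mx (@mpolyC n.+1 C) b *m grad q).
exists a => l.
set e := (\det M *: grad q - jacobian p *m a).
have -> : \det M * mderiv l q - (jacobian p *m a) l 0 = e l 0 by rewrite !mxE.
(* At the points where D does not vanish, the tangent fields and the rows of b
   form an invertible system, by which e is annihilated. *)
pose D := (\prod_i (ev i).1) * \det M.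
have nD : ~ vanishes_on D Z.
  move=> /Ipr[|//]; elim/big_ind: _ => [|x y hx hy /Ipr[]//|i _].
    by case: hpr.
  by case: (hev i).
have [//|//] : vanishes_on D Z \/ vanishes_on (e l 0) Z.
apply: Ipr => z w Zz wz; rewrite pevalM.
have [->|Dw] := eqVneq (peval D w) 0; first by rewrite mul0r.
pose rho : {rmorphism poly -> C} := meval (fun i => w 0 i).
have vw x : vanishes_on x Z -> rho x = 0 by move=> hx; apply: (hx z).
pose Vw : 'M[C]_(d, n.+1) := \matrix_(i, l) rho ((ev i).2 l).
pose Gw : 'M[C]_(n.+1, d) := \matrix_(l, j) rho (mderiv l (g j)).
pose Jw := map_mx rho (jacobian p).
have rb : map_mx rho (map_mx (@mpolyC n.+1 C) b) = b.
  by apply/matrixP => i j; rewrite !mxE /= mevalC.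
have VJ : Vw *m Jw = 0.
  apply/matrixP => i j; rewrite !mxE.
  have [_ h _] := hev i; rewrite -[RHS](vw _ (h _ (pZ j))) rmorph_sum /=.
  by apply: eq_bigr => l' _; rewrite !mxE mevalM mulrC.
have VG : Vw *m Gw = diag_mx (\row_i rho (ev i).1).
  apply/matrixP => i j; rewrite !mxE.
  have [_ _ h] := hev i; have := vw _ (h _ (ltn_ord j)).
  rewrite rmorphB rmorphM rmorph_nat rmorph_sum /= => /eqP.
  rewrite subr_eq0 mulr_natr => /eqP <-.
  by apply: eq_bigr => l' _; rewrite !mxE /= mevalM mulrC.
have bJ : b *m Jw = map_mx rho M by rewrite map_mxM rb.
pose S := col_mx Vw b.
have ST : S *m row_mx Gw Jw =
    block_mx (diag_mx (\row_i rho (ev i).1)) 0 (b *m Gw) (map_mx rho M).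
  by rewrite mul_col_row VJ VG bJ.
have rS : \rank S = n.+1.
  apply/eqP; rewrite eqn_leq rank_leq_col /=; apply: (@leq_trans (d + k)).
    by rewrite dk.
  apply: leq_trans (mxrankM_maxl S (row_mx Gw Jw)); rewrite mxrank_unit//.
  rewrite unitmxE ST det_lblock det_diag unitfE det_map_mx.
  move: Dw; rewrite /D -[peval _ _]/(rho _) rmorphM rmorph_prod /=.
  by congr (_ * _ != 0); apply: eq_bigr => i _; rewrite mxE.
have /row_fullP[S' S'S] : row_full S by rewrite /row_full rS.
have ew : map_mx rho e = 0.
  suff h : S *m map_mx rho e = 0 by rewrite -[LHS]mul1mx -S'S -mulmxA h mulmx0.
  rewrite mul_col_mx; apply/eqP; rewrite col_mx_eq0; apply/andP; split; apply/eqP.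
    rewrite /e map_mxB map_mxM mulmxBr mulmxA VJ mul0mx subr0 map_mxZ -scalemxAr.
    rewrite (_ : Vw *m _ = 0) ?scaler0//; apply/matrixP => i j; rewrite !mxE.
    have [_ h _] := hev i; rewrite -[RHS](vw _ (h _ qZ)) rmorph_sum /=.
    by apply: eq_bigr => l' _; rewrite !mxE mevalM mulrC.
  rewrite -{1}rb -map_mxM /e mulmxBr /a -scalemxAr.
  by rewrite [X in _ - X]mulmxA -/M [X in _ - X]mulmxA mul_mx_adj mul_scalar_mx subrr map_mx0.
have /matrixP/(_ l 0) := ew; rewrite [LHS]mxE [RHS]mxE => h.
by rewrite [peval (e l 0) w]h mulr0.
Qed.

End CoordinateRing.

(** * Absolute values and contractions *)

(** Complete absolute values on a field; completeness is stated for sequences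
    with geometrically decreasing steps, the only ones that Picard iteration
    produces. *)
Record absolute_value (R : realType) (F : fieldType) := AbsoluteValue {
  absval :> F -> R;
  absval_ge0 : forall x, 0 <= absval x;
  absval_eq0 : forall x, (absval x == 0) = (x == 0);
  absvalD : forall x y, absval (x + y) <= absval x + absval y;
  absvalM : forall x y, absval (x * y) = absval x * absval y;
  absval_nat : forall i : nat, absval i%:R = i%:R;
  absval_complete : forall (u : nat -> F) c,
    (forall i, absval (u i.+1 - u i) <= c / 2 ^+ i) ->
    exists l K, forall i, absval (l - u i) <= K / 2 ^+ i }.

Section Dyadic.
Variable R : realType.

(** The limit is a supremum of lower bounds. *)
Lemma dyadic_cauchy (u : nat -> R) (c : R) :
  (forall i, `|u i.+1 - u i| <= c / 2 ^+ i) ->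
  exists l, forall i, `|l - u i| <= 2 * c / 2 ^+ i.
Proof.
move=> hu; pose t i : R := 2 * c / 2 ^+ i.
have tS i : t i = 2 * (c / 2 ^+ i) by rewrite /t mulrA.
have tS' i : t i.+1 = c / 2 ^+ i.
  by rewrite /t exprS -mulf_div divff ?mul1r ?pnatr_eq0.
have step i : u i - t i <= u i.+1 - t i.+1 /\ u i.+1 + t i.+1 <= u i + t i.
  by have := hu i; rewrite tS tS' ler_norml => /andP[h1 h2]; split; lra.
have mono i k : u i - t i <= u (i + k)%N - t (i + k)%N /\
    u (i + k)%N + t (i + k)%N <= u i + t i.
  elim: k => [|k [IH1 IH2]]; first by rewrite addn0.
  by rewrite addnS; have [h1 h2] := step (i + k)%N; split; lra.
have t0 i : 0 <= t i.
  by rewrite tS mulr_ge0//; apply: le_trans (hu i).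
have cross i j : u i - t i <= u j + t j.
  have [h1 _] := mono i j; have [_] := mono j i; rewrite addnC.
  by have := t0 (i + j)%N => h3 h2; lra.
pose E := [set u i - t i | i in setT].
have hE : has_sup E.
  split; first by exists (u 0%N - t 0%N), 0%N.
  by exists (u 0%N + t 0%N) => _ [i _ <-].
exists (sup E) => i; rewrite ler_norml -/(t i); apply/andP; split.
  have : u i - t i <= sup E by apply: ub_le_sup => //; [case: hE|exists i].
  lra.
suff : sup E <= u i + t i by lra.
by apply: ge_sup => [|_ [j _ <-]]; [case: hE|].
Qed.

Lemma dyadic_small (x K : R) : (forall i, x <= K / 2 ^+ i) -> x <= 0.
Proof.
move=> h; rewrite leNgt; apply/negP => x0.
have K0 : 0 < K by have := h 0%N; rewrite expr0 divr1; apply: lt_le_trans.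
have := h (Num.bound (K / x)); rewrite ler_pdivlMr ?exprn_gt0//.
rewrite leNgt => /negP; apply.
have /archi_boundP : 0 <= K / x by rewrite divr_ge0// ltW.
rewrite ltr_pdivrMr// mulrC => /lt_le_trans; apply.
by rewrite ler_pM2l// -natrX ler_nat ltnW// ltn_expl.
Qed.

End Dyadic.

Section EntrywiseNorm.
Variables (R : realType) (F : fieldType) (cabs : absolute_value R F).
Implicit Types x y : F.

Lemma cabs_ge0 x : 0 <= cabs x. Proof. exact: absval_ge0. Qed.

Lemma cabs0 : cabs 0 = 0. Proof. by apply/eqP; rewrite absval_eq0. Qed.

Lemma cabs0_eq x : cabs x = 0 -> x = 0.
Proof. by move/eqP; rewrite absval_eq0 => /eqP. Qed.

Lemma cabsD x y : cabs (x + y) <= cabs x + cabs y. Proof. exact: absvalD. Qed.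

Lemma cabsM x y : cabs (x * y) = cabs x * cabs y. Proof. exact: absvalM. Qed.

Lemma cabs1 : cabs 1 = 1.
Proof.
have h : cabs 1 != 0 by rewrite absval_eq0 oner_neq0.
by apply: (mulfI h); rewrite -cabsM !mulr1.
Qed.

Lemma cabsN x : cabs (- x) = cabs x.
Proof.
rewrite -mulN1r cabsM (_ : cabs (-1) = 1) ?mul1r//; apply/eqP.
rewrite -(@eqrXn2 _ 2) ?cabs_ge0 ?ler01// expr1n expr2 -cabsM.
by rewrite mulrNN mulr1 cabs1.
Qed.

Lemma cabsV x : cabs x^-1 = (cabs x)^-1.
Proof.
have [->|x0] := eqVneq x 0; first by rewrite invr0 cabs0 invr0.
have h : cabs x != 0 by rewrite absval_eq0.
by apply: (mulfI h); rewrite -cabsM !mulfV// cabs1.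
Qed.

Lemma cabs_sum (I : finType) (f : I -> F) : cabs (\sum_i f i) <= \sum_i cabs (f i).
Proof.
elim/big_ind2: _ => [|x1 x2 y1 y2 h1 h2|//]; first by rewrite cabs0.
by rewrite (le_trans (cabsD _ _))// lerD.
Qed.

(** The entrywise l1 norm is submultiplicative for all matrix products and takes
    its values in R, where linear arithmetic is available. *)
Definition mnorm a b (A : 'M[F]_(a, b)) : R := \sum_i \sum_j cabs (A i j).

Section Theory.
Variables (a b : nat).
Implicit Types (A B : 'M[F]_(a, b)).

Lemma mnorm_ge0 A : 0 <= mnorm A.
Proof. by apply: sumr_ge0 => i _; apply: sumr_ge0 => j _; apply: cabs_ge0. Qed.

Lemma mnorm_entry A i j : cabs (A i j) <= mnorm A.
Proof.
rewrite /mnorm (bigD1 i)//= (bigD1 j)//= -addrA lerDl addr_ge0//.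
  by apply: sumr_ge0 => *; apply: cabs_ge0.
by apply: sumr_ge0 => *; apply: sumr_ge0 => *; apply: cabs_ge0.
Qed.

Lemma mnorm_le A e : (forall i j, cabs (A i j) <= e) -> mnorm A <= e *+ (a * b).
Proof.
move=> h; have -> : e *+ (a * b) = \sum_(i < a) \sum_(j < b) e.
  by rewrite sumr_const card_ord sumr_const card_ord mulnC mulrnA.
by apply: ler_sum => i _; apply: ler_sum => j _.
Qed.

Lemma mnorm0 : mnorm (0 : 'M[F]_(a, b)) = 0.
Proof. by rewrite /mnorm big1// => i _; rewrite big1// => j _; rewrite mxE cabs0. Qed.

Lemma mnorm0_eq A : mnorm A = 0 -> A = 0.
Proof.
move=> h; apply/matrixP => i j; rewrite mxE; apply: cabs0_eq; apply/eqP.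
by rewrite eq_le cabs_ge0 andbT -h mnorm_entry.
Qed.

Lemma mnormD A B : mnorm (A + B) <= mnorm A + mnorm B.
Proof.
rewrite /mnorm -big_split /=; apply: ler_sum => i _.
by rewrite -big_split /=; apply: ler_sum => j _; rewrite mxE cabsD.
Qed.

Lemma mnormN A : mnorm (- A) = mnorm A.
Proof. by apply: eq_bigr => i _; apply: eq_bigr => j _; rewrite mxE cabsN. Qed.

Lemma mnormB A B : mnorm (A - B) <= mnorm A + mnorm B.
Proof. by rewrite -(mnormN B) mnormD. Qed.

Lemma mnormBC A B : mnorm (A - B) = mnorm (B - A).
Proof. by rewrite -mnormN opprB. Qed.

Lemma mnorm_triangle A B D : mnorm (A - D) <= mnorm (A - B) + mnorm (B - D).
Proof. by rewrite -[A - D](subrKA B) mnormD. Qed.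

Lemma mnormZ x A : mnorm (x *: A) = cabs x * mnorm A.
Proof.
rewrite /mnorm mulr_sumr; apply: eq_bigr => i _; rewrite mulr_sumr.
by apply: eq_bigr => j _; rewrite mxE cabsM.
Qed.

End Theory.

Lemma mnorm_row a (u : 'rV[F]_a) : mnorm u = \sum_j cabs (u 0 j).
Proof. by rewrite /mnorm big_ord1. Qed.

Lemma mnormM a b c (A : 'M[F]_(a, b)) (B : 'M[F]_(b, c)) :
  mnorm (A *m B) <= mnorm A * mnorm B.
Proof.
rewrite /mnorm mulr_suml; apply: ler_sum => i _.
apply: (@le_trans _ _ (\sum_k \sum_j cabs (A i j) * cabs (B j k))).
  apply: ler_sum => k _; rewrite mxE (le_trans (cabs_sum _))//.
  by apply: ler_sum => j _; rewrite cabsM.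
rewrite exchange_big /= mulr_suml; apply: ler_sum => j _.
rewrite -mulr_sumr ler_wpM2l ?cabs_ge0//.
rewrite [leRHS](bigD1 j)//= lerDl; apply: sumr_ge0 => *.
by apply: sumr_ge0 => *; apply: cabs_ge0.
Qed.

Lemma dyadic_cauchy_mx a b (u : nat -> 'M[F]_(a, b)) (c : R) :
  (forall i, mnorm (u i.+1 - u i) <= c / 2 ^+ i) ->
  exists l K, forall i, mnorm (l - u i) <= K / 2 ^+ i.
Proof.
move=> hu.
have h (ij : 'I_a * 'I_b) : exists l K, forall s,
    cabs (l - u s ij.1 ij.2) <= K / 2 ^+ s.
  apply: (@absval_complete _ _ cabs _ c) => s; apply: le_trans (hu s).
  by have := mnorm_entry (u s.+1 - u s) ij.1 ij.2; rewrite !mxE.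
have /choice [l /choice [K hK]] := h.
exists (\matrix_(i, j) l (i, j)), (\sum_i \sum_j K (i, j)) => s.
rewrite /mnorm mulr_suml; apply: ler_sum => i _; rewrite mulr_suml.
by apply: ler_sum => j _; rewrite !mxE; apply: (hK (i, j)).
Qed.

(** The bound on T 0 keeps the iterates of 0 in the ball of radius r, where they
    converge geometrically. *)
Lemma contraction_fixpoint a b (T : 'M[F]_(a, b) -> 'M[F]_(a, b)) (r : R) :
  (forall x y : 'M[F]_(a, b), mnorm x <= r -> mnorm y <= r ->
     mnorm (T x - T y) <= mnorm (x - y) / 2) ->
  mnorm (T 0) <= r / 2 -> exists2 x : 'M[F]_(a, b), mnorm x <= r & T x = x.
Proof.
move=> hT hT0.
have r0 : 0 <= r.
  by have := le_trans (mnorm_ge0 (T 0)) hT0; rewrite pmulr_lge0.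
have stab (x : 'M[F]_(a, b)) : mnorm x <= r -> mnorm (T x) <= r.
  move=> xr; have := hT x 0 xr; rewrite mnorm0 subr0 => /(_ r0) h.
  by have := mnormD (T x - T 0) (T 0); rewrite subrK; lra.
pose u i := iter i T 0.
have ur i : mnorm (u i) <= r by elim: i => [|i]; [rewrite mnorm0|apply: stab].
have hu i : mnorm (u i.+1 - u i) <= (r / 2) / 2 ^+ i.
  elim: i => [|i IH]; first by rewrite /= subr0 expr0 divr1.
  have := hT _ _ (ur i.+1) (ur i); rewrite -!iterS -/(u i.+2) => h.
  by apply: le_trans h _; rewrite exprSr invfM mulrA ler_wpM2r ?invr_ge0.
have [l [K hl]] := dyadic_cauchy_mx hu.
have lr : mnorm l <= r.
  rewrite -subr_le0; apply: (@dyadic_small _ _ K) => i.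
  by have := mnormD (l - u i) (u i); have := hl i; have := ur i; rewrite subrK; lra.
exists l => //; apply/eqP; rewrite -subr_eq0; apply/eqP/mnorm0_eq.
apply/eqP; rewrite eq_le mnorm_ge0 andbT; apply: (@dyadic_small _ _ (2 * K)) => i.
have h1 : mnorm (T l - u i.+1) <= mnorm (l - u i) / 2 := hT _ _ lr (ur i).
have h2 := hl i; have h3 := hl i.+1.
have h4 := mnorm_triangle (T l) (u i.+1) l; rewrite (mnormBC (u i.+1)) in h4.
have K0 : 0 <= K.
  by have := hl 0%N; rewrite expr0 divr1; apply: le_trans; apply: mnorm_ge0.
have h5 : K / 2 ^+ i.+1 <= K / 2 ^+ i.
  rewrite ler_wpM2l// lef_pV2 ?posrE ?exprn_gt0//.
  by rewrite exprS ler_peMl ?exprn_ge0// ler1n.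
have h6 := mnorm_ge0 (l - u i).
by rewrite -mulrA; lra.
Qed.

End EntrywiseNorm.

Section ComplexAbsoluteValue.
Variable R : realType.
Local Notation C := (Cplx R).
Local Notation cabs := (@ComplexField.Normc.normc R).

Lemma cabs_Re (x : C) : `|complex.Re x| <= cabs x.
Proof. by have := normc_ge_Re x; rewrite -lecR. Qed.

Lemma cabs_Im (x : C) : `|complex.Im x| <= cabs x.
Proof.
case: x => a b; rewrite /= -sqrtr_sqr ler_wsqrtr// lerDr.
exact: sqr_ge0.
Qed.

Lemma cabs_ReIm (x : C) : cabs x <= `|complex.Re x| + `|complex.Im x|.
Proof.
case: x => a b; rewrite /= -[leRHS]ger0_norm ?addr_ge0// -sqrtr_sqr.
rewrite ler_wsqrtr// sqrrD !real_normK ?num_real// lerD2r lerDl.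
by rewrite mulrn_wge0// mulr_ge0.
Qed.

Lemma complex_complete (u : nat -> C) (c : R) :
  (forall i, cabs (u i.+1 - u i) <= c / 2 ^+ i) ->
  exists l K, forall i, cabs (l - u i) <= K / 2 ^+ i.
Proof.
move=> hu.
have [re hre] : exists l, forall s, `|l - complex.Re (u s)| <= 2 * c / 2 ^+ s.
  apply: dyadic_cauchy => s; apply: le_trans (hu s).
  apply: le_trans (cabs_Re _); rewrite le_eqVlt; apply/orP; left; apply/eqP.
  by congr (`|_|); case: (u s.+1); case: (u s).
have [im him] : exists l, forall s, `|l - complex.Im (u s)| <= 2 * c / 2 ^+ s.
  apply: dyadic_cauchy => s; apply: le_trans (hu s).
  apply: le_trans (cabs_Im _); rewrite le_eqVlt; apply/orP; left; apply/eqP.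
  by congr (`|_|); case: (u s.+1); case: (u s).
exists (Complex re im), (2 * c + 2 * c) => s; apply: le_trans (cabs_ReIm _) _.
rewrite mulrDl; apply: lerD.
  by apply: le_trans (hre s); case: (u s).
by apply: le_trans (him s); case: (u s).
Qed.

Definition complex_abs : absolute_value R C.
Proof.
apply: (@AbsoluteValue R C cabs).
- by move=> x; have := normr_ge0 x; rewrite -[`|x|]/(((cabs x)%:C)%C) ler0c.
- move=> x; apply/eqP/eqP => [|->]; first exact: ComplexField.Normc.eq0_normc.
  exact: ComplexField.Normc.normc0.
- by move=> x y; have := ler_normD x y; rewrite -lecR raddfD.
- exact: ComplexField.Normc.normcM.
- by move=> i; apply: complexI; rewrite rmorph_nat -[LHS]/(`|i%:R : C|) normr_nat.
- exact: complex_complete.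
Defined.

End ComplexAbsoluteValue.

(** * Taylor estimates for polynomials *)

Lemma uniform_bound (R : realType) (I : finType) (Q : I -> R -> Prop) :
  (forall i K K', K <= K' -> Q i K -> Q i K') ->
  (forall i, exists2 K, 0 <= K & Q i K) -> exists2 K, 0 <= K & forall i, Q i K.
Proof.
move=> mono h.
have /choice [K hK] : forall i, exists K, 0 <= K /\ Q i K.
  by move=> i; have [K] := h i; exists K.
exists (\sum_i K i) => [|i]; first by apply: sumr_ge0 => i _; case: (hK i).
have [_] := hK i; apply: mono; rewrite (bigD1 i)//= lerDl.
by apply: sumr_ge0 => j _; case: (hK j).
Qed.

Section RingIdentities.
Variable A : comPzRingType.
Implicit Types x y a b : A.

Lemma leibniz_split p q a b y : (a * q + p * b) * y = p * (b * y) + q * (a * y) :> A.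
Proof. ring. Qed.

Lemma remainderD p q p' q' a b :
  p' + q' - (p + q) - (a + b) = (p' - p - a) + (q' - q - b) :> A.
Proof. ring. Qed.

Lemma remainderM p q p' q' a b : p' * q' - p * q - (p * b + q * a) =
  (p' - p - a) * q' + ((p + a) * (q' - q - b) + a * b) :> A.
Proof. ring. Qed.

Lemma remainder_split q q' b : q' = (q' - q - b) + (q + b) :> A.
Proof. ring. Qed.

End RingIdentities.

(** The constant of a product in poly_taylor; p0, p1, p2 bound the value, the
    differential and the remainder of the first factor at an increment of size
    t, and likewise for q. *)
Lemma taylor_product_bound (R : realType) (M t Kp Kq p0 p1 p2 q0 q1 q2 a b c : R) :
  0 <= M -> 0 <= t -> t <= M -> 0 <= Kp -> 0 <= Kq ->
  0 <= p0 -> 0 <= p1 -> 0 <= p2 -> 0 <= q0 -> 0 <= q1 -> 0 <= q2 ->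
  p0 <= Kp -> p1 <= Kp * t -> p2 <= Kp * t ^+ 2 ->
  q0 <= Kq -> q1 <= Kq * t -> q2 <= Kq * t ^+ 2 ->
  a <= p0 * q0 -> b <= p0 * q1 + q0 * p1 ->
  c <= p2 * (q2 + (q0 + q1)) + ((p0 + p1) * q2 + p1 * q1) ->
  let K := Kp * Kq * (3 + 2 * M + M ^+ 2) in
  [/\ a <= K, b <= K * t & c <= K * t ^+ 2].
Proof.
move=> M0 t0 tM Kp0 Kq0 p00 p10 p20 q00 q10 q20 hp0 hp1 hp2 hq0 hq1 hq2 ha hb hc K.
have t2M : t ^+ 2 <= M ^+ 2 by rewrite lerXn2r ?nnegrE.
have M20 := exprn_ge0 2 M0; have t20 := exprn_ge0 2 t0.
have KK0 : 0 <= Kp * Kq by rewrite mulr_ge0.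
split.
- apply: le_trans ha _; apply: (@le_trans _ _ (Kp * Kq)); first by rewrite ler_pM.
  by rewrite /K ler_peMr//; lra.
- apply: le_trans hb _; apply: (@le_trans _ _ (Kp * (Kq * t) + Kq * (Kp * t))).
    by apply: lerD; rewrite ler_pM.
  rewrite [leLHS](_ : _ = Kp * Kq * 2 * t); last by ring.
  by rewrite /K ler_wpM2r// ler_wpM2l//; lra.
- apply: le_trans hc _.
  have q4 : q2 + (q0 + q1) <= Kq * (1 + M + M ^+ 2).
    apply: (@le_trans _ _ (Kq * t ^+ 2 + (Kq + Kq * t))); first by rewrite !lerD.
    rewrite [leLHS](_ : _ = Kq * (1 + t + t ^+ 2)); last by ring.
    by rewrite ler_wpM2l//; lra.
  have p4 : p0 + p1 <= Kp * (1 + M).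
    apply: (@le_trans _ _ (Kp + Kp * t)); first by rewrite lerD.
    rewrite [leLHS](_ : _ = Kp * (1 + t)); last by ring.
    by rewrite ler_wpM2l//; lra.
  apply: (@le_trans _ _ (Kp * t ^+ 2 * (Kq * (1 + M + M ^+ 2)) +
      (Kp * (1 + M) * (Kq * t ^+ 2) + (Kp * t) * (Kq * t)))).
    by rewrite !lerD// ler_pM ?addr_ge0.
  by rewrite le_eqVlt; apply/orP; left; apply/eqP; rewrite /K; ring.
Qed.

Section PolynomialEstimates.
Variables (R : realType) (F : fieldType) (cabs : absolute_value R F) (n : nat).
Local Notation V := 'rV[F]_n.
Local Notation poly := (mpoly n F).
Local Notation mnorm := (mnorm cabs).
Local Notation mev p u := (meval (fun i => u 0 i) p).
Implicit Types (p q : poly) (u h : V).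

Definition differential p u h : F := \sum_l mev (mderiv l p) u * h 0 l.

Lemma differentialM p q u h : differential (p * q) u h =
  mev p u * differential q u h + mev q u * differential p u h.
Proof.
rewrite /differential !mulr_sumr -big_split /=; apply: eq_bigr => l _.
by rewrite mderivM mevalD !mevalM leibniz_split.
Qed.

(** Values and differentials are bounded together with the remainders, because the
    remainder of a product involves all three. *)
Lemma poly_taylor p (M : R) : 0 <= M -> exists2 K : R, 0 <= K & forall u h,
  mnorm u <= M -> mnorm h <= M ->
  [/\ cabs (mev p u) <= K, cabs (differential p u h) <= K * mnorm h &
    cabs (mev p (u + h) - mev p u - differential p u h) <= K * mnorm h ^+ 2].
Proof.
move=> M0.
elim/mpoly_ring_ind: p => [c|i|p q [Kp Kp0 hp] [Kq Kq0 hq]|p q [Kp Kp0 hp] [Kq Kq0 hq]].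
- exists (cabs c) => [|u h _ _]; first exact: cabs_ge0.
  rewrite !mevalC subrr /differential big1 ?subr0 ?cabs0 => [|l _]; last first.
    by rewrite mderivC -mpolyC0 mevalC mul0r.
  by split=> //; rewrite mulr_ge0 ?cabs_ge0 ?exprn_ge0 ?mnorm_ge0.
- exists (M + 1) => [|u h hu hh]; first by rewrite addr_ge0.
  have -> : differential (mpolyX F (mnm1 i)) u h = h 0 i.
    rewrite /differential (bigD1 i)//= big1 ?addr0 => [|l li].
      rewrite mderivX mnm1E eqxx scale1r.
      by rewrite -[X in mnm_sub X _]add0m addmK mpolyX0 -mpolyC1 mevalC mul1r.
    by rewrite mderivX mnm1E eq_sym (negbTE li) scale0r -mpolyC0 mevalC mul0r.
  rewrite !mevalXU mxE [X in cabs (X - _)]addrAC subrr add0r subrr cabs0.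
  have hi := mnorm_entry cabs h 0 i; have ui := mnorm_entry cabs u 0 i.
  have h0 := mnorm_ge0 cabs h; split; first lra.
    by apply: le_trans hi _; rewrite ler_peMl//; lra.
  by rewrite mulr_ge0 ?exprn_ge0//; lra.
- exists (Kp + Kq) => [|u h hu hh]; first by rewrite addr_ge0.
  have [p1 p2 p3] := hp u h hu hh; have [q1 q2 q3] := hq u h hu hh.
  have -> : differential (p + q) u h = differential p u h + differential q u h.
    rewrite /differential -big_split /=; apply: eq_bigr => l _.
    by rewrite mderivD mevalD mulrDl.
  rewrite !mevalD !mulrDl; split; try by rewrite (le_trans (cabsD cabs _ _))// lerD.
  by rewrite remainderD; apply: le_trans (cabsD cabs _ _) (lerD p3 q3).
- have M20 := exprn_ge0 2 M0.
  exists (Kp * Kq * (3 + 2 * M + M ^+ 2)) => [|u h hu hh].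
    by rewrite mulr_ge0 ?(mulr_ge0 Kp0 Kq0)// !addr_ge0// mulr_ge0.
  have [p1 p2 p3] := hp u h hu hh; have [q1 q2 q3] := hq u h hu hh.
  have h0 := mnorm_ge0 cabs h; rewrite differentialM !mevalM remainderM.
  apply: (@taylor_product_bound R M (mnorm h) Kp Kq (cabs (mev p u))
    (cabs (differential p u h))
    (cabs (mev p (u + h) - mev p u - differential p u h))
    (cabs (mev q u)) (cabs (differential q u h))
    (cabs (mev q (u + h) - mev q u - differential q u h)));
    rewrite ?cabs_ge0//.
  - by rewrite cabsM.
  - by apply: le_trans (cabsD cabs _ _) _; rewrite !cabsM.
  - apply: le_trans (cabsD cabs _ _) _; apply: lerD.
      rewrite cabsM; apply: ler_wpM2l; first exact: cabs_ge0.
      rewrite {1}(remainder_split (mev q u) (mev q (u + h)) (differential q u h)).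
      by apply: le_trans (cabsD cabs _ _) _; rewrite lerD2l cabsD.
    apply: le_trans (cabsD cabs _ _) _; rewrite !cabsM lerD2r.
    by apply: ler_wpM2r; [exact: cabs_ge0|exact: cabsD].
Qed.

Lemma poly_lipschitz p (M : R) : 0 <= M -> exists2 K : R, 0 <= K & forall u h,
  mnorm u <= M -> mnorm h <= M ->
  cabs (mev p (u + h) - mev p u) <= K * mnorm h.
Proof.
move=> M0; have [K K0 hK] := poly_taylor p M0.
exists (K * (1 + M)) => [|u h hu hh]; first by rewrite mulr_ge0// addr_ge0.
have [_ h1 h2] := hK u h hu hh.
rewrite -[_ - _](subrK (differential p u h)); apply: le_trans (cabsD cabs _ _) _.
have : K * mnorm h ^+ 2 <= K * (M * mnorm h).
  by rewrite expr2 ler_wpM2l// ler_wpM2r// mnorm_ge0.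
by rewrite mulrDr mulr1 mulrDl -mulrA; lra.
Qed.

Section Systems.
Variables (k : nat) (p : 'I_k -> poly).

Definition sys u : 'rV[F]_k := \row_j mev (p j) u.

Definition sysJ u : 'M[F]_(n, k) := \matrix_(l, j) mev (mderiv l (p j)) u.

Lemma mul_sysJ u h : h *m sysJ u = \row_j differential (p j) u h.
Proof.
apply/rowP => j; rewrite !mxE; apply: eq_bigr => l _.
by rewrite mxE mulrC.
Qed.

Lemma sys_taylor (M : R) : 0 <= M -> exists2 K : R, 0 <= K & forall u h,
  mnorm u <= M -> mnorm h <= M ->
  [/\ mnorm (sys (u + h) - sys u - h *m sysJ u) <= K * mnorm h ^+ 2,
      mnorm (sysJ (u + h) - sysJ u) <= K * mnorm h & mnorm (sysJ u) <= K].
Proof.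
move=> M0.
have [K1 K10 h1] : exists2 K, 0 <= K & forall j, forall u h,
    mnorm u <= M -> mnorm h <= M ->
    cabs (mev (p j) (u + h) - mev (p j) u - differential (p j) u h) <=
      K * mnorm h ^+ 2.
  apply: uniform_bound => [j K K' KK' hK u h hu hh|j].
    by apply: le_trans (hK u h hu hh) _; rewrite ler_wpM2r// exprn_ge0// mnorm_ge0.
  have [K K0 hK] := poly_taylor (p j) M0; exists K => // u h hu hh.
  by have [] := hK u h hu hh.
have [K2 K20 h2] : exists2 K, 0 <= K & forall lj : 'I_n * 'I_k, forall u h,
    mnorm u <= M -> mnorm h <= M ->
    cabs (mev (mderiv lj.1 (p lj.2)) (u + h) - mev (mderiv lj.1 (p lj.2)) u)
      <= K * mnorm h.
  apply: uniform_bound => [j K K' KK' hK u h hu hh|j].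
    by apply: le_trans (hK u h hu hh) _; rewrite ler_wpM2r// mnorm_ge0.
  exact: poly_lipschitz.
have [K3 K30 h3] : exists2 K, 0 <= K & forall lj : 'I_n * 'I_k, forall u,
    mnorm u <= M -> cabs (mev (mderiv lj.1 (p lj.2)) u) <= K.
  apply: uniform_bound => [j K K' KK' hK u hu|j].
    exact: le_trans (hK u hu) _.
  have [K K0 hK] := poly_taylor (mderiv j.1 (p j.2)) M0; exists K => // u hu.
  by have [] := hK u 0 hu; rewrite ?mnorm0.
exists (K1 *+ (1 * k) + K2 *+ (n * k) + K3 *+ (n * k)).
  by rewrite !addr_ge0// mulrn_wge0.
move=> u h hu hh; have h0 := mnorm_ge0 cabs h; have hh0 := exprn_ge0 2 h0.
have [a1 a2 a3] : [/\ 0 <= K1 *+ (1 * k), 0 <= K2 *+ (n * k)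
  & 0 <= K3 *+ (n * k)] by split; apply: mulrn_wge0.
split.
- apply: (@le_trans _ _ (K1 *+ (1 * k) * mnorm h ^+ 2)); last first.
    by rewrite ler_wpM2r//; lra.
  rewrite mulrnAl; apply: mnorm_le => i j; rewrite mul_sysJ !mxE.
  exact: h1.
- apply: (@le_trans _ _ (K2 *+ (n * k) * mnorm h)); last first.
    by rewrite ler_wpM2r//; lra.
  rewrite mulrnAl; apply: mnorm_le => i j; rewrite !mxE.
  exact: (h2 (i, j)).
- apply: (@le_trans _ _ (K3 *+ (n * k))); last by lra.
  by apply: mnorm_le => i j; rewrite !mxE; apply: (h3 (i, j)).
Qed.

End Systems.

End PolynomialEstimates.

(** * The implicit function theorem *)

(** The numbers x, d and h are the sizes of a change of coordinates, of a change of
    base point and directions, and of the resulting displacement; r is chosen so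
    small that half of x dominates all terms proportional to x. *)
Lemma ift_bound (R : realType) (h w x d K beta r E : R) :
  0 <= K -> 1 <= beta -> 0 < r -> r <= 1 -> r * E <= 1 / 2 ->
  E = K * (2 * (1 + beta)) * beta + K + beta * (K * (1 + beta)) ->
  0 <= h -> 0 <= x -> 0 <= d -> 0 <= w -> w <= d ->
  h <= 2 * (r * (1 + beta)) -> h <= beta * x + w ->
  K * h ^+ 2 + (x * (r * (K + beta * (K * (1 + beta)))) + d * K) <=
  x / 2 + (2 * (1 + beta) * K + K) * d.
Proof.
move=> K0 b1 r0 r1 rE eE h0 x0 d0 w0 wd h1 h2.
have h3 : h ^+ 2 <= 2 * (r * (1 + beta)) * (beta * x + d).
  rewrite expr2; apply: ler_pM => //; apply: le_trans h2 _; lra.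
have h4 : K * h ^+ 2 <= K * (2 * (r * (1 + beta)) * (beta * x + d)).
  by rewrite ler_wpM2l.
have h5 : x * (r * E) <= x * (1 / 2) by rewrite ler_wpM2l.
have h6 : r * (2 * (1 + beta) * K * d) <= 2 * (1 + beta) * K * d.
  by rewrite ler_piMl// !mulr_ge0//; lra.
move: h5; rewrite eE => h5.
have e1 : K * (2 * (r * (1 + beta)) * (beta * x + d)) +
    (x * (r * (K + beta * (K * (1 + beta)))) + d * K) =
    x * (r * (K * (2 * (1 + beta)) * beta + K + beta * (K * (1 + beta)))) +
    r * (2 * (1 + beta) * K * d) + K * d by ring.
have e2 : (2 * (1 + beta) * K + K) * d = 2 * (1 + beta) * K * d + K * d by ring.
by rewrite e2; lra.
Qed.

Section ImplicitFunction.
Variables (R : realType) (F : fieldType) (cabs : absolute_value R F).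
Variables (n k : nat) (p : 'I_k -> mpoly n F).
Local Notation mnorm := (mnorm cabs).
Local Notation mnorm_ge0 := (mnorm_ge0 cabs).
Local Notation f := (sys p).
Local Notation df := (sysJ p).

(** A row vector v with v *m A = 0 satisfies v = - v *m (A - 1), and so is at most
    half as large as itself. *)
Lemma near1_unit (A : 'M[F]_k) : mnorm (A - 1%:M) <= 1 / 2 -> A \in unitmx.
Proof.
move=> hA; rewrite -row_free_unit -kermx_eq0; apply/eqP/(@mnorm0_eq _ _ cabs).
apply/eqP; rewrite eq_le mnorm_ge0 andbT.
have h : kermx A = - (kermx A *m (A - 1%:M)).
  by rewrite mulmxBr mulmx_ker mulmx1 sub0r opprK.
have := mnormM cabs (kermx A) (A - 1%:M); rewrite -mnormN -h => h1.
have h2 : mnorm (kermx A) * mnorm (A - 1%:M) <= mnorm (kermx A) * (1 / 2).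
  by rewrite ler_wpM2l ?mnorm_ge0.
by lra.
Qed.

Variables (z : 'rV[F]_n) (b : 'M[F]_(k, n)).
Hypothesis bdf : b *m df z = 1%:M.

(** Points are written y + c *m B with base point y near z and directions B near
    b; as b is dual to the differential at z, the map c |-> f (y + c *m B) is
    close to the identity, uniformly in y and B. *)
Lemma near_identity : exists r K : R, [/\ 0 < r, 0 <= K,
  forall y y' B B' c c',
    mnorm (y - z) <= r -> mnorm (y' - z) <= r -> mnorm (B - b) <= r ->
    mnorm (B' - b) <= r -> mnorm c <= r -> mnorm c' <= r ->
    mnorm (f (y + c *m B) - f (y' + c' *m B') - (c - c')) <=
      mnorm (c - c') / 2 + K * (mnorm (y - y') + mnorm (B - B')) &
  forall y B c, mnorm (y - z) <= r -> mnorm (B - b) <= r -> mnorm c <= r ->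
    mnorm (B *m df (y + c *m B) - 1%:M) <= 1 / 2].
Proof.
have [beta ebeta] : exists beta, beta = mnorm b + 1 by exists (mnorm b + 1).
have b0 := mnorm_ge0 b.
have [|K K0 hK] := @sys_taylor _ _ cabs _ _ p (mnorm z + 2 * (1 + beta)).
  by have := mnorm_ge0 z; rewrite ebeta; lra.
pose E := K * (2 * (1 + beta)) * beta + K + beta * (K * (1 + beta)).
have beta1 : 1 <= beta by rewrite ebeta; lra.
have E0 : 0 <= E.
  by rewrite /E !addr_ge0// !mulr_ge0//; lra.
pose r := (2 * (E + 1))^-1.
have r0 : 0 < r by rewrite invr_gt0; lra.
have rE : r * E <= 1 / 2.
  have : r * (2 * (E + 1)) = 1 by rewrite mulVf//; lra.
  by rewrite mulrCA mulrDr mulr1; lra.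
have r1 : r <= 1 by rewrite invf_le1; lra.
have z0 := mnorm_ge0 z.
have pt y B c : mnorm (y - z) <= r -> mnorm (B - b) <= r -> mnorm c <= r ->
    mnorm B <= beta /\ mnorm (y + c *m B - z) <= r * (1 + beta).
  move=> hy hB hc.
  have B1 : mnorm B <= beta.
    by have := mnormD cabs (B - b) b; rewrite subrK ebeta; lra.
  split=> //; rewrite addrAC.
  have := mnormD cabs (y - z) (c *m B); have := mnormM cabs c B.
  have : mnorm c * mnorm B <= r * beta by rewrite ler_pM ?mnorm_ge0.
  by lra.
have ptz u : mnorm (u - z) <= r * (1 + beta) -> mnorm u <= mnorm z + (1 + beta).
  move=> hu; have := mnormD cabs (u - z) z; rewrite subrK.
  have : r * (1 + beta) <= 1 + beta by rewrite ler_piMl//; lra.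
  by lra.
have hJ B u : mnorm (B - b) <= r -> mnorm (u - z) <= r * (1 + beta) ->
    mnorm (B *m df u - 1%:M) <= r * (K + beta * (K * (1 + beta))).
  move=> hB hu.
  have -> : B *m df u - 1%:M = (B - b) *m df u + b *m (df u - df z).
    by rewrite mulmxBl mulmxBr bdf addrA subrK.
  have uM := ptz _ hu; have rb : r * (1 + beta) <= 1 + beta by rewrite ler_piMl//; lra.
  have [||_ _ h1] := hK u 0; rewrite ?mnorm0; try lra.
  have [||_ h2 _] := hK z (u - z); try lra.
  rewrite (addrC z) subrK in h2.
  apply: le_trans (mnormD _ _ _) _; rewrite mulrDr; apply: lerD.
    by apply: le_trans (mnormM _ _ _) _; rewrite ler_pM ?mnorm_ge0.
  apply: le_trans (mnormM _ _ _) _; rewrite mulrCA; apply: ler_pM; rewrite ?mnorm_ge0//.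
    by rewrite ebeta; lra.
  by apply: le_trans h2 _; rewrite mulrCA ler_wpM2l.
exists r, (2 * (1 + beta) * K + K); split=> //.
- by rewrite addr_ge0// !mulr_ge0//; lra.
- move=> y y' B B' c c' hy hy' hB hB' hc hc'.
  have [B1 hu] := pt y B c hy hB hc; have [B1' hu'] := pt y' B' c' hy' hB' hc'.
  set u := y + c *m B in hu *; set u' := y' + c' *m B' in hu' *.
  pose w := (y - y') + c' *m (B - B').
  have eh : u - u' = (c - c') *m B + w.
    rewrite /u /u' /w mulmxBl mulmxBr opprD addrACA [RHS]addrCA; congr (_ + _).
    by rewrite addrA subrK.
  set h := u - u' in eh.
  have hw : mnorm w <= mnorm (y - y') + mnorm (B - B').
    apply: le_trans (mnormD _ _ _) _; rewrite lerD2l.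
    apply: le_trans (mnormM _ _ _) _; rewrite ler_piMl ?mnorm_ge0//; lra.
  have hh : mnorm h <= 2 * (r * (1 + beta)).
    by have := mnorm_triangle cabs u z u'; rewrite (mnormBC _ z); rewrite -/h; lra.
  have hh' : mnorm h <= beta * mnorm (c - c') + mnorm w.
    rewrite eh; apply: le_trans (mnormD _ _ _) _; rewrite lerD2r.
    by apply: le_trans (mnormM _ _ _) _; rewrite mulrC ler_wpM2r ?mnorm_ge0.
  have rb : r * (1 + beta) <= 1 + beta by rewrite ler_piMl//; lra.
  have hu'' := ptz _ hu'.
  have [||h1 _ h2] := hK u' h; try lra.
  rewrite (addrC u') subrK in h1.
  have -> : f u - f u' - (c - c') = (f u - f u' - h *m df u') +
      ((c - c') *m (B *m df u' - 1%:M) + w *m df u').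
    have -> : h *m df u' = (c - c') *m (B *m df u') + w *m df u'.
      by rewrite eh mulmxDl mulmxA.
    by rewrite mulmxBr mulmx1 (addrAC _ (- (c - c')) (w *m _)) addrA subrK.
  have h3 := hJ B u' hB hu'.
  have h4 : mnorm ((c - c') *m (B *m df u' - 1%:M)) <=
      mnorm (c - c') * (r * (K + beta * (K * (1 + beta)))).
    by apply: le_trans (mnormM _ _ _) _; rewrite ler_wpM2l ?mnorm_ge0.
  have h5 : mnorm (w *m df u') <= (mnorm (y - y') + mnorm (B - B')) * K.
    by apply: le_trans (mnormM _ _ _) _; rewrite ler_pM ?mnorm_ge0.
  apply: le_trans (mnormD _ _ _) _.
  apply: le_trans (lerD (lexx _) (mnormD _ _ _)) _.
  apply: le_trans (lerD h1 (lerD h4 h5)) _.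
  apply: (@ift_bound _ _ (mnorm w) _ _ K beta r E) => //; rewrite ?mnorm_ge0//; try lra.
  by rewrite addr_ge0 ?mnorm_ge0.
- move=> y B c hy hB hc; have [_ hu] := pt y B c hy hB hc.
  apply: le_trans (hJ B _ hB hu) _.
  apply: le_trans rE; rewrite ler_wpM2l ?(ltW r0)// /E.
  by rewrite -addrA lerDr !mulr_ge0//; lra.
Qed.

(** Existence by Picard iteration of c |-> c - f (y + c *m B), which contracts
    by near_identity; the Lipschitz bound contains uniqueness. *)
Lemma implicit_function : f z = 0 -> exists r e K : R,
  [/\ [/\ 0 < e, e <= r & 0 <= K],
  forall y B, mnorm (y - z) <= e -> mnorm (B - b) <= e ->
    exists2 c, mnorm c <= r & f (y + c *m B) = 0,
  forall y y' B B' c c',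
    mnorm (y - z) <= e -> mnorm (y' - z) <= e -> mnorm (B - b) <= e ->
    mnorm (B' - b) <= e -> mnorm c <= r -> mnorm c' <= r ->
    mnorm (c - c') <= K * (mnorm (f (y + c *m B) - f (y' + c' *m B')) +
      (mnorm (y - y') + mnorm (B - B'))) &
  forall y B c, mnorm (y - z) <= e -> mnorm (B - b) <= e -> mnorm c <= r ->
    B *m df (y + c *m B) \in unitmx].
Proof.
move=> fz; have [r [K [r0 K0 near_id near_dual]]] := near_identity.
pose e := r / (2 * (K + 1)).
have K1 : 2 * (K + 1) != 0 by rewrite gt_eqF//; lra.
have eK : e * (2 * (K + 1)) = r by rewrite divfK.
have e0 : 0 < e by rewrite divr_gt0//; lra.
have er : e <= r.
  by rewrite -eK ler_peMr ?(ltW e0)//; lra.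
exists r, e, (2 * (K + 1)); split.
- by split=> //; lra.
- move=> y B hy hB.
  have [||c cr hc] := @contraction_fixpoint _ _ cabs _ _ (fun c => c - f (y + c *m B)) r.
  + move=> c c' hc hc'.
    have := near_id y y B B c c' (le_trans hy er) (le_trans hy er)
      (le_trans hB er) (le_trans hB er) hc hc'.
    rewrite !subrr !mnorm0 addr0 mulr0 addr0 => h; apply: le_trans h.
    by rewrite [leRHS]mnormBC opprD opprK addrACA opprB [- _ + _]addrC.
  + have m0 : mnorm (0 : 'rV[F]_k) <= r by rewrite mnorm0 ltW.
    have z0 : mnorm (z - z) <= r by rewrite subrr mnorm0 ltW.
    have := near_id y z B B 0 0 (le_trans hy er) z0 (le_trans hB er) (le_trans hB er) m0 m0.
    rewrite !mul0mx !addr0 fz !subr0 sub0r mnormN subrr !mnorm0 mul0r add0r addr0.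
    move=> h; apply: le_trans h _.
    have h1 : K * mnorm (y - z) <= K * e by rewrite ler_wpM2l.
    by rewrite -eK; lra.
  exists c => //; apply/eqP; rewrite -oppr_eq0; apply/eqP.
  by apply: (addrI c); rewrite addr0.
- move=> y y' B B' c c' hy hy' hB hB' hc hc'.
  have := near_id y y' B B' c c' (le_trans hy er) (le_trans hy' er)
    (le_trans hB er) (le_trans hB' er) hc hc'.
  set a := f _ - f _; set d := mnorm (y - y') + _ => h1.
  have := mnormB cabs a (a - (c - c')); rewrite opprB addrC subrK => h2.
  have a0 := mnorm_ge0 a; have d0 : 0 <= d by rewrite addr_ge0 ?mnorm_ge0.
  have h3 : 0 <= K * mnorm a by rewrite mulr_ge0.
  by lra.
- move=> y B c hy hB hc; apply: near1_unit; apply: near_dual => //.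
    exact: le_trans er.
  exact: le_trans er.
Qed.

End ImplicitFunction.

(** * Equations implied near a smooth point *)

(** As long as Q i does not exceed 2 * A / M, the linear term of the increment is at
    most the constant one, so that each of the M steps adds at most
    2 * A / M ^+ 2. *)
Lemma discrete_gronwall (R : realType) (Q : nat -> R) (M : nat) (A : R) :
  (0 < M)%N -> 0 <= A -> (forall i, 0 <= Q i) -> Q 0%N = 0 ->
  (forall i, (i < M)%N -> Q i.+1 <= Q i + (Q i / 2 / M%:R + A / M%:R ^+ 2)) ->
  forall i, (i <= M)%N -> Q i <= 2 * A / M%:R ^+ 2 * i%:R.
Proof.
move=> M0 A0 Q0 Qz step; have m0 : 0 < M%:R :> R by rewrite ltr0n.
elim=> [_|i IH iM]; first by rewrite Qz mulr0.
have h1 := IH (ltnW iM); have h2 := step i iM.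
have h3 : Q i <= 2 * A / M%:R.
  apply: le_trans h1 _; apply: (@le_trans _ _ (2 * A / M%:R ^+ 2 * M%:R)).
    by rewrite ler_wpM2l ?ler_nat 1?ltnW// !mulr_ge0// invr_ge0 exprn_ge0// ltW.
  by rewrite expr2 invfM mulrA divfK// gt_eqF.
have h4 : Q i / 2 / M%:R <= A / M%:R ^+ 2.
  rewrite expr2 invfM [leRHS]mulrA ler_wpM2r ?invr_ge0 ?(ltW m0)//.
  by rewrite ler_pdivrMr// mulrC mulrA.
rewrite -[i.+1%:R]natr1 mulrDr mulr1; set B := A / _ in h2 h4 *.
have e2 : 2 * A / M%:R ^+ 2 = B + B by rewrite -mulrA -/B mulr_natl mulr2n.
by rewrite e2 in h1 *; lra.
Qed.

(** A step of size h <= t / N: rem is the Taylor remainder of the functions q, dq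
    their differential, and dp that of the equations p, of second order in h because
    the equations hold at both ends of the step. *)
Lemma gronwall_step (R : realType) (Q' Q rem dq sm dp h C Kp Kq t N : R) :
  Q' <= rem + sm -> rem <= Kq * h ^+ 2 -> sm <= Q + dq ->
  dq <= C * (dp + Q * h) -> dp <= Kp * h ^+ 2 ->
  0 <= h -> h <= t / N -> 0 < N -> 0 <= Q -> 0 <= C -> 0 <= Kp -> 0 <= Kq ->
  0 <= t -> C * t <= 1 / 2 ->
  Q' <= Q + (Q / 2 / N + (C * Kp + Kq) * t ^+ 2 / N ^+ 2).
Proof.
move=> h1 h2 h3 h4 h5 h0 hN N0 Q0 C0 Kp0 Kq0 t0 Ct.
have e1 : h ^+ 2 <= t ^+ 2 / N ^+ 2.
  by rewrite -expr_div_n lerXn2r ?nnegrE// divr_ge0// ltW.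
have e2 : Kq * h ^+ 2 <= Kq * (t ^+ 2 / N ^+ 2) by rewrite ler_wpM2l.
have e3 : C * (Kp * h ^+ 2) <= C * (Kp * (t ^+ 2 / N ^+ 2)).
  by rewrite ler_wpM2l// ler_wpM2l.
have e4 : C * (Q * h) <= Q / 2 / N.
  apply: (@le_trans _ _ (C * (Q * (t / N)))); first by rewrite !ler_wpM2l.
  have -> : C * (Q * (t / N)) = Q * (C * t) / N by ring.
  by rewrite ler_wpM2r ?invr_ge0 ?(ltW N0)// ler_wpM2l//; lra.
have e5 : C * dp <= C * (Kp * h ^+ 2) by rewrite ler_wpM2l.
have -> : (C * Kp + Kq) * t ^+ 2 / N ^+ 2 =
    C * (Kp * (t ^+ 2 / N ^+ 2)) + Kq * (t ^+ 2 / N ^+ 2) by ring.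
set T := t ^+ 2 / N ^+ 2 in e1 e2 e3 *; set U := Q / 2 / N in e4 *.
have e6 : dq <= C * dp + C * (Q * h) by rewrite -mulrDr.
by lra.
Qed.

Section Propagation.
Variables (R : realType) (F : fieldType) (cabs : absolute_value R F).
Variables (n k r : nat) (p : 'I_k -> mpoly n F) (q : 'I_r -> mpoly n F).
Local Notation mnorm := (mnorm cabs).
Local Notation mnorm_ge0 := (mnorm_ge0 cabs).
Local Notation mev p u := (meval (fun i => u 0 i) p).
Variables (z : 'rV[F]_n) (J : mpoly n F).
Hypothesis Jz : mev J z != 0.
Hypothesis dq_comb : forall l, exists (a : 'I_k -> mpoly n F)
  (c : 'I_n -> 'I_r -> mpoly n F), forall i, J * mderiv i (q l) =
    \sum_j mderiv i (p j) * a j + \sum_l' c i l' * q l'.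

Lemma poly_bounded (s : mpoly n F) (M : R) :
  exists2 K : R, 0 <= K & forall u : 'rV[F]_n, mnorm u <= M -> cabs (mev s u) <= K.
Proof.
have M0 : 0 <= `|M| := normr_ge0 M.
have [K K0 hK] := poly_taylor cabs s M0; exists K => // u hu.
have [||//] := hK u 0; last by rewrite mnorm0.
by apply: le_trans hu _; apply: ler_norm.
Qed.

(** Where J is bounded below, dq_comb bounds the differentials of the functions q
    in the directions tangent to p = 0 by the values of these functions. *)
Lemma tangential_bound : exists e C : R, [/\ 0 < e, 0 <= C & forall u h : 'rV[F]_n,
  mnorm (u - z) <= e ->
  mnorm (h *m sysJ q u) <= C * (mnorm (h *m sysJ p u) + mnorm (sys q u) * mnorm h)].
Proof.
have /choice [a /choice [c hac]] := dq_comb.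
have z0 := mnorm_ge0 z.
pose M := mnorm z + 1; have M0 : 0 <= M by rewrite /M; lra.
have [Ka Ka0 ha] : exists2 K, 0 <= K & forall lj : 'I_r * 'I_k, forall u : 'rV[F]_n,
    mnorm u <= M -> cabs (mev (a lj.1 lj.2) u) <= K.
  apply: uniform_bound => [lj K K' KK' hK u hu|lj]; last exact: poly_bounded.
  exact: le_trans (hK u hu) _.
have [Kc Kc0 hc] : exists2 K, 0 <= K & forall lil : 'I_r * 'I_n * 'I_r, forall u : 'rV[F]_n,
    mnorm u <= M -> cabs (mev (c lil.1.1 lil.1.2 lil.2) u) <= K.
  apply: uniform_bound => [lj K K' KK' hK u hu|lj]; last exact: poly_bounded.
  exact: le_trans (hK u hu) _.
have [KJ KJ0 hJ] := poly_lipschitz cabs J M0.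
have jz0 : 0 < cabs (mev J z) by rewrite lt_def absval_eq0 Jz cabs_ge0.
pose j0 := cabs (mev J z) / 2; have j00 : 0 < j0 by rewrite divr_gt0.
pose e := Num.min 1 (j0 / (KJ + 1)).
have e0 : 0 < e by rewrite lt_min ltr01 divr_gt0//; lra.
have e1 : e <= 1 by rewrite ge_min lexx.
have eJ : KJ * e <= j0.
  have : e <= j0 / (KJ + 1) by rewrite ge_min lexx orbT.
  rewrite ler_pdivlMr; last lra.
  by have := ltW e0; lra.
exists e, ((Ka + Kc) / j0 *+ r); split=> //.
  by rewrite mulrn_wge0// divr_ge0 ?addr_ge0// ltW.
move=> u h hu.
have uM : mnorm u <= M.
  by have := mnormD cabs (u - z) z; rewrite subrK /M; lra.
have Ju : j0 <= cabs (mev J u).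
  have zM : mnorm z <= M by rewrite /M; lra.
  have uzM : mnorm (u - z) <= M by rewrite /M; lra.
  have := hJ z (u - z) zM uzM; rewrite (addrC z) subrK => h1.
  have := cabsD cabs (mev J u) (mev J z - mev J u); rewrite (addrC (mev J u)) subrK.
  rewrite -(cabsN cabs (mev J z - mev J u)) opprB.
  have : KJ * mnorm (u - z) <= KJ * e by rewrite ler_wpM2l.
  by rewrite /j0 in eJ *; lra.
rewrite mulrnAl -[X in _ *+ X]mul1n; apply: mnorm_le => i l.
rewrite mul_sysJ mxE mulrAC ler_pdivlMr//.
apply: (@le_trans _ _ (cabs (differential (q l) u h) * cabs (mev J u))).
  by rewrite ler_wpM2l ?cabs_ge0.
rewrite mulrC -cabsM.
have -> : mev J u * differential (q l) u h =
    \sum_j mev (a l j) u * differential (p j) u h +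
    \sum_i \sum_l' (mev (c l i l') u * mev (q l') u) * h 0 i.
  rewrite /differential mulr_sumr.
  under [X in _ = X + _]eq_bigr do rewrite mulr_sumr.
  rewrite exchange_big -big_split /=; apply: eq_bigr => i' _.
  rewrite mulrA -mevalM hac mevalD !raddf_sum /= mulrDl !mulr_suml; congr (_ + _).
    by apply: eq_bigr => j _; rewrite mevalM mulrAC mulrC mulrA.
  by apply: eq_bigr => l' _; rewrite mevalM.
apply: le_trans (cabsD _ _ _) _.
have b1 : cabs (\sum_j mev (a l j) u * differential (p j) u h) <=
    Ka * mnorm (h *m sysJ p u).
  apply: le_trans (cabs_sum _ _) _; rewrite mul_sysJ mnorm_row mulr_sumr.
  apply: ler_sum => j _; rewrite cabsM mxE ler_wpM2r ?cabs_ge0//.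
  exact: (ha (l, j)).
have b2 : cabs (\sum_i \sum_l' (mev (c l i l') u * mev (q l') u) * h 0 i) <=
    Kc * (mnorm (sys q u) * mnorm h).
  apply: le_trans (cabs_sum _ _) _.
  rewrite mulrA [X in _ * X]mnorm_row mulr_sumr; apply: ler_sum => i' _.
  apply: le_trans (cabs_sum _ _) _.
  rewrite mnorm_row mulr_sumr mulr_suml; apply: ler_sum => l' _.
  rewrite !cabsM mxE ler_wpM2r ?cabs_ge0// ler_wpM2r ?cabs_ge0//.
  exact: (hc (l, i', l')).
apply: le_trans (lerD b1 b2) _.
have t1 := mnorm_ge0 (h *m sysJ p u).
have t2 : 0 <= mnorm (sys q u) * mnorm h by rewrite mulr_ge0 ?mnorm_ge0.
have t3 : 0 <= Kc * mnorm (h *m sysJ p u) by rewrite mulr_ge0.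
have t4 : 0 <= Ka * (mnorm (sys q u) * mnorm h) by rewrite mulr_ge0.
by lra.
Qed.

(** The equations p cut out near z a manifold on which the functions q_l satisfy a
    linear differential inequality; starting at z, where they vanish, they are
    followed along a polygon with vertices over the segment from z to x.  With N
    steps the error is of order 1 / N. *)
Lemma vanishing_propagates (b : 'M[F]_(k, n)) :
  b *m sysJ p z = 1%:M -> sys p z = 0 -> sys q z = 0 ->
  exists2 e : R, 0 < e &
    forall x, mnorm (x - z) <= e -> sys p x = 0 -> sys q x = 0.
Proof.
move=> bdf pz qz.
have [r0 [e0 [K [[e00 er K0] ex_c lip_c _]]]] := implicit_function cabs bdf pz.
have [e1 [C [e10 C0 tang]]] := tangential_bound.
pose D := 1 + K * mnorm b.
have b0 := mnorm_ge0 b; have z0 := mnorm_ge0 z.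
have D1 : 1 <= D by rewrite lerDl mulr_ge0.
have D0 : 0 < D by lra.
pose M := mnorm z + 2.
have M0 : 0 <= M by rewrite /M; lra.
have [Kp Kp0 hp] := sys_taylor cabs p M0.
have [Kq Kq0 hq] := sys_taylor cabs q M0.
pose e2 := Num.min e1 (Num.min 1 (2 * (C + 1))^-1).
have e20 : 0 < e2 by rewrite !lt_min e10 ltr01 invr_gt0; lra.
have e2e1 : e2 <= e1 by rewrite ge_min lexx.
have e21 : e2 <= 1 by rewrite !ge_min lexx orbT.
have e2C : C * e2 <= 1 / 2.
  have : e2 <= (2 * (C + 1))^-1 by rewrite !ge_min lexx !orbT.
  move=> h; have h1 : C * e2 <= C * (2 * (C + 1))^-1 by rewrite ler_wpM2l.
  apply: le_trans h1 _; rewrite ler_pdivrMr; lra.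
pose e := Num.min e0 (e2 / D).
exists e; first by rewrite lt_min e00 divr_gt0.
move=> x hx px; set s := mnorm (x - z) in hx.
have s0 : 0 <= s := mnorm_ge0 _.
have se0 : s <= e0 by apply: le_trans hx _; rewrite ge_min lexx.
pose t := D * s.
have te2 : t <= e2.
  by rewrite /t mulrC -ler_pdivlMr//; apply: le_trans hx _; rewrite ge_min lexx orbT.
have t0 : 0 <= t by rewrite mulr_ge0// ltW.
have r00 : 0 <= r0 by apply: le_trans (ltW e00) er.
have bb : mnorm (b - b) <= e0 by rewrite subrr mnorm0 ltW.
have c00 : mnorm (0 : 'rV[F]_k) <= r0 by rewrite mnorm0.
have zz : mnorm (z - z) <= e0 by rewrite subrr mnorm0 ltW.
pose E := (C * Kp + Kq) * t ^+ 2.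
have E0 : 0 <= E by rewrite mulr_ge0 ?exprn_ge0// addr_ge0// mulr_ge0.
apply: (@mnorm0_eq _ _ cabs); apply/eqP; rewrite eq_le mnorm_ge0 andbT.
apply: (@dyadic_small _ _ (2 * E)) => i0.
(* Powers of two as numbers of steps, to conclude by dyadic_small. *)
set N := (2 ^ i0)%N; have N0 : (0 < N)%N by rewrite expn_gt0.
have -> : 2 ^+ i0 = N%:R :> R by rewrite natrX.
have n0 : 0 < N%:R :> R by rewrite ltr0n.
have nF : (N%:R : F) != 0.
  by rewrite -(absval_eq0 cabs) absval_nat gt_eqF.
pose y i := z + (i%:R / N%:R) *: (x - z).
have frac i : cabs (i%:R / N%:R) = i%:R / N%:R.
  by rewrite cabsM cabsV !absval_nat.
have hy i : (i <= N)%N -> mnorm (y i - z) <= s.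
  move=> iN; rewrite addrC addKr mnormZ frac ler_piMl// ler_pdivrMr// mul1r.
  by rewrite ler_nat.
have ystep i : mnorm (y i.+1 - y i) = s / N%:R.
  have -> : y i.+1 - y i = N%:R^-1 *: (x - z).
    rewrite opprD addrACA subrr add0r -scalerBl -mulrBl -natr1 addrAC subrr.
    by rewrite add0r mul1r.
  by rewrite mnormZ cabsV absval_nat mulrC.
have /choice [c hc] : forall i, exists c, (i <= N)%N ->
    mnorm c <= r0 /\ sys p (y i + c *m b) = 0.
  move=> i; have [iN|] := leqP i N; last by exists 0.
  have [|c cr hc] := ex_c (y i) b _ bb; first exact: le_trans (hy i iN) se0.
  by exists c.
pose w i := y i + c i *m b.
have he0 i : (i <= N)%N -> mnorm (y i - z) <= e0.
  by move=> /hy h; apply: le_trans h se0.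
have cz i : (i <= N)%N -> mnorm (c i) <= K * mnorm (y i - z).
  move=> iN; have [cr hci] := hc i iN.
  have := lip_c (y i) z b b (c i) 0 (he0 i iN) zz bb bb cr c00.
  by rewrite hci mul0mx addr0 pz !subrr !subr0 mnorm0 add0r mnorm0 addr0.
have wz i : (i <= N)%N -> mnorm (w i - z) <= t.
  move=> iN; rewrite /w addrAC.
  have h1 := mnormD cabs (y i - z) (c i *m b).
  have h2 := mnormM cabs (c i) b.
  have h3 : mnorm (c i) * mnorm b <= K * s * mnorm b.
    rewrite ler_wpM2r//; apply: le_trans (cz i iN) _.
    by rewrite ler_wpM2l// hy.
  by have := hy i iN; rewrite /t /D; lra.
have wstep i : (i < N)%N -> mnorm (w i.+1 - w i) <= t / N%:R.
  move=> iN; have [cr hci] := hc i (ltnW iN); have [cr' hci'] := hc i.+1 iN.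
  have := lip_c (y i.+1) (y i) b b (c i.+1) (c i) (he0 _ iN) (he0 _ (ltnW iN)) bb bb cr' cr.
  rewrite hci hci' !subrr mnorm0 add0r mnorm0 addr0 ystep => h1.
  have -> : w i.+1 - w i = (y i.+1 - y i) + (c i.+1 - c i) *m b.
    by rewrite mulmxBl opprD addrACA.
  apply: le_trans (mnormD _ _ _) _; rewrite ystep /t /D.
  apply: le_trans (lerD (lexx _) (mnormM _ _ _)) _.
  have -> : (1 + K * mnorm b) * s / N%:R = s / N%:R + K * (s / N%:R) * mnorm b by ring.
  by rewrite lerD2l ler_wpM2r.
have w0 : w 0%N = z.
  have y0 : y 0%N = z by rewrite /y mul0r scale0r addr0.
  have := cz 0%N (leq0n _); rewrite y0 subrr mnorm0 mulr0 => h.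
  have c0 : c 0%N = 0.
    by apply: (@mnorm0_eq _ _ cabs); apply/eqP; rewrite eq_le h mnorm_ge0.
  by rewrite /w y0 c0 mul0mx addr0.
have wN : w N = x.
  have yN : y N = x by rewrite /y divff// scale1r addrC subrK.
  have [cr hcN] := hc N (leqnn N).
  have xz : mnorm (x - z) <= e0 by [].
  have := lip_c (y N) x b b (c N) 0 (he0 _ (leqnn N)) xz bb bb cr c00.
  rewrite hcN mul0mx addr0 px yN !subrr !subr0 !mnorm0 !addr0 mulr0 => h.
  have c0 : c N = 0.
    by apply: (@mnorm0_eq _ _ cabs); apply/eqP; rewrite eq_le h mnorm_ge0.
  by rewrite /w yN c0 mul0mx addr0.
pose Q i := mnorm (sys q (w i)).
have Qz : Q 0%N = 0 by rewrite /Q w0 qz mnorm0.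
suff step i : (i < N)%N ->
    Q i.+1 <= Q i + (Q i / 2 / N%:R + E / N%:R ^+ 2).
  have h := discrete_gronwall N0 E0 (fun i => mnorm_ge0 _) Qz step (leqnn N).
  rewrite -wN; apply: le_trans h _.
  by rewrite expr2 invfM mulrA divfK// gt_eqF.
move=> iN; set u := w i; set h := w i.+1 - w i.
have hu : mnorm (u - z) <= t := wz i (ltnW iN).
have hh : mnorm h <= t / N%:R := wstep i iN.
have tN : t / N%:R <= t by rewrite ler_pdivrMr// ler_peMr// ler1n.
have h00 := mnorm_ge0 h.
have uM : mnorm u <= M.
  by have := mnormD cabs (u - z) z; rewrite subrK /M; lra.
have hM : mnorm h <= M by rewrite /M; lra.
have uh : u + h = w i.+1 by rewrite addrC subrK.
have [q1 _ _] := hq u h uM hM; have [p1 _ _] := hp u h uM hM.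
have pu : sys p u = 0 by have [_] := hc i (ltnW iN).
have puh : sys p (u + h) = 0 by rewrite uh; have [_] := hc i.+1 iN.
rewrite puh pu !sub0r oppr0 add0r mnormN in p1.
have ue1 : mnorm (u - z) <= e1 by lra.
have tq := tang u h ue1.
have q2 : mnorm (sys q (u + h)) <=
    mnorm (sys q (u + h) - sys q u - h *m sysJ q u) + mnorm (sys q u + h *m sysJ q u).
  by apply: le_trans (mnormD _ _ _); rewrite -[_ - _ *m _]addrA -opprD subrK.
have q3 := mnormD cabs (sys q u) (h *m sysJ q u).
rewrite /Q -uh -/u; set Qu := mnorm (sys q u) in q3 tq *.
have Qu0 : 0 <= Qu := mnorm_ge0 _.
apply: (gronwall_step q2 q1 q3 tq p1) => //.
by apply: le_trans e2C; rewrite ler_wpM2l.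
Qed.

End Propagation.

(** * Differentiability from quadratic remainders *)

(** A quadratic remainder instead of little-o: explicit bounds are all that the
    calculus below manipulates. *)
Definition quadratic_diff (R : realType) (F : fieldType) (cabs : absolute_value R F)
    a b c d (f : 'M[F]_(a, b) -> 'M[F]_(c, d)) x (L : 'M[F]_(a, b) -> 'M[F]_(c, d)) : Prop :=
  exists e M : R, [/\ 0 < e, 0 <= M & forall h, mnorm cabs h < e ->
    mnorm cabs (f (x + h) - f x - L h) <= M * mnorm cabs h ^+ 2].

Section Differentiability.
Variables (R : realType) (K : numFieldType) (cabs : absolute_value R K).
Variable iota : {rmorphism R -> K}.
Hypothesis norm_iota : forall x : K, `|x| = iota (cabs x).
Hypothesis iota_lt : forall a b, (iota a < iota b) = (a < b).
Local Notation mnorm := (mnorm cabs).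
Local Notation mnorm_ge0 := (mnorm_ge0 cabs).

Lemma iota_le a b : (iota a <= iota b) = (a <= b).
Proof. by rewrite !le_eqVlt iota_lt (inj_eq (fmorph_inj iota)). Qed.

Lemma norm_le_mnorm a b (A : 'M[K]_(a, b)) : `|A| <= iota (mnorm A).
Proof.
have h : 0 <= iota (mnorm A) by rewrite -(rmorph0 iota) iota_le mnorm_ge0.
have hij i j : `|A i j| <= iota (mnorm A).
  by rewrite norm_iota iota_le mnorm_entry.
case/nonnegP: h hij => c h; rewrite /Num.Def.normr /= mx_normE num_le; apply/bigmax_leP.
split=> [|[i j] _]; first by rewrite -num_le /=.
by rewrite -num_le /=; apply: h.
Qed.

Lemma mnorm_le_norm a b (A : 'M[K]_(a, b)) : iota (mnorm A) <= `|A| *+ (a * b).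
Proof.
have hij i j : iota (cabs (A i j)) <= `|A|.
  rewrite -norm_iota [leRHS]/Num.Def.normr /= mx_normE.
  have := le_bigmax (0%:nng : {nonneg K})
    (fun ij : 'I_a * 'I_b => `|A ij.1 ij.2|%:nng) (i, j).
  by apply.
have -> : `|A| *+ (a * b) = \sum_(i < a) \sum_(j < b) `|A|.
  by rewrite sumr_const card_ord sumr_const card_ord mulnC mulrnA.
rewrite rmorph_sum; apply: ler_sum => i _; rewrite rmorph_sum.
by apply: ler_sum.
Qed.

Lemma near0_mnorm a b (Q : 'M[K]_(a, b) -> Prop) :
  (\forall A \near (0 : 'M[K]_(a, b)), Q A) <->
  exists2 e : R, 0 < e & forall A, mnorm A < e -> Q A.
Proof.
split=> [/nbhs_norm0P [e /= e0 he]|[e e0 he]].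
  have ee : e = iota (cabs e) by rewrite -norm_iota gtr0_norm.
  exists (cabs e); first by rewrite -iota_lt rmorph0 -ee.
  move=> A hA; apply: he => /=; apply: le_lt_trans (norm_le_mnorm A) _.
  by rewrite ee iota_lt.
apply/nbhs_norm0P; exists (iota (e / (a * b).+1%:R)) => /=.
  by rewrite -(rmorph0 iota) iota_lt divr_gt0.
move=> A /= hA; apply: he; rewrite -iota_lt.
apply: le_lt_trans (mnorm_le_norm A) _.
apply: (@le_lt_trans _ _ (iota (e / (a * b).+1%:R) *+ (a * b))).
  by rewrite lerMn2r ltW ?orbT.
rewrite -rmorphMn iota_lt -mulr_natr -mulrA gtr_pMr// mulrC ltr_pdivrMr//.
by rewrite mul1r ltr_nat.
Qed.

Variables (a b c d : nat).
Implicit Types (f : 'M[K]_(a, b) -> 'M[K]_(c, d)).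

Lemma linear_mnorm_bounded (L : {linear 'M[K]_(a, b) -> 'M[K]_(c, d)}) :
  exists2 M : R, 0 <= M & forall h, mnorm (L h) <= M * mnorm h.
Proof.
exists (\sum_i \sum_j mnorm (L (delta_mx i j))) => [|h].
  by apply: sumr_ge0 => i _; apply: sumr_ge0 => j _; apply: mnorm_ge0.
rewrite {1}(matrix_sum_delta h) !raddf_sum /= mulr_suml.
elim/big_rec2: _ => [|i x y _ hxy]; first by rewrite mnorm0.
apply: le_trans (mnormD _ _ _) (lerD _ hxy).
rewrite raddf_sum /= mulr_suml.
elim/big_rec2: _ => [|j x' y' _ hxy']; first by rewrite mnorm0.
apply: le_trans (mnormD _ _ _) (lerD _ hxy').
by rewrite linearZ mnormZ /= mulrC ler_wpM2l ?mnorm_ge0 ?mnorm_entry.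
Qed.

Lemma quadratic_diff_differentiable f (L : {linear 'M[K]_(a, b) -> 'M[K]_(c, d)}) :
  quadratic_diff cabs f 0 L ->
  differentiable f (0 : 'M[K]_(a, b)) /\ 'd f (0 : 'M[K]_(a, b)) = L :> (_ -> _).
Proof.
move=> [e [M [e0 M0 hf]]].
have [ML ML0 hL] := linear_mnorm_bounded L.
have cL : continuous L.
  apply: bounded_linear_continuous; apply/linear_boundedP.
  exists (iota (ML *+ (a * b))); split.
    by rewrite realE -(rmorph0 iota) iota_le mulrn_wge0.
  move=> r /ltW hr h; apply: le_trans (norm_le_mnorm _) _.
  apply: (@le_trans _ _ (iota (ML * mnorm h))); first by rewrite iota_le.
  apply: (@le_trans _ _ (iota (ML *+ (a * b)) * `|h|)); last first.
    by rewrite ler_wpM2r.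
  rewrite rmorphM rmorphMn mulrnAl -mulrnAr ler_wpM2l ?mnorm_le_norm//.
  by rewrite -(rmorph0 iota) iota_le.
have key : f \o shift 0 = cst (f 0) + L +o_ (0 : 'M[K]_(a, b)) id.
  apply/eqaddoP => eps eps0.
  have ee : eps = iota (cabs eps) by rewrite -norm_iota gtr0_norm.
  have ce0 : 0 < cabs eps by rewrite -iota_lt rmorph0 -ee.
  apply/near0_mnorm; exists (Num.min e (cabs eps / (M *+ (a * b) + 1))).
    by rewrite lt_min e0 divr_gt0// ltr_wpDl// mulrn_wge0.
  move=> h; rewrite lt_min => /andP[he hM].
  have hab : 0 < M *+ (a * b) + 1 by rewrite ltr_wpDl// mulrn_wge0.
  have -> : (f \o shift 0 - (cst (f 0) + L)) h = f (0 + h) - f 0 - L h.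
    by rewrite -[LHS]/(f (h + 0) - (f 0 + L h)) addr0 add0r opprD addrA.
  apply: le_trans (norm_le_mnorm _) _.
  apply: (@le_trans _ _ (iota (M * mnorm h ^+ 2))); first by rewrite iota_le hf.
  apply: (@le_trans _ _ (iota (M * mnorm h) * (`|h| *+ (a * b)))).
    rewrite expr2 mulrA [leLHS]rmorphM ler_wpM2l ?mnorm_le_norm//.
    by rewrite -(rmorph0 iota) iota_le mulr_ge0// mnorm_ge0.
  rewrite mulrnAr -mulrnAl -rmorphMn ler_wpM2r// ee iota_le -mulrnAl.
  move: hM; rewrite ltr_pdivlMr// mulrDr mulr1 => /ltW h1.
  by apply: le_trans h1; rewrite mulrC lerDl mnorm_ge0.
have dL : 'd f (0 : 'M[K]_(a, b)) = L :> (_ -> _) by apply: diff_unique.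
split=> //; apply/diff_locallyP; rewrite dL.
exact: (conj cL key).
Qed.

End Differentiability.

Section QuadraticCalculus.
Variables (R : realType) (F : fieldType) (cabs : absolute_value R F) (n : nat).
Local Notation mnorm := (mnorm cabs).
Local Notation mnorm_ge0 := (mnorm_ge0 cabs).
Local Notation quadratic_diff := (quadratic_diff cabs).
Implicit Types (u : 'M[F]_n -> 'rV[F]_n).

Lemma quadratic_diff_lipschitz x a (P : 'M[F]_(1, n)) (Q : 'M[F]_(n, a)) v :
  quadratic_diff v x (fun h => P *m h *m Q) ->
  exists e M : R, [/\ 0 < e, 0 <= M & forall h, mnorm h < e ->
    mnorm (v (x + h) - v x) <= M * mnorm h].
Proof.
move=> [e [M [e0 M0 hv]]]; exists (Num.min e 1), (M + mnorm P * mnorm Q); split.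
- by rewrite lt_min e0 ltr01.
- by rewrite addr_ge0// mulr_ge0 ?mnorm_ge0.
move=> h; rewrite lt_min => /andP[he h1]; have h0 := mnorm_ge0 h.
rewrite -[_ - _](subrK (P *m h *m Q)); apply: le_trans (mnormD _ _ _) _.
rewrite mulrDl; apply: lerD.
  by apply: le_trans (hv h he) _; rewrite ler_wpM2l// expr2 ler_piMl// ltW.
apply: le_trans (mnormM _ _ _) _; rewrite mulrAC ler_wpM2r ?mnorm_ge0//.
exact: mnormM.
Qed.

(** The Taylor expansion of sys p (u A) = 0 at A0 is solved for the increment of c;
    the Lipschitz hypothesis on c makes the remainder quadratic. *)
Lemma implicit_diff k (p : 'I_k -> mpoly n F) (z : 'rV[F]_n) (b : 'M[F]_(k, n))
    (c : 'M[F]_n -> 'rV[F]_k) (A0 : 'M[F]_n) (e K : R) :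
  let u A := (z + c A *m b) *m (1%:M + A) in
  let M0 := b *m (1%:M + A0) *m sysJ p (u A0) in
  0 < e -> 0 <= K -> M0 \in unitmx ->
  (forall h, mnorm h < e -> sys p (u (A0 + h)) = 0 /\
    mnorm (c (A0 + h) - c A0) <= K * mnorm h) ->
  quadratic_diff u A0 (fun h => (z + c A0 *m b) *m h *m
    (1%:M - sysJ p (u A0) *m invmx M0 *m b *m (1%:M + A0))).
Proof.
move=> u M0 e0 K0 uM hc; set v0 := z + c A0 *m b; set u0 := u A0.
set D := sysJ p u0 *m invmx M0.
have v00 := mnorm_ge0 v0; have b0 := mnorm_ge0 b; have D0 := mnorm_ge0 D.
set B1 := mnorm (1%:M + A0 : 'M[F]_n); have B10 : 0 <= B1 := mnorm_ge0 _.
have u00 := mnorm_ge0 u0; have i0 := mnorm_ge0 (invmx M0).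
have M1 : 0 <= mnorm u0 + 1 by lra.
have [Kp Kp0 hp] := sys_taylor cabs p M1.
have [S eS] : exists S, S = K * mnorm b * B1 + mnorm v0 + K * mnorm b by eexists.
have S0 : 0 <= S by rewrite eS !addr_ge0// !mulr_ge0.
have [T eT] : exists T, T = (Kp * S ^+ 2 + K * mnorm b * mnorm (sysJ p u0)) *
    mnorm (invmx M0) by eexists.
have J0 := mnorm_ge0 (sysJ p u0).
have T0 : 0 <= T.
  by rewrite eT mulr_ge0// addr_ge0// !mulr_ge0// exprn_ge0.
exists (Num.min e (S + 1)^-1), (T * mnorm b * B1 + K * mnorm b); split.
- by rewrite lt_min e0 invr_gt0; lra.
- by rewrite addr_ge0// !mulr_ge0.
move=> h; rewrite lt_min => /andP[he hS]; have h0 := mnorm_ge0 h.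
have [ph cl] := hc h he.
have he0 : mnorm (0 : 'M[F]_n) < e by rewrite mnorm0.
have [p0 _] := hc 0 he0; rewrite addr0 in p0.
set dc := c (A0 + h) - c A0 in cl.
have e1 : mnorm h * (S + 1) <= 1.
  by have := ltW hS; rewrite -[X in _ <= X]mul1r ler_pdivlMr//; lra.
have hS0 : 0 <= mnorm h * S by rewrite mulr_ge0.
have h1 : mnorm h <= 1 by lra.
have du : u (A0 + h) - u0 = dc *m b *m (1%:M + A0) + v0 *m h + dc *m b *m h.
  have ec : c (A0 + h) = c A0 + dc by rewrite /dc [RHS]addrC subrK.
  rewrite /u0 /u ec (mulmxDl (c A0)) !addrA -/v0.
  move: (1%:M + A0) => B; rewrite mulmxDr !(mulmxDl v0).
  by rewrite addrC addrA addrA addKr.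
have ndc b' (X : 'M[F]_(n, b')) : mnorm (dc *m b *m X) <= K * mnorm h * mnorm b * mnorm X.
  apply: le_trans (mnormM _ _ _) _; rewrite ler_wpM2r ?mnorm_ge0//.
  by apply: le_trans (mnormM _ _ _) _; rewrite ler_wpM2r.
have nu : mnorm (u (A0 + h) - u0) <= S * mnorm h.
  rewrite du; apply: le_trans (mnormD _ _ _) _.
  apply: le_trans (lerD (mnormD _ _ _) (lexx _)) _.
  have a1 := ndc _ (1%:M + A0); have a2 := ndc _ h; have a3 := mnormM cabs v0 h.
  have a4 : K * mnorm h * mnorm b * mnorm h <= K * mnorm h * mnorm b * 1.
    by rewrite ler_wpM2l// !mulr_ge0.
  by rewrite eS -/B1 in a1 *; lra.
have nu1 : mnorm (u (A0 + h) - u0) <= mnorm u0 + 1.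
  by apply: le_trans nu _; lra.
have u0M : mnorm u0 <= mnorm u0 + 1 by lra.
have [q1 _ _] := hp u0 _ u0M nu1.
rewrite (addrC u0) subrK ph p0 subrr sub0r mnormN in q1.
set J := sysJ p u0 in J0 q1 eT.
have edc : dc = - (v0 *m h *m D) + ((u (A0 + h) - u0) *m J - dc *m b *m h *m J) *m invmx M0.
  have e2 : (u (A0 + h) - u0) *m J - dc *m b *m h *m J = dc *m M0 + v0 *m h *m J.
    rewrite du !mulmxDl addrK; congr (_ + _).
    by rewrite /M0 !mulmxA.
  rewrite e2 mulmxDl mulmxK// /D !mulmxA addrC.
  by rewrite addrK.
have ndcl : mnorm (dc + v0 *m h *m D) <= T * mnorm h ^+ 2.
  rewrite {1}edc addrAC addNr add0r; apply: le_trans (mnormM _ _ _) _.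
  rewrite eT [leRHS]mulrAC ler_wpM2r//; apply: le_trans (mnormB _ _ _) _.
  rewrite mulrDl; apply: lerD.
    apply: le_trans q1 _.
    by rewrite -mulrA ler_wpM2l// -exprMn lerXn2r ?nnegrE ?mnorm_ge0// mulr_ge0.
  rewrite -mulmxA; apply: le_trans (ndc _ (h *m J)) _.
  have := mnormM cabs h J => hJ.
  apply: (@le_trans _ _ (K * mnorm h * mnorm b * (mnorm h * mnorm J))).
    by rewrite ler_wpM2l// !mulr_ge0.
  by rewrite le_eqVlt; apply/orP; left; apply/eqP; ring.
have -> : u (A0 + h) - u0 - v0 *m h *m (1%:M - D *m b *m (1%:M + A0)) =
    (dc + v0 *m h *m D) *m b *m (1%:M + A0) + dc *m b *m h.
  rewrite du; move: (1%:M + A0) => B.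
  rewrite mulmxBr mulmx1 (mulmxDl dc) (mulmxDl (dc *m b)) opprB !mulmxA.
  by rewrite [_ + v0 *m h + _]addrAC (addrC _ (- (v0 *m h))) addrA addrK addrAC.
apply: le_trans (mnormD _ _ _) _; rewrite mulrDl; apply: lerD.
  apply: le_trans (mnormM _ _ _) _; rewrite mulrAC ler_wpM2r//.
  apply: le_trans (mnormM _ _ _) _; rewrite mulrAC ler_wpM2r//.
apply: le_trans (ndc _ h) _.
by rewrite le_eqVlt; apply/orP; left; apply/eqP; ring.
Qed.

Lemma regroup (V : zmodType) (A B D E G : V) :
  A + D - B = A - B + G + (D - E) + (E - G).
Proof.
by rewrite -(addrA (A - B + G)) (addrA (D - E)) subrK addrACA subrr addr0 addrAC.
Qed.

Lemma normalization_identity (s0 l a : F) : s0 != 0 -> s0 + l != 0 ->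
  a / (s0 + l) - a / s0 + a / s0 ^+ 2 * l = a * l ^+ 2 / ((s0 + l) * s0 ^+ 2) /\
  a / (s0 + l) - a / s0 = - (a * l / ((s0 + l) * s0)).
Proof. by move=> h1 h2; split; field; rewrite ?h1 ?h2. Qed.

(** Rescaling u so that the linear functional y takes a prescribed value. *)
Lemma quadratic_diff_normalize u x (P : 'M[F]_(1, n)) (Q : 'M[F]_n) (y : 'cV[F]_n)
    (a : F) : let s A : F := (u A *m y) 0 0 in s x != 0 ->
  quadratic_diff u x (fun h => P *m h *m Q) ->
  quadratic_diff (fun A => (a / s A) *: u A) x (fun h => P *m h *m (Q *m
    ((a / s x)%:M - (a / s x ^+ 2) *: (y *m u x)))).
Proof.
move=> s sx hu; have [e1 [M1 [e10 M10 hl]]] := quadratic_diff_lipschitz hu.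
have [e [M [e0 M0 hq]]] := hu.
set s0 := s x in sx *; set u0 := u x; set N := _ - _ *: _.
have c0 : 0 < cabs s0 by rewrite lt_def absval_eq0 sx cabs_ge0.
have y0 := mnorm_ge0 y; have u00 := mnorm_ge0 u0; have N0 := mnorm_ge0 N.
have a0 := cabs_ge0 cabs a.
pose e2 := cabs s0 / (2 * (M1 * mnorm y + 1)).
have my : 0 <= M1 * mnorm y by rewrite mulr_ge0.
have [C eC] : exists C, C = 2 * cabs a * mnorm y / cabs s0 ^+ 2 +
   2 * cabs a * mnorm y ^+ 2 * mnorm u0 / cabs s0 ^+ 3 by eexists.
have C0 : 0 <= C.
  by rewrite eC addr_ge0// divr_ge0 ?exprn_ge0 ?mulr_ge0 ?cabs_ge0// ?mulr_ge0 ?exprn_ge0// ?mulr_ge0.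
exists (Num.min (Num.min e e1) e2), (C * M1 ^+ 2 + M * mnorm N); split.
- by rewrite !lt_min e0 e10 divr_gt0//; lra.
- by rewrite addr_ge0// mulr_ge0 ?exprn_ge0.
move=> h; rewrite !lt_min => /andP[/andP[he he1] he2]; have h0 := mnorm_ge0 h.
set d := u (x + h) - u0; set l := (d *m y) 0 0.
have hd : mnorm d <= M1 * mnorm h by apply: hl.
have d0 := mnorm_ge0 d.
have hl1 : cabs l <= mnorm d * mnorm y.
  by apply: le_trans (mnorm_entry _ _ _ _) _; apply: mnormM.
have ls0 : cabs l <= cabs s0 / 2.
  have h1 : mnorm d * mnorm y <= M1 * mnorm h * mnorm y by rewrite ler_wpM2r.
  move: he2; rewrite ltr_pdivlMr; last lra.
  by move=> /ltW; lra.
have es : s (x + h) = s0 + l.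
  have -> : l = s (x + h) - s0 by rewrite /l /d mulmxBl [LHS]mxE [X in _ + X]mxE.
  by rewrite [RHS]addrC subrK.
have cs : cabs s0 / 2 <= cabs (s0 + l).
  have := cabsD cabs (s0 + l) (- l); rewrite addrK cabsN; lra.
have cs0 : 0 < cabs (s0 + l) by apply: lt_le_trans cs; rewrite divr_gt0.
have snz : s0 + l != 0 by rewrite -(absval_eq0 cabs) gt_eqF.
have [id1 id2] := normalization_identity a sx snz.
have -> : (a / s (x + h)) *: u (x + h) - (a / s0) *: u0 - P *m h *m (Q *m N) =
    (a * l ^+ 2 / ((s0 + l) * s0 ^+ 2)) *: u0 - (a * l / ((s0 + l) * s0)) *: d
    + (d - P *m h *m Q) *m N.
  have -> : u (x + h) = u0 + d by rewrite /d [RHS]addrC subrK.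
  rewrite es -id1 -[- (_ *: d)]scaleNr -id2 mulmxBl -(mulmxA (P *m h)) [RHS]addrA.
  congr (_ - _).
  have -> : d *m N = (a / s0) *: d - (a / s0 ^+ 2 * l) *: u0.
    rewrite /N mulmxBr mul_mx_scalar -scalemxAr mulmxA.
    by rewrite (mx11_scalar (d *m y)) mul_scalar_mx scalerA.
  by rewrite scalerDl !scalerBl scalerDr; apply: regroup.
have l2 : cabs l ^+ 2 <= (mnorm d * mnorm y) ^+ 2.
  by rewrite lerXn2r ?nnegrE ?cabs_ge0// mulr_ge0.
have c3 : 0 < cabs s0 / 2 * cabs s0 ^+ 2 by rewrite mulr_gt0 ?divr_gt0 ?exprn_gt0.
have n1 : cabs (a * l ^+ 2 / ((s0 + l) * s0 ^+ 2)) * mnorm u0 <=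
    2 * cabs a * mnorm y ^+ 2 * mnorm u0 / cabs s0 ^+ 3 * mnorm d ^+ 2.
  have -> : 2 * cabs a * mnorm y ^+ 2 * mnorm u0 / cabs s0 ^+ 3 * mnorm d ^+ 2 =
      cabs a * (mnorm d * mnorm y) ^+ 2 / (cabs s0 / 2 * cabs s0 ^+ 2) * mnorm u0.
    by field; rewrite gt_eqF.
  rewrite ler_wpM2r// !expr2 !cabsM cabsV !cabsM -!expr2.
  apply: ler_pM; rewrite ?invr_ge0 ?mulr_ge0 ?exprn_ge0 ?cabs_ge0//.
    by rewrite ler_wpM2l.
  by rewrite lef_pV2 ?posrE ?mulr_gt0 ?exprn_gt0// ler_wpM2r ?exprn_ge0 ?(ltW c0).
have n2 : cabs (a * l / ((s0 + l) * s0)) * mnorm d <=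
    2 * cabs a * mnorm y / cabs s0 ^+ 2 * mnorm d ^+ 2.
  have -> : 2 * cabs a * mnorm y / cabs s0 ^+ 2 * mnorm d ^+ 2 =
      cabs a * (mnorm d * mnorm y) / (cabs s0 / 2 * cabs s0) * mnorm d.
    by field; rewrite gt_eqF.
  rewrite ler_wpM2r// !cabsM cabsV !cabsM.
  apply: ler_pM; rewrite ?invr_ge0 ?mulr_ge0 ?exprn_ge0 ?cabs_ge0//.
    by rewrite ler_wpM2l.
  rewrite lef_pV2 ?posrE ?mulr_gt0 ?divr_gt0 ?exprn_gt0//.
  by rewrite ler_wpM2r ?exprn_ge0 ?(ltW c0).
have n3 : mnorm ((d - P *m h *m Q) *m N) <= M * mnorm h ^+ 2 * mnorm N.
  by apply: le_trans (mnormM _ _ _) _; rewrite ler_wpM2r// hq.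
have n4 : C * mnorm d ^+ 2 <= C * (M1 * mnorm h) ^+ 2.
  by rewrite ler_wpM2l// lerXn2r ?nnegrE// mulr_ge0.
apply: le_trans (mnormD _ _ _) _.
apply: le_trans (lerD (mnormB _ _ _) n3) _; rewrite !mnormZ.
apply: le_trans (lerD (lerD n1 n2) (lexx _)) _.
rewrite [X in X + _]addrC -mulrDl -eC.
by apply: le_trans (lerD n4 (lexx _)) _; rewrite le_eqVlt; apply/orP; left;
  apply/eqP; ring.
Qed.

Lemma quadratic_diff_affine m1 (f : 'M[F]_n -> 'rV[F]_m1) (A0 : 'M[F]_n)
    (P : 'M[F]_(1, n)) (Q : 'M[F]_(n, m1)) :
  quadratic_diff f A0 (fun h => P *m h *m Q) ->
  quadratic_diff (fun A => f (A0 + (1%:M + A0) *m A)) 0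
    (fun h => P *m (1%:M + A0) *m h *m Q).
Proof.
move=> [e [M [e0 M0 hf]]]; set B := 1%:M + A0; have B0 := mnorm_ge0 B.
have B1 : 0 < mnorm B + 1 by lra.
exists (e / (mnorm B + 1)), (M * mnorm B ^+ 2); split.
- by rewrite divr_gt0.
- by rewrite mulr_ge0// exprn_ge0.
move=> h hh; have h0 := mnorm_ge0 h.
have hB : mnorm (B *m h) <= mnorm B * mnorm h := mnormM _ _ _.
rewrite add0r mulmx0 addr0 -(mulmxA P); apply: le_trans (hf _ _) _.
  by move: hh; rewrite ltr_pdivlMr//; lra.
by rewrite -mulrA -exprMn ler_wpM2l// lerXn2r ?nnegrE ?mnorm_ge0// mulr_ge0.
Qed.

Lemma quadratic_diff_congr m1 (f g : 'M[F]_n -> 'rV[F]_m1) (v : 'rV[F]_m1) x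
    (L : 'M[F]_n -> 'rV[F]_m1) (e : R) : 0 < e ->
  (forall h, mnorm h < e -> g (x + h) = f (x + h) - v) ->
  quadratic_diff f x L -> quadratic_diff g x L.
Proof.
move=> e0 fg [e1 [M [e10 M0 hf]]]; exists (Num.min e e1), M.
split=> //; first by rewrite lt_min e0.
move=> h; rewrite lt_min => /andP[he he1].
have gx : g x = f x - v by have := fg 0; rewrite mnorm0 addr0; apply.
rewrite fg// gx opprB addrA subrK; exact: hf.
Qed.

End QuadraticCalculus.

Section LocalSolution.
Variables (R : realType) (F : fieldType) (cabs : absolute_value R F).
Variables (n k : nat) (p : 'I_k -> mpoly n F).
Variables (z : 'rV[F]_n) (b : 'M[F]_(k, n)).
Hypothesis bdf : b *m sysJ p z = 1%:M.
Hypothesis pz : sys p z = 0.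
Local Notation mnorm := (mnorm cabs).
Local Notation mnorm_ge0 := (mnorm_ge0 cabs).

(** The point of the perturbed space with coordinates c: the image under 1 + A of
    a point of the affine chart of the original space. *)
Definition chart_point (c : 'rV[F]_k) (A : 'M[F]_n) : 'rV[F]_n :=
  (z + c *m b) *m (1%:M + A).

(** A perturbation by A acts on the base point z and on the directions b at the same
    time, as z *m (1%:M + A) and b *m (1%:M + A), to which implicit_function
    applies. *)
Lemma local_solution : exists (c : 'M[F]_n -> 'rV[F]_k) (e r K : R),
  let u A := chart_point (c A) A in
  [/\ [/\ 0 < e, 0 < r & 0 <= K],
    forall A, mnorm A <= e -> sys p (u A) = 0 /\ mnorm (u A - z) <= K * mnorm A,
    forall A c', mnorm A <= e -> mnorm c' <= r ->
      sys p (chart_point c' A) = 0 -> c' = c A,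
    c 0 = 0 &
    forall A, mnorm A < e -> quadratic_diff cabs u A (fun h =>
      (z + c A *m b) *m h *m (1%:M - sysJ p (u A) *m
        invmx (b *m (1%:M + A) *m sysJ p (u A)) *m b *m (1%:M + A)))].
Proof.
have [r [e0 [K [[e00 er K0] ex_c lip_c unit_c]]]] := implicit_function cabs bdf pz.
have z0 := mnorm_ge0 z; have b0 := mnorm_ge0 b.
pose D := mnorm z + mnorm b + 1; have D0 : 0 < D by rewrite /D; lra.
pose e := e0 / D; have epos : 0 < e by rewrite divr_gt0.
have cpE c A : chart_point c A = z *m (1%:M + A) + c *m (b *m (1%:M + A)).
  by rewrite /chart_point mulmxDl mulmxA.
have hz (A : 'M[F]_n) : mnorm (z *m (1%:M + A) - z) <= mnorm z * mnorm A.
  by rewrite mulmxDr mulmx1 addrC addKr; apply: mnormM.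
have hb (A : 'M[F]_n) : mnorm (b *m (1%:M + A) - b) <= mnorm b * mnorm A.
  by rewrite mulmxDr mulmx1 addrC addKr; apply: mnormM.
have eD (A : 'M[F]_n) : mnorm A <= e -> mnorm z * mnorm A <= e0 /\ mnorm b * mnorm A <= e0.
  rewrite ler_pdivlMr// => h; have A0 := mnorm_ge0 A.
  have h1 : 0 <= mnorm z * mnorm A by rewrite mulr_ge0.
  have h2 : 0 <= mnorm b * mnorm A by rewrite mulr_ge0.
  by move: h; rewrite /D; split; lra.
have /choice [c hc] : forall A, exists c, mnorm A <= e ->
    mnorm c <= r /\ sys p (chart_point c A) = 0.
  move=> A; have [Ae|nAe] := pselect (mnorm A <= e); last by exists 0.
  have [h1 h2] := eD A Ae.
  have [c cr hc] := ex_c _ _ (le_trans (hz A) h1) (le_trans (hb A) h2).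
  by exists c => _; rewrite cpE.
have r0 : 0 < r := lt_le_trans e00 er.
have lip (A A' : 'M[F]_n) c1 c2 : mnorm A <= e -> mnorm A' <= e -> mnorm c1 <= r ->
    mnorm c2 <= r -> sys p (chart_point c1 A) = 0 -> sys p (chart_point c2 A') = 0 ->
    mnorm (c1 - c2) <= K * D * mnorm (A - A').
  move=> Ae Ae' c1r c2r; rewrite !cpE => p1 p2.
  have [h1 h2] := eD A Ae; have [h1' h2'] := eD A' Ae'.
  have := lip_c _ _ _ _ c1 c2 (le_trans (hz A) h1) (le_trans (hz A') h1')
    (le_trans (hb A) h2) (le_trans (hb A') h2') c1r c2r.
  rewrite p1 p2 subrr mnorm0 add0r -!mulmxBr => h; apply: le_trans h _.
  rewrite -mulrA ler_wpM2l//.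
  have -> : 1%:M + A - (1%:M + A') = A - A' by rewrite opprD addrACA subrr add0r.
  have h3 := mnormM cabs z (A - A'); have h4 := mnormM cabs b (A - A').
  by have := mnorm_ge0 (A - A'); rewrite /D; lra.
have e_ge0 : mnorm (0 : 'M[F]_n) <= e by rewrite mnorm0 ltW.
have cp0 : sys p (chart_point 0 0) = 0.
  by rewrite /chart_point mul0mx !addr0 mulmx1.
have r00 : mnorm (0 : 'rV[F]_k) <= r by rewrite mnorm0 ltW.
have eq0 (c1 c2 : 'rV[F]_k) : mnorm (c1 - c2) <= 0 -> c1 = c2.
  move=> h; apply/eqP; rewrite -subr_eq0; apply/eqP/(@mnorm0_eq _ _ cabs).
  by apply/eqP; rewrite eq_le h mnorm_ge0.
have c0 : c 0 = 0.
  have [cr hp] := hc 0 e_ge0; apply: eq0.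
  by have := lip 0 0 _ _ e_ge0 e_ge0 cr r00 hp cp0; rewrite [X in _ * mnorm X]subrr mnorm0 mulr0.
exists c, e, r, (mnorm z + K * D * mnorm b * (mnorm (1%:M : 'M[F]_n) + e)).
have KD : 0 <= K * D by rewrite mulr_ge0// ltW.
have n1 := mnorm_ge0 (1%:M : 'M[F]_n).
split=> //.
- by split=> //; rewrite addr_ge0// mulr_ge0 ?(mulr_ge0 KD b0)// addr_ge0// ltW.
- move=> A Ae; have [cr hp] := hc A Ae; split=> //.
  rewrite cpE addrAC; apply: le_trans (mnormD _ _ _) _; rewrite mulrDl.
  apply: lerD; first exact: hz.
  have := lip A 0 _ _ Ae e_ge0 cr r00 hp cp0; rewrite !subr0 => hcA.
  have h5 : mnorm (b *m (1%:M + A)) <= mnorm b * (mnorm (1%:M : 'M[F]_n) + e).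
    apply: le_trans (mnormM _ _ _) _; rewrite ler_wpM2l//.
    by have := mnormD cabs (1%:M : 'M[F]_n) A; lra.
  apply: le_trans (mnormM _ _ _) _.
  apply: le_trans (ler_pM (mnorm_ge0 _) (mnorm_ge0 _) hcA h5) _.
  by rewrite le_eqVlt; apply/orP; left; apply/eqP; ring.
- move=> A c' Ae c'r hp; have [cr hpA] := hc A Ae; apply: eq0.
  by have := lip A A _ _ Ae Ae c'r cr hp hpA; rewrite subrr mnorm0 mulr0.
- move=> A Ae; have [cr hp] := hc A (ltW Ae).
  have [h1 h2] := eD A (ltW Ae).
  apply: (@implicit_diff _ _ cabs _ _ p z b c A (e - mnorm A) (K * D)) => //.
  + by rewrite subr_gt0.
  + have := unit_c _ _ (c A) (le_trans (hz A) h1) (le_trans (hb A) h2) cr.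
    by rewrite -cpE.
  + move=> h hh; have hAh : mnorm (A + h) <= e.
      by have := mnormD cabs A h; lra.
    have [cr' hp'] := hc _ hAh; split=> //.
    have := lip (A + h) A _ _ hAh (ltW Ae) cr' cr hp' hp.
    by rewrite [A + h - A]addrC addKr.
Qed.

End LocalSolution.

(** * Hermitian geometry *)

Section HermitianGeometry.
Variables (R : realType) (C : numClosedFieldType) (cabs : absolute_value R C).
Variable iota : {rmorphism R -> C}.
Hypothesis norm_iota : forall x : C, `|x| = iota (cabs x).
Hypothesis iota_lt : forall a b, (iota a < iota b) = (a < b).
Variable n : nat.
Local Notation V := 'rV[C]_n.
Implicit Types (u v w : V) (W : {vspace V}).

Let iotaI : injective iota := fmorph_inj iota.

Let iota_leE a b : (iota a <= iota b) = (a <= b) := iota_le iota_lt a b.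

Definition conjT v : 'cV[C]_n := (map_mx Num.conj v)^T.

Lemma dotmx_conjT u v : dotmx u v = (u *m conjT v) 0 0.
Proof. by rewrite dotmxE /conjT map_trmx. Qed.

Lemma dotmxDl u v w : dotmx (u + v) w = dotmx u w + dotmx v w.
Proof. exact: linearDl. Qed.

Lemma dotmxBl u v w : dotmx (u - v) w = dotmx u w - dotmx v w.
Proof. exact: linearBl. Qed.

Lemma dotmxZl a u v : dotmx (a *: u) v = a * dotmx u v.
Proof. exact: linearZl_LR. Qed.

Lemma dotmxDr u v w : dotmx w (u + v) = dotmx w u + dotmx w v.
Proof. exact: linearDr. Qed.

Lemma dotmxZr a u v : dotmx u (a *: v) = (Num.conj a) * dotmx u v.
Proof. exact: linearZr_LR. Qed.

Lemma dotmxC0 u v : dotmx u v = 0 -> dotmx v u = 0.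
Proof. by move=> h; rewrite hermC /= mul1r h rmorph0. Qed.

Lemma dotmx_neq0 u : u != 0 -> dotmx u u != 0.
Proof. by move=> u0; rewrite gt_eqF// dotmx_is_dotmx. Qed.

(** Both the hermitian norm of vectors and, by trace_conj, the Frobenius norm of
    matrices; real-valued, unlike the square root of dotmx u u. *)
Definition l2norm a b (A : 'M[C]_(a, b)) : R :=
  Num.sqrt (\sum_i \sum_j cabs (A i j) ^+ 2).

Lemma l2norm_ge0 a b (A : 'M[C]_(a, b)) : 0 <= l2norm A.
Proof. exact: sqrtr_ge0. Qed.

Lemma l2norm_sqrE a b (A : 'M[C]_(a, b)) :
  l2norm A ^+ 2 = \sum_i \sum_j cabs (A i j) ^+ 2.
Proof.
rewrite sqr_sqrtr//; apply: sumr_ge0 => i _; apply: sumr_ge0 => j _.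
by rewrite exprn_ge0// cabs_ge0.
Qed.

Lemma l2norm_row u : l2norm u ^+ 2 = \sum_j cabs (u 0 j) ^+ 2.
Proof. by rewrite l2norm_sqrE big_ord1. Qed.

Lemma dotmxx u : dotmx u u = iota (l2norm u ^+ 2).
Proof.
rewrite l2norm_row dotmx_conjT mxE rmorph_sum; apply: eq_bigr => j _.
by rewrite !mxE -normCK norm_iota -rmorphXn.
Qed.

Lemma trace_conj (A : 'M[C]_n) :
  \tr (A *m (map_mx Num.conj A)^T) = iota (l2norm A ^+ 2).
Proof.
rewrite l2norm_sqrE /mxtrace rmorph_sum; apply: eq_bigr => i _.
rewrite mxE rmorph_sum; apply: eq_bigr => j _.
by rewrite !mxE -normCK norm_iota -rmorphXn.
Qed.

Lemma l2norm_gt0 u : u != 0 -> 0 < l2norm u.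
Proof.
move=> u0; rewrite lt_def l2norm_ge0 andbT; apply: contra_neq (dotmx_neq0 u0).
by move=> h; rewrite dotmxx h expr2 mulr0 rmorph0.
Qed.

Lemma l2normZ a b x (A : 'M[C]_(a, b)) : l2norm (x *: A) = cabs x * l2norm A.
Proof.
apply/eqP; rewrite -(@eqrXn2 _ 2) ?mulr_ge0 ?l2norm_ge0 ?cabs_ge0//.
rewrite exprMn !l2norm_sqrE mulr_sumr; apply/eqP; apply: eq_bigr => i _.
by rewrite mulr_sumr; apply: eq_bigr => j _; rewrite mxE cabsM exprMn.
Qed.

Lemma cauchy_schwarz u v : cabs (dotmx u v) <= l2norm u * l2norm v.
Proof.
have h : `|dotmx u v| ^+ 2 <= dotmx u u * dotmx v v.
  by have [] := @CauchySchwarz C V (@dotmx C n) u v.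
move: h; rewrite !dotmxx norm_iota -rmorphXn -rmorphM iota_leE -exprMn.
by rewrite ler_sqr ?nnegrE ?mulr_ge0 ?l2norm_ge0 ?cabs_ge0.
Qed.

Lemma pythagoras u v : dotmx u v = 0 ->
  l2norm (u + v) ^+ 2 = l2norm u ^+ 2 + l2norm v ^+ 2.
Proof.
move=> uv; apply: iotaI; rewrite rmorphD /= -!dotmxx.
by rewrite dotmxDl !dotmxDr uv (dotmxC0 uv) add0r addr0.
Qed.

Lemma l2norm_mulmx u (A : 'M[C]_n) : l2norm (u *m A) <= l2norm u * l2norm A.
Proof.
rewrite -ler_sqr ?nnegrE ?mulr_ge0 ?l2norm_ge0// exprMn l2norm_row.
rewrite [X in _ * X]l2norm_sqrE exchange_big /= mulr_sumr.
apply: ler_sum => j _.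
pose v : V := \row_i (Num.conj (A i j)).
have -> : (u *m A) 0 j = dotmx u v.
  rewrite dotmx_conjT !mxE; apply: eq_bigr => i _.
  by rewrite !mxE conjCK.
have -> : \sum_i cabs (A i j) ^+ 2 = l2norm v ^+ 2.
  rewrite l2norm_row; apply: eq_bigr => i _; congr (_ ^+ 2); rewrite mxE.
  by apply: iotaI; rewrite -!norm_iota norm_conjC.
rewrite -exprMn ler_sqr ?nnegrE ?mulr_ge0 ?l2norm_ge0 ?cabs_ge0//.
exact: cauchy_schwarz.
Qed.

(** The matrix of least norm among those that send z to y. *)
Definition rank_one z y : 'M[C]_n := (dotmx z z)^-1 *: (conjT z *m y).

Lemma mul_rank_one u z y : u *m rank_one z y = (dotmx u z / dotmx z z) *: y.
Proof.
rewrite /rank_one -scalemxAr mulmxA (mx11_scalar (u *m conjT z)) mul_scalar_mx.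
by rewrite scalerA -dotmx_conjT mulrC.
Qed.

Lemma l2norm_rank_one z y : z != 0 -> l2norm (rank_one z y) = l2norm y / l2norm z.
Proof.
move=> z0; have zp := l2norm_gt0 z0.
have h : l2norm (conjT z *m y) = l2norm z * l2norm y.
  apply/eqP; rewrite -(@eqrXn2 _ 2) ?mulr_ge0 ?l2norm_ge0//; apply/eqP.
  rewrite exprMn l2norm_sqrE !l2norm_row mulr_suml; apply: eq_bigr => i _.
  rewrite mulr_sumr; apply: eq_bigr => j _.
  rewrite mxE big_ord1 !mxE cabsM exprMn; congr (_ ^+ 2 * _).
  by apply: iotaI; rewrite -!norm_iota norm_conjC.
rewrite /rank_one l2normZ h cabsV.
have -> : cabs (dotmx z z) = l2norm z ^+ 2.
  by apply: iotaI; rewrite -norm_iota dotmxx ger0_norm// -(rmorph0 iota) iota_leE exprn_ge0// ltW.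
by field; rewrite gt_eqF.
Qed.

Lemma vspace_rows W : exists b : 'M[C]_(\dim W, n), row_free b /\
  forall v, v \in W <-> exists c : 'rV[C]_(\dim W), v = c *m b.
Proof.
pose b : 'M[C]_(\dim W, n) := \matrix_i (vbasis W)`_i.
have hb c : c *m b = \sum_i c 0 i *: (vbasis W)`_i.
  by rewrite mulmx_sum_row; apply: eq_bigr => i _; rewrite rowK.
have fW : free (vbasis W) := basis_free (vbasisP W).
exists b; split.
  apply/row_freeP; apply: contrapT => nb.
  have /rowV0Pn[c cb c0] : kermx b != 0.
    apply/negP; rewrite kermx_eq0 => /row_freeP; exact: nb.
  move/negP: c0; apply; apply/eqP/rowP => i; rewrite mxE.
  move/freeP: fW; apply; rewrite -hb; exact/sub_kermxP.
move=> v; split=> [vW|[c ->]].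
  exists (\row_i coord (vbasis W) i v); rewrite hb {1}(coord_vbasis vW).
  by apply: eq_bigr => i _; rewrite mxE.
rewrite hb; apply: memv_suml => i _; apply: memvZ; apply: vbasis_mem.
by apply: mem_nth; rewrite size_tuple.
Qed.

Lemma orthogonal_projection W v :
  exists2 w, w \in W & forall x, x \in W -> dotmx (v - w) x = 0.
Proof.
have [b [_ hb]] := vspace_rows W.
have /submxP[c hc] := proj_ortho_sub b v.
exists (v *m proj_ortho b); first by apply/hb; exists c.
move=> x /hb[d ->].
have /orthomx1P h := proj_ortho_compl_sub b v.
rewrite dotmxE trmx_mul map_mxM.
by rewrite mulmxA h mul0mx mxE.
Qed.

End HermitianGeometry.

(** * The minimum angle as an operator norm *)

Section AcuteAngles.
Variable R : realType.
Implicit Types (x a b : R).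

Lemma acos_acute x : 0 <= x <= 1 -> 0 <= acos x <= pi / 2.
Proof.
move=> /andP[x0 x1]; have x11 : -1 <= x <= 1 by rewrite x1 andbT; lra.
rewrite acos_ge0//= leNgt; apply/negP => h.
have pi0 := pi_ge0 R; have api := acos_lepi x11.
have c1 : acos x \in `[0, pi] by rewrite in_itv /= acos_ge0.
have c2 : pi / 2 \in `[0, pi : R] by rewrite in_itv /=; apply/andP; split; lra.
move: h; rewrite -(ltr_cos c2 c1) cos_pihalf acosK ?in_itv//=.
by rewrite ltNge x0.
Qed.

Lemma sin_le_acute a b : 0 <= a -> a <= b -> b <= pi / 2 -> sin a <= sin b.
Proof.
move=> a0 ab b1; have pi0 := pi_ge0 R.
by rewrite leNgt ltr_sin -?leNgt// in_itv /=; apply/andP; split; lra.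
Qed.

Lemma sin_right_close a (e : R) : 0 < e ->
  exists2 d : R, 0 < d & forall b, a <= b -> b < a + d -> sin b < sin a + e.
Proof.
move=> e0; have /cvgrPdist_lt /(_ e e0) := @continuous_sin R a.
move=> /nbhs_ballP[d /= d0 hd]; exists d => // b ab bd.
have h : `|sin a - sin b| < e.
  by apply: hd; rewrite /ball /= ler0_norm ?subr_le0//; lra.
by move: h; rewrite ltr_norml => /andP[h _]; lra.
Qed.

End AcuteAngles.

Section MinimumAngle.
Variables (R : realType) (C : numClosedFieldType) (cabs : absolute_value R C).
Variable iota : {rmorphism R -> C}.
Hypothesis norm_iota : forall x : C, `|x| = iota (cabs x).
Hypothesis iota_lt : forall a b, (iota a < iota b) = (a < b).
Variable n : nat.
Local Notation V := 'rV[C]_n.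
Local Notation l2norm := (l2norm cabs).
Variables (T W : {vspace V}).

Definition ang (u v : V) : R := acos (cabs (dotmx u v) / (l2norm u * l2norm v)).

Definition angles : set R := [set a | exists v w,
  [/\ v \in T, v != 0, w \in W, w != 0 & a = ang v w]].

Let l2pos (u : V) : u != 0 -> 0 < l2norm u := l2norm_gt0 norm_iota (u := u).

Lemma cos_ratio (u v : V) : u != 0 -> v != 0 ->
  0 <= cabs (dotmx u v) / (l2norm u * l2norm v) <= 1.
Proof.
move=> u0 v0; have h : 0 < l2norm u * l2norm v by rewrite mulr_gt0 ?l2pos.
rewrite divr_ge0 ?cabs_ge0 ?(ltW h)//= ler_pdivrMr// mul1r.
exact: (cauchy_schwarz norm_iota iota_lt).
Qed.

Lemma ang_acute (u v : V) : u != 0 -> v != 0 -> 0 <= ang u v <= pi / 2.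
Proof. by move=> u0 v0; apply/acos_acute/cos_ratio. Qed.

Lemma angles_ge0 : lbound angles 0.
Proof. by move=> _ [v [w [_ v0 _ w0 ->]]]; have /andP[] := ang_acute v0 w0. Qed.

Lemma inf_angles_ge0 : 0 <= inf angles.
Proof.
have [/eqP ->|/set0P h] := boolP (angles == set0); first by rewrite inf0.
by apply: lb_le_inf => //; apply: angles_ge0.
Qed.

Lemma inf_angles_le v w : v \in T -> v != 0 -> w \in W -> w != 0 ->
  inf angles <= ang v w.
Proof.
move=> vT v0 wW w0; apply: ge_inf; first by exists 0; apply: angles_ge0.
by exists v, w.
Qed.

Lemma sin_inf_common v : v \in T -> v \in W -> v != 0 -> sin (inf angles) = 0.
Proof.
move=> vT vW v0; suff -> : inf angles = 0 by rewrite sin0.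
apply/eqP; rewrite eq_le inf_angles_ge0 andbT.
apply: le_trans (inf_angles_le vT v0 vW v0) _; rewrite /ang.
have -> : cabs (dotmx v v) = l2norm v * l2norm v.
  apply: (fmorph_inj iota); rewrite -norm_iota (dotmxx norm_iota) expr2.
  by rewrite ger0_norm// -(rmorph0 iota) (iota_le iota_lt) mulr_ge0// l2norm_ge0.
by rewrite divff ?acos1// mulf_neq0// gt_eqF// l2pos.
Qed.

(** The angle between v and the vectors of W is least at the orthogonal projection
    w0 of v, where its sine is the distance to W divided by the norm of v. *)
Section Projection.
Variables (v w0 : V).
Hypothesis v0 : v != 0.
Hypothesis w0W : w0 \in W.
Hypothesis vw0 : forall w, w \in W -> dotmx (v - w0) w = 0.

Let vpos := l2pos v0.

Lemma projection_ratio :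
  (l2norm (v - w0) / l2norm v) ^+ 2 = 1 - (l2norm w0 / l2norm v) ^+ 2.
Proof.
rewrite !expr_div_n.
have := pythagoras norm_iota (vw0 w0W); rewrite subrK => ->.
have h : l2norm (v - w0) ^+ 2 + l2norm w0 ^+ 2 != 0.
  have := pythagoras norm_iota (vw0 w0W); rewrite subrK => <-.
  by rewrite gt_eqF// exprn_gt0.
by field.
Qed.

Lemma sin_ang_ge w : w \in W -> w != 0 ->
  l2norm (v - w0) / l2norm v <= sin (ang v w).
Proof.
move=> wW wn0; have wpos := l2pos wn0.
have /andP[r0 r1] := cos_ratio v0 wn0.
have h1 : -1 <= cabs (dotmx v w) / (l2norm v * l2norm w) <= 1.
  by rewrite r1 andbT; lra.
rewrite /ang sin_acos// -[leLHS]ger0_norm ?divr_ge0 ?l2norm_ge0//.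
rewrite -sqrtr_sqr ler_wsqrtr// projection_ratio lerD2l lerN2.
apply: lerXn2r; rewrite ?nnegrE ?r0 ?divr_ge0 ?l2norm_ge0//.
rewrite ler_pdivrMr ?mulr_gt0// mulrA divfK ?gt_eqF//.
have -> : dotmx v w = dotmx w0 w.
  by apply/eqP; rewrite -subr_eq0 -dotmxBl vw0.
exact: (cauchy_schwarz norm_iota iota_lt).
Qed.

Lemma sin_inf_le : v \in T -> sin (inf angles) <= l2norm (v - w0) / l2norm v.
Proof.
move=> vT; have [w00|wn0] := eqVneq w0 0.
  by rewrite w00 subr0 divff ?gt_eqF// sin_le1.
have wpos := l2pos wn0.
have -> : l2norm (v - w0) / l2norm v = sin (ang v w0).
  have e : cabs (dotmx v w0) / (l2norm v * l2norm w0) = l2norm w0 / l2norm v.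
    have -> : dotmx v w0 = dotmx w0 w0.
      by apply/eqP; rewrite -subr_eq0 -dotmxBl vw0.
    have -> : cabs (dotmx w0 w0) = l2norm w0 * l2norm w0.
      apply: (fmorph_inj iota); rewrite -norm_iota (dotmxx norm_iota) expr2.
      by rewrite ger0_norm// -(rmorph0 iota) (iota_le iota_lt) mulr_ge0// ltW.
    by field; rewrite !gt_eqF.
  have /andP[r0 r1] := cos_ratio v0 wn0; rewrite e in r0 r1.
  rewrite /ang e sin_acos; last by rewrite r1 andbT; lra.
  by rewrite -projection_ratio sqrtr_sqr ger0_norm// divr_ge0 ?l2norm_ge0.
have /andP[a0 a1] := ang_acute v0 wn0.
by apply: sin_le_acute => //; [exact: inf_angles_ge0|exact: inf_angles_le].
Qed.

End Projection.

Lemma sin_inf_approx (e : R) : 0 < e -> angles !=set0 -> exists v w0,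
  [/\ v \in T, v != 0, w0 \in W, forall w, w \in W -> dotmx (v - w0) w = 0 &
    l2norm (v - w0) / l2norm v < sin (inf angles) + e].
Proof.
move=> e0 ne; have [d d0 hd] := sin_right_close (inf angles) e0.
have [|_ [v [w [vT v0 wW w0 ->]]] hvw] := @inf_adherent R angles d d0.
  by split=> //; exists 0; apply: angles_ge0.
have [p pW hp] := orthogonal_projection W v.
exists v, p; split=> //; apply: le_lt_trans (sin_ang_ge v0 pW hp wW w0) _.
by apply: hd => //; apply: inf_angles_le.
Qed.

(** Put v = d A and y = z *m A.  As v - y lies in W and y is orthogonal to W, the norm
    of y is the distance from v to W, so that l2norm y / l2norm v is the sine of the
    angle between v and W, and l2norm v / l2norm y is largest where that angle is
    least.  A matrix of norm at most 1 gives l2norm y <= l2norm z; conversely every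
    v in T arises from a matrix of rank one for which equality holds. *)
Lemma operator_norm_angle (z : V) (H : set 'M[C]_n) (d : 'M[C]_n -> V) :
  z != 0 -> (T :&: W = 0)%VS -> angles !=set0 ->
  (forall A, H A -> [/\ d A \in T, d A - z *m A \in W &
     forall w, w \in W -> dotmx (z *m A) w = 0]) ->
  (forall v w, v \in T -> w \in W -> (forall x, x \in W -> dotmx (v - w) x = 0) ->
     H (rank_one z (v - w))) ->
  ereal_sup [set x | exists A, [/\ H A, l2norm A <= 1 &
    x = (l2norm (d A) / l2norm z)%:E]] = ((sin (inf angles))%:E^-1)%E.
Proof.
move=> z0 TW ne hd hH; set s := sin (inf angles).
have zpos := l2pos z0.
have s0 : 0 <= s.
  rewrite leNgt; apply/negP => sn.
  have ns0 : 0 < - s by rewrite oppr_gt0.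
  have [v [w [_ v0 _ _]]] := sin_inf_approx ns0 ne.
  rewrite addrN ltNge divr_ge0//; exact: l2norm_ge0.
set D : set (\bar R) := [set x | _].
have lower (r : R) : 0 < r -> r * s < 1 -> (r%:E <= ereal_sup D)%E.
  move=> r0 rs.
  have rs0 : 0 < r^-1 - s by rewrite subr_gt0 -[r^-1]mul1r ltr_pdivlMr// mulrC.
  have [v [w [vT v0 wW vw hvw]]] := sin_inf_approx rs0 ne.
  rewrite (addrC (sin _)) subrK in hvw; have vpos := l2pos v0.
  have y0 : v - w != 0.
    apply/eqP => /subr0_eq e; move/negP: v0; apply; rewrite -memv0 -TW memv_cap vT.
    by rewrite e.
  have ypos := l2pos y0.
  pose t : C := iota (l2norm z / l2norm (v - w)).
  have ct : cabs t = l2norm z / l2norm (v - w).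
    apply: (fmorph_inj iota); rewrite -norm_iota ger0_norm// -(rmorph0 iota).
    by rewrite (iota_le iota_lt) divr_ge0// ltW.
  pose v' := t *: v; pose w' := t *: w.
  have e' : v' - w' = t *: (v - w) by rewrite scalerBr.
  have v'T : v' \in T by apply: memvZ.
  have w'W : w' \in W by apply: memvZ.
  pose A := rank_one z (v' - w').
  have HA : H A.
    apply: hH => // x xW; rewrite e' dotmxZl vw ?mulr0//.
  have zA : z *m A = v' - w'.
    by rewrite mul_rank_one divff ?scale1r// dotmx_neq0.
  have [dT dW _] := hd A HA.
  have dA : d A = v'.
    apply/eqP; rewrite -subr_eq0 -memv0 -TW memv_cap memvB//=.
    have -> : d A - v' = d A - z *m A - w' by rewrite zA opprB [w' - v']addrC addrA addrK.
    exact: memvB.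
  apply: le_ereal_sup_tmp; exists (l2norm (d A) / l2norm z)%:E.
    exists A; split=> //.
    rewrite (l2norm_rank_one norm_iota iota_lt)// e' l2normZ ct.
    by rewrite divfK ?gt_eqF// divff// gt_eqF.
  rewrite lee_fin dA l2normZ ct.
  have -> : l2norm z / l2norm (v - w) * l2norm v / l2norm z = l2norm v / l2norm (v - w).
    by field; rewrite !gt_eqF.
  rewrite ler_pdivlMr//; move: hvw; rewrite ltr_pdivrMr// => /ltW h.
  have : r * l2norm (v - w) <= r * (r^-1 * l2norm v) by rewrite ler_pM2l.
  by rewrite mulrA divff ?mul1r// gt_eqF.
apply/eqP; rewrite eq_le; apply/andP; split; last first.
  rewrite inver; case: ifPn => [/eqP sz|sn0].
    rewrite leye_eq; apply/eqP/eqyP => r r0; apply: lower => //.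
    by rewrite sz mulr0.
  have sp : 0 < s by rewrite lt_def sn0.
  apply/lee_subgt0Pr => e e0; rewrite -EFinB.
  have [r0|rn] := ltP 0 (s^-1 - e).
    apply: lower => //; rewrite mulrBl mulVf// gtrBl mulr_gt0//.
  apply: le_trans (lower (s^-1 / 2) _ _).
  - by rewrite lee_fin (le_trans rn)// divr_ge0// invr_ge0.
  - by rewrite divr_gt0// invr_gt0.
  - by rewrite mulrAC mulVf//; lra.
apply: ge_ereal_sup => _ [A [HA A1 ->]].
rewrite inver; case: ifPn => [_|sn0]; first by rewrite leey.
have sp : 0 < s by rewrite lt_def sn0.
have [dT dW zW] := hd A HA.
have zA : l2norm (z *m A) <= l2norm z.
  apply: le_trans (l2norm_mulmx norm_iota iota_lt _ _) _.
  by rewrite ler_piMr// ltW.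
rewrite lee_fin; have [d0|dn0] := eqVneq (d A) 0.
  have -> : l2norm (d A) = 0.
    by rewrite d0 -(scale0r (0 : V)) l2normZ cabs0 mul0r.
  by rewrite mul0r invr_ge0.
have dpos := l2pos dn0.
have hproj w : w \in W -> dotmx (d A - (d A - z *m A)) w = 0.
  by rewrite opprB addrC subrK; apply: zW.
have := sin_inf_le dn0 dW hproj dT; rewrite opprB addrC subrK -/s.
rewrite ler_pdivlMr// => h; rewrite ler_pdivrMr// -[leLHS](mulKf sn0).
by rewrite ler_wpM2l ?invr_ge0//; apply: le_trans zA.
Qed.

End MinimumAngle.

(** * Equations of the variety near the intersection point *)

Section Annihilators.
Variables (F : fieldType) (k : nat).

(** A matrix of maximal rank among those with column space in S either is invertible
    or is annihilated by some c on the left; then c annihilates S, since otherwise an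
    element of S could be added to the column space. *)
Lemma proper_subspace_annihilator (S : 'cV[F]_k -> Prop) :
  S 0 -> (forall a u v, S u -> S v -> S (a *: u + v)) ->
  (forall u, S u) \/ exists2 c : 'rV[F]_k, c != 0 & forall u, S u -> c *m u = 0.
Proof.
move=> S0 SD.
pose good r := exists A : 'M[F]_k, (forall c : 'cV[F]_k, S (A *m c)) /\ \rank A = r.
have ex0 : exists r, `[< good r >].
  exists 0%N; apply/asboolP; exists 0; split=> [c|]; first by rewrite mul0mx.
  by rewrite mxrank0.
have bound r : `[< good r >] -> (r <= k)%N.
  by move=> /asboolP[A [_ <-]]; apply: rank_leq_row.
have [r /asboolP[A [SA rA]] rmax] := ex_maxnP ex0 bound.
have [fA|nfA] := boolP (row_full A); [left|right].
  move=> u; have /row_fullP[B BA] := fA.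
  have uA : A \in unitmx by rewrite -row_full_unit.
  by have := SA (invmx A *m u); rewrite mulmxA mulmxV// mul1mx.
have : kermx A != 0.
  rewrite kermx_eq0 row_free_unit -row_full_unit.
  by rewrite (negbTE nfA).
move=> /rowV0Pn[c cA c0]; exists c => // u Su; apply/eqP/negPn/negP => cu.
have cA0 : c *m A = 0 by apply/sub_kermxP.
have : good (\rank (A^T + u^T)%MS).
  exists (A^T + u^T)%MS^T; split; last by rewrite mxrank_tr.
  move=> d; have /sub_addsmxP[[x y] /= e] : (d^T *m (A^T + u^T)%MS <= A^T + u^T)%MS.
    exact: submxMl.
  have -> : (A^T + u^T)%MS^T *m d = A *m x^T + u *m y^T.
    by apply: trmx_inj; rewrite trmx_mul trmxK e raddfD /= !trmx_mul !trmxK.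
  rewrite addrC (mx11_scalar y) tr_scalar_mx mul_mx_scalar; apply: SD => //.
move=> /asboolP/rmax; rewrite leqNgt -rA => /negP; apply.
have : (A^T < A^T + u^T)%MS.
  rewrite /ltmx addsmxSl /=; apply/negP => h.
  have /submxP[x ex] : (u^T <= A^T)%MS := submx_trans (addsmxSr _ _) h.
  move/negP: cu; apply; apply/eqP/trmx_inj.
  by rewrite trmx_mul ex -mulmxA -trmx_mul cA0 trmx0 mulmx0 trmx0.
by rewrite ltmxErank => /andP[_]; rewrite mxrank_tr.
Qed.

End Annihilators.

Section OrthogonalComplements.
Variables (C : numClosedFieldType) (n : nat).
Local Notation V := 'rV[C]_n.
Implicit Types (z v : V) (L : {vspace V}).

Definition zperp z : {vspace V} := lker (linfun (mulmxr (conjT z)) : 'Hom(V, 'M[C]_1)).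

Lemma mem_zperp z v : (v \in zperp z) = (dotmx v z == 0).
Proof.
rewrite memv_ker lfunE /= dotmx_conjT; apply/eqP/eqP => [->|h].
  by rewrite mxE.
by rewrite (mx11_scalar (_ *m _)) h raddf0.
Qed.

Lemma dim_zperp L z : z != 0 -> z \in L -> \dim L = (\dim (L :&: zperp z)).+1.
Proof.
move=> z0 zL; have zz := dotmx_neq0 z0.
have cap0 : (<[z]> :&: (L :&: zperp z) = 0)%VS.
  apply/eqP; rewrite -subv0; apply/subvP => v; rewrite !memv_cap mem_zperp memv0.
  move=> /and3P[/vlineP[a ->] _].
  by rewrite dotmxZl mulf_eq0 (negbTE zz) orbF => /eqP ->; rewrite scale0r.
have e : (<[z]> + (L :&: zperp z))%VS = L.
  apply/eqP; rewrite eqEsubv subv_add capvSl -memvE zL /=.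
  apply/subvP => v vL; apply/memv_addP.
  exists ((dotmx v z / dotmx z z) *: z); first by apply/memvZ/memv_line.
  exists (v - (dotmx v z / dotmx z z) *: z); last by rewrite addrC subrK.
  rewrite memv_cap memvB ?memvZ//= mem_zperp dotmxBl dotmxZl divfK ?subrr//.
by rewrite -{1}e dimv_disjoint_sum// dim_vline z0 add1n.
Qed.

End OrthogonalComplements.

Lemma generated_sum (B : comNzRingType) (s : seq B) (x : B) : generated s x ->
  exists c : 'I_(size s) -> B, x = \sum_i c i * s`_i.
Proof.
elim: s x => [|y s IH] x /=; first by move=> ->; exists (fun=> 0); rewrite big_ord0.
move=> [a /IH[c hc]]; exists (fun i => if unlift ord0 i is Some j then c j else a).
rewrite big_ord_recl unlift_none /= -[LHS](subrK (a * y)) addrC hc; congr (_ + _).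
by apply: eq_bigr => i _; rewrite liftK.
Qed.

Section LocalEquations.
Variables (R : realType) (m n : nat).
Local Notation C := (Cplx R).
Local Notation V := 'rV[C]_n.+1.
Local Notation poly := (mpoly n.+1 C).
Variables (Z : set {vspace V}) (L : {vspace V}) (z : V).
Hypotheses (hmn : (m < n)%N) (hZ : irreducible_variety Z) (hdim : dim_variety Z m).
Hypotheses (hL : grass (n - m) L) (hz : z != 0) (hzZ : Z <[z]>%VS) (hzL : z \in L).
Local Notation mnorm := (mnorm (complex_abs R)).

Lemma smooth_tangent_space : smooth_point Z z ->
  exists T : {vspace V}, tangent_variety Z z = [set` T] /\ \dim T = m.
Proof.
move=> [m' [[ch' le'] [T [eT dT]]]]; exists T; split=> //; rewrite dT.
have [ch le] := hdim; apply/eqP; rewrite eqn_leq.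
by rewrite (le _ ch') (le' _ ch).
Qed.

Let LW : {vspace V} := (L :&: zperp z)%VS.

Lemma tangent_linearE : tangent_linear L z = [set` LW].
Proof.
apply/seteqP; split=> v /=.
  by move=> [h vL]; rewrite memv_cap vL mem_zperp; apply/eqP.
by rewrite memv_cap mem_zperp => /andP[vL /eqP].
Qed.

Lemma dim_tangent_linear : \dim LW = (n - m)%N.
Proof. by have := dim_zperp hz hzL; rewrite hL => -[]. Qed.

Lemma dim_tangent_proj : \dim (zperp z) = n.
Proof.
have := dim_zperp hz (memvf z); rewrite capfv dimvf.
by rewrite /dim /= mul1n => -[].
Qed.

Variable T : {vspace V}.
Hypotheses (eT : tangent_variety Z z = [set` T]) (dT : \dim T = m).

Lemma T_perp v : v \in T -> dotmx v z = 0.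
Proof.
by move=> vT; have [] : tangent_variety Z z v by rewrite eT; exact: vT.
Qed.

Let sub_zperp : (T + LW <= zperp z)%VS.
Proof.
rewrite subv_add capvSr andbT; apply/subvP => v vT.
by rewrite mem_zperp T_perp.
Qed.

(** The dimensions m of T and n - m of LW are complementary in T_z P^n. *)
Lemma tangent_sumP : (T + LW = zperp z)%VS <-> (T :&: LW = 0)%VS.
Proof.
have ds := dimv_sum_cap T LW.
rewrite dT dim_tangent_linear subnKC ?(ltnW hmn)// in ds.
split=> h.
  apply/eqP; rewrite -dimv_eq0; move: ds; rewrite h dim_tangent_proj => e0.
  by rewrite -(eqn_add2l n) e0 addn0.
rewrite h dimv0 addn0 in ds.
by apply/eqP; rewrite eqEdim sub_zperp dim_tangent_proj ds leqnn.
Qed.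

Lemma transversal_direct : Defs.transversal Z L z <-> (T :&: LW = 0)%VS.
Proof.
apply: iff_trans tangent_sumP.
rewrite /Defs.transversal eT tangent_linearE; split=> [h|h].
  apply/eqP; rewrite eqEsubv sub_zperp /=; apply/subvP => v.
  rewrite mem_zperp => /eqP vz.
  have : tangent_proj z v := vz.
  rewrite -h => -[a aT [c cL <-]]; apply: memv_add => //.
apply/seteqP; split=> v.
  move=> [a aT [c cL <-]]; have : a + c \in zperp z.
    by rewrite -h memv_add.
  by rewrite mem_zperp => /eqP.
move=> vz; have : v \in zperp z by rewrite mem_zperp; apply/eqP.
by rewrite -h => /memv_addP[a aT [c cL ->]]; exists a => //; exists c.
Qed.

Lemma vanishing_at_z q : vanishes_on q Z -> peval q z = 0.
Proof. by move=> h; apply: (h _ _ hzZ); apply: memv_line. Qed.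

(** The differentials at z of the equations of Z separate the points of T_z L, by
    transversality, so that a basis of its dual can be chosen among them. *)
Lemma dual_equations : (T :&: LW = 0)%VS ->
  exists (p : 'I_(n - m) -> poly) (b : 'M[C]_(n - m, n.+1)),
  [/\ forall j, vanishes_on (p j) Z, b *m sysJ p z = 1%:M,
      forall c, c *m b \in LW & forall v, v \in LW -> exists c, v = c *m b].
Proof.
move=> TL0; have := vspace_rows LW; rewrite dim_tangent_linear.
move=> [b [fb hb]].
pose gr (q : poly) : 'cV[C]_n.+1 := \col_l peval (mderiv l q) z.
have grE q i j : gr q i j = peval (mderiv i q) z by apply: mxE.
pose S u := exists q, vanishes_on q Z /\ u = b *m gr q.
have [Iid0 IidD IidM] := vanishing_ideal Z.
have S0 : S 0.
  exists 0; split=> //; rewrite (_ : gr 0 = 0) ?mulmx0//.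
  by apply/matrixP => i j; rewrite !mxE mderiv0 -mpolyC0 pevalC.
have SD a u v : S u -> S v -> S (a *: u + v).
  move=> [q [Iq ->]] [q' [Iq' ->]]; exists (mpolyC n.+1 a * q + q'); split.
    by apply: IidD => //; apply: IidM.
  rewrite scalemxAr -mulmxDr; congr (_ *m _); apply/matrixP => i j.
  rewrite grE mderivD mderivM mderivC mul0r add0r pevalD pevalM pevalC.
  by rewrite -!(grE _ _ j) mxE; congr (_ + _); rewrite mxE.
have [all|[c c0 hc]] := proper_subspace_annihilator S0 SD.
  have /choice [p hp] : forall j : 'I_(n - m), exists q, vanishes_on q Z /\
      delta_mx j 0 = b *m gr q by move=> j; apply: all.
  exists p, b; split=> [j||c|v vL].
  - by case: (hp j).
  - apply/matrixP => i j; have [_ e] := hp j.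
    have -> : (b *m sysJ p z) i j = (b *m gr (p j)) i 0.
      by rewrite !mxE; apply: eq_bigr => l _; rewrite !mxE.
    by rewrite -e !mxE eqxx andbT.
  - by apply/hb; exists c.
  - exact/hb.
exfalso; move/negP: c0; apply.
have cbL : c *m b \in LW by apply/hb; exists c.
have cbT : c *m b \in T.
  have : tangent_variety Z z (c *m b).
    split; first by move: cbL; rewrite memv_cap mem_zperp => /andP[_ /eqP].
    move=> q Iq; have := hc (b *m gr q) (ex_intro _ q (conj Iq erefl)).
    rewrite mulmxA => /matrixP/(_ 0 0); rewrite !mxE => e; rewrite -[RHS]e.
    by apply: eq_bigr => l _; rewrite [gr _ _ _]mxE mulrC.
  by rewrite eT.
have : c *m b \in (T :&: LW)%VS by rewrite memv_cap cbT cbL.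
rewrite TL0 memv0 => /eqP cb0; apply/eqP.
by move/row_freeP: fb => [B bB]; rewrite -[c]mulmx1 -bB mulmxA cb0 mul0mx.
Qed.

Section LocalEquality.
Variables (p : 'I_(n - m) -> poly) (b : 'M[C]_(n - m, n.+1)).
Hypotheses (pZ : forall j, vanishes_on (p j) Z) (bdf : b *m sysJ p z = 1%:M).

Lemma sys_on_cone l w : Z l -> w \in l -> sys p w = 0.
Proof. by move=> Zl wl; apply/rowP => j; rewrite !mxE; apply: (pZ j Zl). Qed.

(** Since the dimension of Z is m, the n - m equations p_j have independent
    differentials along Z near z, and those of the generators q_l of the ideal of Z
    are combinations of them modulo the q_l, by gradient_combination.  Hence
    vanishing_propagates applies. *)
Lemma locally_complete_intersection : exists2 e : R, 0 < e & forall x,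
  mnorm (x - z) <= e -> x != 0 -> sys p x = 0 -> Z <[x]>%VS.
Proof.
have Iid := vanishing_ideal Z.
have [s sI sgen] := noetherian_mpoly Iid.
pose q (l : 'I_(size s)) := s`_l.
have qI l : vanishes_on (q l) Z by apply: sI; apply: mem_nth.
pose M := map_mx (@mpolyC n.+1 C) b *m jacobian p.
have Mz : peval (\det M) z = 1.
  rewrite -[LHS]/(meval (fun i => z 0 i) (\det M)) -det_map_mx map_mxM.
  rewrite (_ : map_mx _ (map_mx _ b) = b); last first.
    by apply/matrixP => i j; rewrite !mxE /= mevalC.
  rewrite (_ : map_mx _ (jacobian p) = sysJ p z) ?bdf ?det1//.
  by apply/matrixP => i j; rewrite !mxE.
have nM : ~ vanishes_on (\det M) Z.
  by move=> /vanishing_at_z; rewrite Mz => /eqP; rewrite oner_eq0.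
have hfr := chain_frame (proj1 hdim).
have dk : (m.+1 + (n - m))%N = n.+1 by rewrite addSn subnKC// ltnW.
have comb l : exists (a : 'I_(n - m) -> poly) (c : 'I_n.+1 -> 'I_(size s) -> poly),
    forall i, \det M * mderiv i (q l) =
      \sum_j mderiv i (p j) * a j + \sum_l' c i l' * q l'.
  have [a ha] := gradient_combination hZ hfr dk pZ nM (qI l).
  have /choice [c hc] : forall i, exists c : 'I_(size s) -> poly,
      \det M * mderiv i (q l) - (jacobian p *m a) i 0 = \sum_l' c l' * q l'.
    by move=> i; apply: generated_sum; apply: sgen.
  exists (fun j => a j 0), c => i; rewrite -hc.
  have -> : \sum_j mderiv i (p j) * a j 0 = (jacobian p *m a) i 0.
    by rewrite [RHS]mxE; apply: eq_bigr => j _; rewrite mxE.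
  by rewrite addrC subrK.
have Jz : meval (fun i => z 0 i) (\det M) != 0.
  by rewrite -[meval _ _]/(peval (\det M) z) Mz oner_neq0.
have pz : sys p z = 0 := sys_on_cone hzZ (memv_line z).
have qz : sys q z = 0.
  by apply/rowP => l; rewrite !mxE; apply: (vanishing_at_z (qI l)).
have [e e0 he] := vanishing_propagates (complex_abs R) Jz comb bdf pz qz.
exists e => // x hx x0 px; have := he x hx px => qx.
have [cZ _ _] := hZ.
apply: (alg_closedP cZ); first by rewrite dim_vline x0.
move=> f [d fd] fZ l' w -> /vlineP[a ->].
have fx : peval f x = 0.
  have [c ->] := generated_sum (sgen f fZ).
  rewrite peval_sum big1// => i _; rewrite pevalM.
  have /rowP/(_ i) := qx; rewrite !mxE => qi.
  by rewrite [peval _`_i _]qi mulr0.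
by rewrite (peval_homog _ _ fd) fx mulr0.
Qed.

End LocalEquality.

End LocalEquations.

(** * Charts *)

Section Charts.
Variables (R : realType) (C : numClosedFieldType) (cabs : absolute_value R C).
Variable n : nat.
Local Notation mnorm := (mnorm cabs).
Local Notation mnorm_ge0 := (mnorm_ge0 cabs).
Implicit Types (z x : 'rV[C]_n) (A : 'M[C]_n).

Lemma near_affine a (x y : 'M[C]_(a, n)) (e : R) : mnorm x < e ->
  exists2 d : R, 0 < d & forall A, mnorm A < d -> mnorm (x + y *m A) < e.
Proof.
move=> xe; have y0 := mnorm_ge0 y; have y1 : 0 < mnorm y + 1 by lra.
exists ((e - mnorm x) / (mnorm y + 1)); first by rewrite divr_gt0 ?subr_gt0.
move=> A; rewrite ltr_pdivlMr// => h; have A0 := mnorm_ge0 A.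
apply: le_lt_trans (mnormD _ _ _) _; have := mnormM cabs y A; lra.
Qed.

Lemma rank_one_bounded z : exists2 M : R, 0 <= M & forall y : 'rV[C]_n,
  mnorm (rank_one z y) <= M * mnorm y.
Proof.
exists (cabs (dotmx z z)^-1 * mnorm (conjT z)) => [|y].
  by rewrite mulr_ge0 ?cabs_ge0 ?mnorm_ge0.
rewrite mnormZ -mulrA ler_wpM2l ?cabs_ge0//; exact: mnormM.
Qed.

Lemma near_identity_bound z x A (d : R) : d <= 1 / 2 ->
  mnorm (x *m (1%:M + A) - z) <= d -> mnorm A <= d ->
  mnorm (x - z) <= 2 * d * (1 + mnorm z).
Proof.
move=> d1 hx hA; have A0 := mnorm_ge0 A; have z0 := mnorm_ge0 z.
have xz0 := mnorm_ge0 (x - z).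
have e : x - z = (x *m (1%:M + A) - z) - x *m A.
  by rewrite mulmxDr mulmx1 addrAC addrK.
have h1 : mnorm (x - z) <= d + mnorm x * mnorm A.
  rewrite {1}e; apply: le_trans (mnormB _ _ _) _; apply: lerD => //; exact: mnormM.
have h2 : mnorm x <= mnorm z + mnorm (x - z).
  by rewrite -{1}(subrK z x) addrC; apply: mnormD.
have h3 : mnorm x * mnorm A <= (mnorm z + mnorm (x - z)) * d.
  by apply: ler_pM; rewrite ?mnorm_ge0.
have h4 : mnorm (x - z) * d <= mnorm (x - z) * (1 / 2) by rewrite ler_wpM2l.
lra.
Qed.

(** A vector x near z is a multiple of a point z + c' *m b of the affine chart, since
    its component along z is close to 1; b *m J = 1%:M bounds the coordinates c'. *)
Lemma near_chart k z (b : 'M[C]_(k, n)) (J : 'M[C]_(n, k)) (r : R) :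
  z != 0 -> b *m J = 1%:M -> 0 < r ->
  exists2 d : R, 0 < d & forall x A c,
    mnorm (x *m (1%:M + A) - z) <= d -> mnorm A <= d ->
    x - (dotmx x z / dotmx z z) *: z = c *m b ->
    exists beta c', [/\ beta != 0, mnorm c' <= r & x = beta *: (z + c' *m b)].
Proof.
move=> nz bJ r0; have zz := dotmx_neq0 nz; have z0 := mnorm_ge0 z.
have [Mz eM] : exists M, M = mnorm (conjT z) * cabs (dotmx z z)^-1 by eexists.
have M0 : 0 <= Mz by rewrite eM mulr_ge0 ?mnorm_ge0 ?cabs_ge0.
have [S eS] : exists S, S = mnorm J + Mz * mnorm z * mnorm J by eexists.
have J0 := mnorm_ge0 J.
have S0 : 0 <= S by rewrite eS addr_ge0// !mulr_ge0.
have D0 : 0 < 2 * Mz + 2 * S + 1 by lra.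
pose eta := Num.min 1 r / (2 * Mz + 2 * S + 1).
have m0 : 0 < Num.min 1 r by rewrite lt_min ltr01.
have eta0 : 0 < eta by rewrite divr_gt0.
have etaE : eta * (2 * Mz + 2 * S + 1) = Num.min 1 r by rewrite divfK// gt_eqF.
have m1 : Num.min 1 r <= 1 by rewrite ge_min lexx.
have mr : Num.min 1 r <= r by rewrite ge_min lexx orbT.
have eM0 : 0 <= eta * Mz by rewrite mulr_ge0// ltW.
have eS0 : 0 <= eta * S by rewrite mulr_ge0// ltW.
pose d := Num.min (1 / 2) (eta / (2 * (1 + mnorm z))).
exists d; first by rewrite lt_min !divr_gt0//; lra.
move=> x A c hx hA hc.
have d1 : d <= 1 / 2 by rewrite ge_min lexx.
have hxz : mnorm (x - z) <= eta.
  apply: le_trans (near_identity_bound d1 hx hA) _.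
  have : d <= eta / (2 * (1 + mnorm z)) by rewrite ge_min lexx orbT.
  rewrite ler_pdivlMr; last lra.
  by move=> h; lra.
have xz0 := mnorm_ge0 (x - z).
set beta := dotmx x z / dotmx z z in hc.
have b1 : cabs (beta - 1) <= Mz * mnorm (x - z).
  have -> : beta - 1 = dotmx (x - z) z * (dotmx z z)^-1.
    by rewrite dotmxBl mulrBl divff.
  rewrite cabsM eM mulrAC ler_wpM2r ?cabs_ge0// dotmx_conjT mulrC.
  by apply: le_trans (mnorm_entry _ _ _ _) _; apply: mnormM.
have b2 : Mz * mnorm (x - z) <= Mz * eta by rewrite ler_wpM2l.
have bhalf : 1 / 2 <= cabs beta.
  have : 1 <= cabs beta + cabs (beta - 1).
    by rewrite -(cabs1 cabs) -{1}(subrKC beta 1) -(cabsN cabs (beta - 1)) opprB cabsD.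
  lra.
have b0 : beta != 0.
  by apply/eqP => e0; move: bhalf; rewrite e0 cabs0; lra.
have cE : c = (x - z) *m J - (beta - 1) *: z *m J.
  rewrite -[c]mulmx1 -bJ mulmxA -hc -mulmxBl; congr (_ *m _).
  by rewrite scalerBl scale1r opprB addrA subrK.
have nc : mnorm c <= S * mnorm (x - z).
  rewrite cE; apply: le_trans (mnormB _ _ _) _; rewrite eS mulrDl; apply: lerD.
    by rewrite mulrC; apply: mnormM.
  apply: le_trans (mnormM _ _ _) _; rewrite mnormZ.
  have : cabs (beta - 1) * mnorm z * mnorm J <= Mz * mnorm (x - z) * mnorm z * mnorm J.
    by rewrite !ler_wpM2r.
  lra.
exists beta, (beta^-1 *: c); split=> //.
  rewrite mnormZ cabsV; have bp : 0 < cabs beta by lra.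
  rewrite mulrC ler_pdivrMr//; apply: le_trans nc _.
  have h1 : S * mnorm (x - z) <= S * eta by rewrite ler_wpM2l.
  have h2 : r * (1 / 2) <= r * cabs beta by rewrite ler_wpM2l// ltW.
  lra.
by rewrite -scalemxAl -hc scalerDr scalerA divff// scale1r addrC subrK.
Qed.

(** Rescaling u A so that its product with zp is constant amounts to the chart of
    projective space at zp, and A |-> A0 + (1%:M + A0) *m A to a change of base point
    in the Grassmannian. *)
Lemma quadratic_diff_chart (u f : 'M[C]_n -> 'rV[C]_n) A0 (P : 'rV[C]_n) (Q : 'M[C]_n)
    (zp : 'rV[C]_n) (e : R) :
  let s := dotmx (u A0) zp in let a := dotmx zp zp in
  0 < e -> s != 0 -> quadratic_diff cabs u A0 (fun h => P *m h *m Q) ->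
  (forall A, mnorm A < e -> let v := u (A0 + (1%:M + A0) *m A) in
     f A = (a / dotmx v zp) *: v - zp) ->
  quadratic_diff cabs f 0 (fun h => P *m (1%:M + A0) *m h *m
    (Q *m ((a / s)%:M - (a / s ^+ 2) *: (conjT zp *m u A0)))).
Proof.
move=> s a e0; rewrite /s dotmx_conjT => s0 hu hf.
have h1 := quadratic_diff_normalize (y := conjT zp) a s0 hu.
apply: quadratic_diff_congr e0 _ (quadratic_diff_affine h1) => h he.
by rewrite add0r hf// dotmx_conjT.
Qed.

(** The identities that simplify quadratic_diff_chart at A0 = 0 and zp = u 0. *)
Lemma mulmx_shift0 (P : 'rV[C]_n) : P *m (1%:M + 0) = P.
Proof. by rewrite addr0 mulmx1. Qed.

Lemma chart_factor z (a := dotmx z z) : z != 0 ->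
  (a / a)%:M - (a / a ^+ 2) *: (conjT z *m z) = 1%:M - a^-1 *: (conjT z *m z).
Proof.
by move=> nz; rewrite /a expr2 invfM mulrA divff ?mul1r// dotmx_neq0.
Qed.

End Charts.

Section OrthogonalProjector.
Variables (C : numClosedFieldType) (n : nat).
Implicit Types (z w : 'rV[C]_n).

Lemma perp_projector z w : dotmx w z = 0 ->
  w *m (1%:M - (dotmx z z)^-1 *: (conjT z *m z)) = w.
Proof.
move=> h; rewrite mulmxBr mulmx1 -scalemxAr mulmxA (mx11_scalar (w *m conjT z)).
by rewrite -dotmx_conjT h mul_scalar_mx scale0r scaler0 subr0.
Qed.

Lemma mem_perp_part (L : {vspace 'rV[C]_n}) z y : z != 0 -> z \in L -> y \in L ->
  y - (dotmx y z / dotmx z z) *: z \in (L :&: zperp z)%VS.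
Proof.
move=> nz zL yL; rewrite memv_cap memvB ?memvZ//= mem_zperp dotmxBl dotmxZl.
by rewrite divfK ?subrr// dotmx_neq0.
Qed.

End OrthogonalProjector.

Section Grassmannian.
Variables (R : realType) (n : nat).
Local Notation C := (Cplx R).
Local Notation V := 'rV[C]_n.+1.
Local Notation mnorm := (mnorm (complex_abs R)).
Implicit Types (L l : {vspace V}) (A : 'M[C]_n.+1) (v w z : V).

Lemma norm_real_complex (x : C) : `|x| = real_complex R (complex_abs R x).
Proof. by []. Qed.

Lemma real_complex_lt (x y : R) : (real_complex R x < real_complex R y) = (x < y).
Proof. exact: ltcR. Qed.

Lemma near0P a b (Q : 'M[C]_(a, b) -> Prop) :
  (\forall A \near (0 : 'M[C]_(a, b)), Q A) <->
  exists2 e : R, 0 < e & forall B, mnorm B < e -> Q B.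
Proof. exact: (near0_mnorm norm_real_complex real_complex_lt). Qed.

Lemma mem_perturbP L A v :
  v \in perturb L A <-> exists2 x, x \in L & v = x *m (1%:M + A).
Proof.
split=> [/memv_imgP[x xL ->]|[x xL ->]]; first by exists x => //; rewrite lfunE.
by apply/memv_imgP; exists x => //; rewrite lfunE.
Qed.

Lemma perturb_line w A : perturb <[w]> A = <[w *m (1%:M + A)]>%VS.
Proof. by rewrite /perturb limg_line lfunE. Qed.

Lemma perturb0 L : perturb L 0 = L.
Proof.
apply/vspaceP => v; apply/idP/idP => [/mem_perturbP[x xL ->]|vL].
  by rewrite addr0 mulmx1.
by apply/mem_perturbP; exists v => //; rewrite addr0 mulmx1.
Qed.

Lemma perturb_perturb L A A' : perturb (perturb L A) A' = perturb L (A + (1%:M + A) *m A').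
Proof.
have e x : x *m (1%:M + (A + (1%:M + A) *m A')) = x *m (1%:M + A) *m (1%:M + A').
  by rewrite addrA [in RHS]mulmxDr mulmx1 [in LHS]mulmxDr mulmxA.
apply/vspaceP => v; apply/idP/idP => /mem_perturbP.
  by move=> [_ /mem_perturbP[x xL ->] ->]; apply/mem_perturbP; exists x.
move=> [x xL ->]; rewrite e; apply/mem_perturbP; exists (x *m (1%:M + A)) => //.
by apply/mem_perturbP; exists x.
Qed.

Lemma dim_perturb L A : mnorm A <= 1 / 2 -> \dim (perturb L A) = \dim L.
Proof.
move=> hA; apply: limg_dim_eq.
have uA : 1%:M + A \in unitmx by apply: near1_unit; rewrite addrC addKr; exact: hA.
apply/eqP; rewrite -subv0; apply/subvP => v; rewrite memv_cap memv_ker => /andP[_].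
rewrite lfunE /= => /eqP e.
by rewrite memv0 -[v]mulmx1 -(mulmxV uA) mulmxA e mul0mx.
Qed.

Lemma line_eq l w : \dim l = 1%N -> w \in l -> w != 0 -> l = <[w]>%VS.
Proof.
move=> dl wl w0; apply/eqP; rewrite eq_sym eqEdim -memvE wl dim_vline w0 dl.
by [].
Qed.

Lemma line_scale (w v : V) (a : C) : a != 0 -> v != 0 -> w = a *: v ->
  <[w]>%VS = <[v]>%VS.
Proof.
move=> a0 v0 ->; apply: esym; apply: line_eq; first by rewrite dim_vline v0.
  by rewrite memvZ// memv_line.
by rewrite scaler_eq0 negb_or a0.
Qed.

Lemma vpick_line w : w != 0 -> exists2 a : C, a != 0 & vpick <[w]> = a *: w.
Proof.
move=> w0; have /vlineP[a ea] := memv_pick <[w]>.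
exists a => //; apply/eqP => a0; move: ea; rewrite a0 scale0r => /eqP.
by rewrite vpick0 -dimv_eq0 dim_vline w0.
Qed.

(** The chart does not see the scalar by which vpick differs from w. *)
Lemma proj_coord_line z w : w != 0 ->
  proj_coord z <[w]> = (dotmx z z / dotmx w z) *: w - z.
Proof.
move=> w0; have [a a0 e] := vpick_line w0; rewrite /proj_coord e dotmxZl.
by rewrite scalerA invfM (mulrC a^-1) mulrA mulfVK.
Qed.

Lemma grass_open_ball L d (e : R) : e <= 1 / 2 -> grass d L ->
  grass_open d [set L' | exists2 A, mnorm A < e & L' = perturb L A].
Proof.
move=> e1 dL; split=> [_ [A hA ->]|_ [A hA ->]].
  rewrite /grass /= dim_perturb//; apply: le_trans (ltW hA) e1.
have [d' d0 hd] := near_affine (1%:M + A) hA.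
apply/near0P; exists d' => // A' hA'; exists (A + (1%:M + A) *m A').
  exact: hd.
exact: perturb_perturb.
Qed.

Lemma grass_open_lines z (e : R) : e <= mnorm z ->
  grass_open 0 [set l | exists2 w, mnorm (w - z) < e & l = <[w]>%VS].
Proof.
move=> ez; split=> [_ [w hw ->]|_ [w hw ->]].
  rewrite /grass /= dim_vline; case: eqVneq hw => // ->.
  by rewrite sub0r mnormN ltNge ez.
have [d' d0 hd] := near_affine w hw.
apply/near0P; exists d' => // A' hA'; exists (w *m (1%:M + A')).
  by rewrite mulmxDr mulmx1 addrAC; apply: hd.
exact: perturb_line.
Qed.

End Grassmannian.

(** * The solution map *)

Section SolutionMap.
Variables (R : realType) (m n : nat).
Local Notation C := (Cplx R).
Local Notation V := 'rV[C]_n.+1.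
Local Notation poly := (mpoly n.+1 C).
Variables (Z : set {vspace V}) (L : {vspace V}) (z : V).
Hypotheses (hmn : (m < n)%N) (hZ : irreducible_variety Z) (hdim : dim_variety Z m).
Hypotheses (hL : grass (n - m) L) (hz : z != 0) (hzZ : Z <[z]>%VS) (hzL : z \in L).
Local Notation mnorm := (mnorm (complex_abs R)).
Let LW : {vspace V} := (L :&: zperp z)%VS.
Variables (p : 'I_(n - m) -> poly) (b : 'M[C]_(n - m, n.+1)).
Hypotheses (pZ : forall j, vanishes_on (p j) Z) (bdf : b *m sysJ p z = 1%:M).
Hypotheses (bL : forall c, c *m b \in LW) (Lb : forall v, v \in LW -> exists c, v = c *m b).

Let LW_L v : v \in LW -> v \in L.
Proof. by rewrite memv_cap => /andP[]. Qed.

(** Near z the variety is given by the equations p, and a line of the perturbed space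
    near [z] has coordinates c in the chart of near_chart, so that the intersection
    amounts to the system solved by local_solution. *)
Lemma solution_points : exists (u : 'M[C]_n.+1 -> V) (e d K : R),
  [/\ [/\ 0 < e, e <= 1 / 2, 0 < d, d <= mnorm z & 0 <= K], u 0 = z,
    forall A, mnorm A < e -> [/\ u A != 0, Z <[u A]>%VS, mnorm (u A - z) < d,
      mnorm (u A - z) <= K * mnorm A & (<[u A]> <= perturb L A)%VS],
    forall A w, mnorm A < e -> mnorm (w - z) < d -> Z <[w]>%VS ->
      (<[w]> <= perturb L A)%VS -> <[w]>%VS = <[u A]>%VS &
    forall A, mnorm A < e -> exists P Q, quadratic_diff (complex_abs R) u A
      (fun h => P *m h *m Q) /\ (A = 0 -> P = z /\ Q = 1%:M - sysJ p z *m b)].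
Proof.
have pz : sys p z = 0 := sys_on_cone pZ hzZ (memv_line z).
have [c [e1 [r [K [[e10 r0 K0] hu uniq c0 hq]]]]] :=
  local_solution (complex_abs R) bdf pz.
have [e2 e20 he2] := locally_complete_intersection hmn hZ hdim hzZ pZ bdf.
have [d3 d30 hd3] := near_chart (complex_abs R) hz bdf r0.
have z0 : 0 < mnorm z.
  rewrite lt_neqAle mnorm_ge0 andbT eq_sym; apply/eqP => /mnorm0_eq e.
  by move/eqP: hz; apply.
have [d [d0 dz dd3 de2]] : exists d : R, [/\ 0 < d, d <= mnorm z, d <= d3 & d <= e2].
  exists (Num.min (mnorm z) (Num.min d3 e2)); split.
  - by rewrite !lt_min z0 d30.
  - by rewrite ge_min lexx.
  - by rewrite !ge_min lexx orbT.
  - by rewrite !ge_min lexx !orbT.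
have K1 : 0 < K + 1 by rewrite ltr_wpDl.
have [e [e0 ee1 eh ed3 eK]] : exists e : R,
    [/\ 0 < e, e <= e1, e <= 1 / 2, e <= d3 & e * (K + 1) <= d].
  exists (Num.min (Num.min e1 (1 / 2)) (Num.min d3 (d / (K + 1)))); split.
  - by rewrite !lt_min e10 d30 !divr_gt0.
  - by rewrite !ge_min lexx.
  - by rewrite !ge_min lexx !orbT.
  - by rewrite !ge_min lexx !orbT.
  - by rewrite -ler_pdivlMr// !ge_min lexx !orbT.
pose u A := chart_point z b (c A) A.
have uz A : mnorm A < e -> mnorm (u A - z) <= K * mnorm A.
  by move=> /ltW hA; have [] := hu A (le_trans hA ee1).
have ud A : mnorm A < e -> mnorm (u A - z) < d.
  move=> hA; apply: le_lt_trans (uz A hA) _; apply: lt_le_trans eK.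
  apply: (@le_lt_trans _ _ (mnorm A * (K + 1))); last by rewrite ltr_pM2r.
  by rewrite mulrC ler_wpM2l ?mnorm_ge0// lerDl.
have un0 A : mnorm A < e -> u A != 0.
  move=> /ud hA; apply/eqP => uA0; move: hA.
  by rewrite uA0 sub0r mnormN ltNge dz.
exists u, e, d, K; split=> //.
- by rewrite /u /chart_point c0 mul0mx !addr0 mulmx1.
- move=> A hA; have hA1 := le_trans (ltW hA) ee1; have hd := ud A hA.
  split; [exact: un0| |by []|exact: uz|].
    apply: he2; [exact: le_trans (ltW hd) de2|exact: un0|].
    by have [] := hu A hA1.
  rewrite -memvE; apply/mem_perturbP; exists (z + c A *m b) => //.
  by rewrite memvD// LW_L.
- move=> A w hA hw Zw; rewrite -memvE => /mem_perturbP[x xL ew].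
  have [c1 hc1] : exists c1, x - (dotmx x z / dotmx z z) *: z = c1 *m b.
    by apply: Lb; apply: mem_perp_part.
  have [| |beta [c' [b0 hc' ex]]] := hd3 x A c1 _ _ hc1.
  - by rewrite -ew; apply: le_trans (ltW hw) dd3.
  - exact: le_trans (ltW hA) ed3.
  have ewu : w = beta *: chart_point z b c' A by rewrite ew ex -scalemxAl.
  have pc : sys p (chart_point z b c' A) = 0.
    apply: (sys_on_cone pZ Zw); rewrite ewu.
    by apply/vlineP; exists beta^-1; rewrite scalerA mulVf// scale1r.
  have ec := uniq A c' (le_trans (ltW hA) ee1) hc' pc.
  exact: (line_scale b0 (un0 A hA) (etrans ewu (congr1 (fun x => _ *: chart_point z b x A) ec))).
move=> A hA; have := hq A (lt_le_trans hA ee1) => h.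
eexists; eexists; split; first exact: h.
have cp0 : chart_point z b 0 0 = z by rewrite /chart_point mul0mx !addr0 mulmx1.
move=> ->; rewrite c0 cp0 mul0mx !addr0; split=> //.
by rewrite !mulmx1 bdf invmx1 mulmx1.
Qed.

End SolutionMap.

Section SolutionGerm.
Variables (R : realType) (s n : nat).
Local Notation C := (Cplx R).
Local Notation V := 'rV[C]_n.+1.
Local Notation mnorm := (mnorm (complex_abs R)).
Variables (Z : set {vspace V}) (L : {vspace V}) (z : V).
Hypotheses (hL : grass s L) (hz : z != 0).
Variables (u : 'M[C]_n.+1 -> V) (e d K : R) (D : 'M[C]_n.+1).
Hypotheses (e0 : 0 < e) (eh : e <= 1 / 2) (d0 : 0 < d) (dz : d <= mnorm z) (K0 : 0 <= K).
Hypothesis u0 : u 0 = z.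
Hypothesis hu : forall A, mnorm A < e -> [/\ u A != 0, Z <[u A]>%VS,
  mnorm (u A - z) < d, mnorm (u A - z) <= K * mnorm A & (<[u A]> <= perturb L A)%VS].
Hypothesis uniq : forall A w, mnorm A < e -> mnorm (w - z) < d -> Z <[w]>%VS ->
  (<[w]> <= perturb L A)%VS -> <[w]>%VS = <[u A]>%VS.
Hypothesis hq : forall A, mnorm A < e -> exists P Q,
  quadratic_diff (complex_abs R) u A (fun h => P *m h *m Q) /\ (A = 0 -> P = z /\ Q = D).

Let W : set {vspace V} := [set l | exists2 w, mnorm (w - z) < d & l = <[w]>%VS].
Let U : set {vspace V} := [set L' | exists2 A, mnorm A < e & L' = perturb L A].

Lemma unique_solution A : mnorm A < e ->
  [set l | (Z `&` W) l /\ (l <= perturb L A)%VS] = [set <[u A]>%VS].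
Proof.
move=> hA; have [un0 Zu ud _ uL] := hu hA; apply/seteqP; split=> l /=.
  by move=> [[Zl [w hw el]] lL]; rewrite el in Zl lL *; apply: uniq.
by move=> ->; split=> //; split=> //; exists (u A).
Qed.

Definition solve (L' : {vspace V}) : {vspace V} :=
  xget <[z]>%VS [set l | (Z `&` W) l /\ (l <= L')%VS].

Lemma solve_perturb A : mnorm A < e -> solve (perturb L A) = <[u A]>%VS.
Proof. by move=> hA; rewrite /solve unique_solution//; apply: xget_unique. Qed.

(** The matrix A0 is the base point of the Grassmannian where g is differentiated,
    so that the same lemma serves the holomorphy of the solution map and the
    derivative at L. *)
Lemma local_expr_diff g A0 (zp : V) : mnorm A0 < e -> dotmx (u A0) zp != 0 ->
  (exists2 e' : R, 0 < e' & forall A, mnorm A < e' ->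
    let A1 := A0 + (1%:M + A0) *m A in u A1 != 0 /\ g (perturb L A1) = <[u A1]>%VS) ->
  exists P Q, quadratic_diff (complex_abs R) (local_expr g (perturb L A0) zp) 0
      (fun h => P *m h *m Q) /\
    (A0 = 0 -> zp = z -> P = z /\
       Q = D *m (1%:M - (dotmx z z)^-1 *: (conjT z *m z))).
Proof.
move=> hA0 nz [e' e'0 he']; have [P [Q [hPQ hP0]]] := hq hA0.
have := quadratic_diff_chart e'0 nz hPQ => h.
eexists; eexists; split.
  apply: h => A hA v; have [v0 gv] := he' A hA.
  by rewrite /local_expr perturb_perturb gv proj_coord_line.
move=> A00 zpz; have [eP eQ] := hP0 A00; rewrite A00 zpz u0 eP eQ; split.
  exact: mulmx_shift0.
exact: (congr1 (mulmx D) (chart_factor hz)).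
Qed.

Lemma diff_of_quadratic (f : 'M[C]_n.+1 -> V) P Q :
  quadratic_diff (complex_abs R) f 0 (fun h => P *m h *m Q) ->
  differentiable f (0 : 'M[C]_n.+1) /\
  forall h, 'd f (0 : 'M[C]_n.+1) h = P *m h *m Q.
Proof.
move=> h; have [df ef] := quadratic_diff_differentiable
  (@norm_real_complex R) (@real_complex_lt R)
  (L := mulmxr Q \o mulmx P) h.
by split=> // A; rewrite ef.
Qed.

Lemma solve_solution_map : solution_map s Z L z solve.
Proof.
have h0 : mnorm (0 : 'M[C]_n.+1) < e by rewrite mnorm0.
exists U, W; split.
- split; first exact: (grass_open_ball eh hL).
  by exists 0; rewrite ?perturb0.
- split; first exact: (grass_open_lines dz).
  by exists z => //; rewrite subrr mnorm0.
- move=> _ [A0 hA0 ->]; rewrite /holomorphic_at (solve_perturb hA0).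
  have [un0 _ _ _ _] := hu hA0.
  have [a a0 ->] := vpick_line un0.
  have nz : dotmx (u A0) (a *: u A0) != 0.
    by rewrite dotmxZr mulf_neq0 ?dotmx_neq0// conjC_eq0.
  have [|P [Q [hPQ _]]] := local_expr_diff (g := solve) hA0 nz.
    have [d' d'0 hd'] := near_affine (1%:M + A0) hA0.
    exists d' => // A hA; have := hd' A hA => hA1.
    have [un1 _ _ _ _] := hu hA1; split=> //; exact: solve_perturb.
  exact: (proj1 (diff_of_quadratic hPQ)).
move=> _ [A hA ->]; rewrite solve_perturb//; exact: unique_solution.
Qed.

(** For small A the line of u A lies in the neighborhood of [z] that belongs to g, being
    a perturbation of [z] by a matrix of rank one; hence it is the value of g. *)
Lemma solution_map_eq g : solution_map s Z L z g -> exists2 e' : R, 0 < e' &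
  forall A, mnorm A < e' -> u A != 0 /\ g (perturb L A) = <[u A]>%VS.
Proof.
move=> [U' [W' [[[_ oU] UL] [[_ oW] Wz] _ hg]]].
have /near0P[e1 e10 he1] := oU L UL.
have /near0P[e2 e20 he2] := oW _ Wz.
have [M M0 hM] := rank_one_bounded (complex_abs R) z.
have MK : 0 <= M * K by rewrite mulr_ge0.
have MK1 : 0 < M * K + 1 by rewrite ltr_wpDl.
exists (Num.min (Num.min e e1) (e2 / (M * K + 1))).
  by rewrite !lt_min e0 e10 divr_gt0.
move=> A; rewrite !lt_min => /andP[/andP[hA hA1] hA2].
have [un0 Zu _ uK uL] := hu hA; split=> //.
have Wu : W' <[u A]>%VS.
  have -> : <[u A]>%VS = perturb <[z]> (rank_one z (u A - z)).
    rewrite perturb_line mulmxDr mulmx1 mul_rank_one divff ?dotmx_neq0// scale1r.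
    by rewrite addrC subrK.
  apply: he2; apply: le_lt_trans (hM _) _.
  apply: (@le_lt_trans _ _ (mnorm A * (M * K + 1))).
    apply: le_trans (ler_wpM2l M0 uK) _.
    by rewrite mulrA mulrC ler_wpM2l ?mnorm_ge0// lerDl.
  by rewrite -ltr_pdivlMr.
have : [set l | (Z `&` W') l /\ (l <= perturb L A)%VS] <[u A]>%VS by [].
by rewrite hg; [move=> ->|apply: he1].
Qed.

Lemma solution_map_diff g : solution_map s Z L z g -> forall h,
  'd (local_expr g L z) (0 : 'M[C]_n.+1) h =
    z *m h *m (D *m (1%:M - (dotmx z z)^-1 *: (conjT z *m z))).
Proof.
move=> /solution_map_eq[e' e'0 he'].
have h0 : mnorm (0 : 'M[C]_n.+1) < e by rewrite mnorm0.
have nz : dotmx (u 0) z != 0 by rewrite u0 dotmx_neq0.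
have [|P [Q [hPQ hP0]]] := local_expr_diff (g := g) h0 nz.
  by exists e' => // A hA; rewrite add0r addr0 mul1mx; apply: he'.
have [eP eQ] := hP0 erefl erefl; rewrite perturb0 eP eQ in hPQ.
by move=> h; have [_ ->] := diff_of_quadratic hPQ.
Qed.

End SolutionGerm.

(** * The condition number *)

Section Bridges.
Variables (R : realType) (n : nat).
Local Notation C := (Cplx R).
Local Notation V := 'rV[C]_n.+1.
Local Notation cabs := (complex_abs R).

Lemma hnormE (u : V) : hnorm u = l2norm cabs u.
Proof.
rewrite /hnorm; have -> := dotmxx (@norm_real_complex R) u.
rewrite -[complex.Re _]/(l2norm cabs u ^+ 2) sqrtr_sqr ger0_norm//; exact: l2norm_ge0.
Qed.

Lemma frobeniusE (A : 'M[C]_n.+1) : frobenius A = l2norm cabs A.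
Proof.
rewrite /frobenius; have -> := trace_conj (@norm_real_complex R) A.
rewrite -[complex.Re _]/(l2norm cabs A ^+ 2) sqrtr_sqr ger0_norm//; exact: l2norm_ge0.
Qed.

Lemma angleE (u v : V) : Defs.angle u v = ang cabs u v.
Proof. by rewrite /Defs.angle !hnormE. Qed.

Lemma min_angleE (T W : {vspace V}) :
  min_angle [set` T] [set` W] = inf (angles cabs T W).
Proof.
congr (inf _); apply/seteqP; split=> a [v [w [vT v0 wW w0 ->]]]; exists v, w;
  by split=> //; rewrite ?angleE.
Qed.

End Bridges.

Section ConditionNumber.
Variables (R : realType) (m n : nat).
Local Notation C := (Cplx R).
Local Notation V := 'rV[C]_n.+1.
Local Notation poly := (mpoly n.+1 C).
Variables (Z : set {vspace V}) (L : {vspace V}) (z : V).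
Hypotheses (hm : (0 < m)%N) (hmn : (m < n)%N).
Hypotheses (hZ : irreducible_variety Z) (hdim : dim_variety Z m).
Hypotheses (hL : grass (n - m) L) (hz : z != 0) (hzZ : Z <[z]>%VS) (hzL : z \in L).
Variable T : {vspace V}.
Hypotheses (eT : tangent_variety Z z = [set` T]) (dT : \dim T = m).
Let LW : {vspace V} := (L :&: zperp z)%VS.

Lemma angles_nonempty : angles (complex_abs R) T LW !=set0.
Proof.
have pick (W : {vspace V}) : (0 < \dim W)%N -> vpick W \in W /\ vpick W != 0.
  by rewrite lt0n dimv_eq0 memv_pick vpick0.
have [t1 t2] : vpick T \in T /\ vpick T != 0 by apply: pick; rewrite dT.
have [w1 w2] : vpick LW \in LW /\ vpick LW != 0.
  by apply: pick; rewrite (dim_tangent_linear hL hz hzL) subn_gt0.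
by exists (ang (complex_abs R) (vpick T) (vpick LW)), (vpick T), (vpick LW).
Qed.

Lemma hom_perp_image A w : hom_perp L A -> w \in L -> dotmx (z *m A) w = 0.
Proof. by move=> [h _] wL; apply: h. Qed.

Lemma hom_perp_rank_one y : dotmx y z = 0 -> (forall w, w \in LW -> dotmx y w = 0) ->
  hom_perp L (rank_one z y).
Proof.
move=> yz yW; split=> [x w xL wL|w hw]; rewrite mul_rank_one.
  rewrite dotmxZl -(subrK ((dotmx w z / dotmx z z) *: z) w) dotmxDr dotmxZr yz mulr0.
  by rewrite yW ?addr0 ?mulr0//; apply: mem_perp_part.
by rewrite hw// mul0r scale0r.
Qed.

(** Multiplication by 1%:M - sysJ p z *m b projects onto the kernel of the
    differentials of the p_j along LW, and that kernel is T in T_z P^n = T + LW; the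
    last factor is the identity on vectors orthogonal to z. *)
Lemma derivative_tangent (p : 'I_(n - m) -> poly) (b : 'M[C]_(n - m, n.+1)) A :
  (T :&: LW = 0)%VS -> (forall j, vanishes_on (p j) Z) -> b *m sysJ p z = 1%:M ->
  (forall c, c *m b \in LW) -> (forall v, v \in LW -> exists c, v = c *m b) ->
  hom_perp L A ->
  let v := z *m A *m ((1%:M - sysJ p z *m b) *m
    (1%:M - (dotmx z z)^-1 *: (conjT z *m z))) in
  v \in T /\ v - z *m A \in LW.
Proof.
move=> TL0 pZ bdf bL Lb hA v; set J := sysJ p z in bdf v *.
have ev : v = z *m A - z *m A *m J *m b.
  have eD : z *m A *m (1%:M - J *m b) = z *m A - z *m A *m J *m b.
    by rewrite mulmxBr mulmx1 !mulmxA.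
  rewrite /v mulmxA eD; apply: perp_projector; rewrite dotmxBl (hom_perp_image hA hzL) sub0r.
  have := bL (z *m A *m J); rewrite memv_cap mem_zperp => /andP[_ /eqP ->].
  exact: oppr0.
have vW : v - z *m A \in LW.
  by rewrite ev addrAC subrr sub0r -mulNmx.
split=> //; have vJ : v *m J = 0.
  by rewrite ev mulmxBl -(mulmxA _ b) bdf mulmx1 subrr.
have : v \in zperp z.
  rewrite -[v](subrK (z *m A)) memvD//; last first.
    by rewrite mem_zperp (hom_perp_image hA hzL).
  by move: vW; rewrite memv_cap => /andP[].
have [_ h] := tangent_sumP hmn hL hz hzL eT dT.
rewrite -(h TL0) => /memv_addP[t tT [w /Lb[c ec] evtw]].
have tJ : t *m J = 0.
  have [_ ht] : tangent_variety Z z t by rewrite eT; exact: tT.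
  apply/rowP => j; rewrite mxE [RHS]mxE -[RHS](ht (p j) (pZ j)).
  by apply: eq_bigr => i _; rewrite mxE mulrC.
have c0 : c = 0.
  by rewrite -[c]mulmx1 -bdf mulmxA -ec -[RHS]vJ evtw mulmxDl tJ add0r.
by rewrite evtw ec c0 mul0mx addr0.
Qed.

Lemma kappa_transversal : smooth_point Z z -> (T :&: LW = 0)%VS ->
  kappa (n - m) Z L z = ((sin (inf (angles (complex_abs R) T LW)))%:E^-1)%E.
Proof.
move=> hs TL0; rewrite /kappa asboolT; last first.
  
  by split=> //; exact: (proj2 (transversal_direct hmn hL hz hzL eT dT) TL0).
have [p [b [pZ bdf bL Lb]]] := dual_equations hL hz hzL eT TL0.
have [u [e [d [K [[e0 eh d0 dz K0] u0 hu uniq hq]]]]] :=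
  solution_points hmn hZ hdim hz hzZ hzL pZ bdf bL Lb.
have sol := solve_solution_map hL hz e0 eh d0 dz u0 hu uniq hq.
have key g : solution_map (n - m) Z L z g ->
    deriv_norm g L z = ((sin (inf (angles (complex_abs R) T LW)))%:E^-1)%E.
  move=> hg; have dg := solution_map_diff hz e0 K0 u0 hu hq hg.
  rewrite /deriv_norm.
  have <- := @operator_norm_angle R C (complex_abs R) (real_complex R)
    (@norm_real_complex R) (@real_complex_lt R) _ T LW z (hom_perp L)
    (fun A => 'd (local_expr g L z) (0 : 'M[C]_n.+1) A) hz TL0 angles_nonempty.
  - congr (ereal_sup _); apply/seteqP; split=> x [A [h1 h2 ->]]; exists A;
      by move: h2; rewrite ?frobeniusE => h2; split=> //; rewrite !hnormE.
  - move=> A hA; rewrite dg; have [h1 h2] := derivative_tangent TL0 pZ bdf bL Lb hA.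
    split=> // w; rewrite memv_cap => /andP[wL _]; exact: hom_perp_image.
  move=> v w vT wW hvw; apply: hom_perp_rank_one => //.
  rewrite dotmxBl (T_perp eT vT); move: wW; rewrite memv_cap mem_zperp.
  by move=> /andP[_ /eqP ->]; rewrite subr0.
apply: xget_unique; last by move=> x [g hg ->]; apply: key.
by exists (solve Z z d) => //; rewrite key.
Qed.

(** If T and LW meet, the intersection is not transversal and the minimum angle
    vanishes, so that both sides are +oo. *)
Lemma kappa_angle : smooth_point Z z ->
  kappa (n - m) Z L z = ((sin (inf (angles (complex_abs R) T LW)))%:E^-1)%E.
Proof.
move=> hs; have [TL0|TLn] := eqVneq (T :&: LW)%VS 0%VS.
  exact: kappa_transversal.
rewrite /kappa asboolF; last first.
  move=> [_ tr]; have TL0 := proj1 (transversal_direct hmn hL hz hzL eT dT) tr.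
  by move: TLn; rewrite [(_ :&: _)%VS]TL0 eqxx.
have v0 : vpick (T :&: LW)%VS != 0 by rewrite vpick0.
have := memv_pick (T :&: LW)%VS; rewrite memv_cap => /andP[vT vW].
have := sin_inf_common (@norm_real_complex R) (@real_complex_lt R) vT vW v0 => ->.
by rewrite inver eqxx.
Qed.

End ConditionNumber.

(* In \bar R, the inverse of 0%:E is +oo. *)
Theorem theorem1p4 (R : realType) (m n : nat) (hm : (0 < m)%N) (hmn : (m < n)%N)
    (Z : set {vspace 'rV[Cplx R]_n.+1}) (hZ : irreducible_variety Z)
    (hdim : dim_variety Z m)
    (L : {vspace 'rV[Cplx R]_n.+1}) (hL : grass (n - m) L)
    (z : 'rV[Cplx R]_n.+1) (hz : z != 0) (hzZ : Z <[z]>%VS) (hzL : z \in L)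
    (hsmooth : smooth_point Z z) :
  kappa (n - m) Z L z =
    ((sin (min_angle (tangent_variety Z z) (tangent_linear L z)))%:E^-1)%E.
Proof.
have [T [eT dT]] := smooth_tangent_space hdim hsmooth.
rewrite (kappa_angle hm hmn hZ hdim hL hz hzZ hzL eT dT hsmooth).
by rewrite eT tangent_linearE min_angleE.
Qed.
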